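(* Let $\rho_1,\sigma_1$ be density operators on a finite-dimensional Hilbert space and $\rho_2,\sigma_2$ on another. Let $\lambda>0$ and $\epsilon_n=1-\exp(-\lambda n)$. If $[\rho_2,\sigma_2]=0$, then $$\lim_{n\to\infty}R_n^*(\epsilon_n)=\inf_{t_1>1,\;0<t_2<1}\frac{\widetilde D_{t_1}(\rho_1\|\sigma_1)+\left(\frac{t_1}{t_1-1}+\frac{t_2}{1-t_2}\right)\lambda}{D_{t_2}(\rho_2\|\sigma_2)}.$$ For general (not necessarily commuting) $\rho_2,\sigma_2$, $$\limsup_{n\to\infty}R_n^*(\epsilon_n)\le\inf_{t_1>1,\;0<t_2<1}\frac{\widetilde D_{t_1}(\rho_1\|\sigma_1)+\left(\frac{t_1}{t_1-1}+\frac{t_2}{1-t_2}\right)\lambda}{\overline D_{t_2}(\rho_2\|\sigma_2)}.$$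
   Context: $T(\rho,\sigma)=\frac12\|\rho-\sigma\|_1$. $(\rho,\sigma)\succeq_{(\epsilon_\rho,\epsilon_\sigma)}(\rho',\sigma')$ means some quantum channel $\mathcal E$ has $T(\mathcal E(\rho),\rho')\le\epsilon_\rho$, $T(\mathcal E(\sigma),\sigma')\le\epsilon_\sigma$. $R_n^*(\epsilon_n)$ is the largest $R_n$ with $(\rho_1^{\otimes n},\sigma_1^{\otimes n})\succeq_{(\epsilon_n,0)}(\rho_2^{\otimes R_nn},\sigma_2^{\otimes R_nn})$. Petz Rényi $\overline D_\alpha(\rho\|\sigma)=\frac{1}{\alpha-1}\log\mathrm{Tr}(\rho^\alpha\sigma^{1-\alpha})$; minimal (sandwiched) Rényi for $\alpha\ge\frac12$: $\widetilde D_\alpha(\rho\|\sigma)=\frac{1}{\alpha-1}\log\mathrm{Tr}\bigl((\sqrt\rho\,\sigma^{\frac{1-\alpha}{\alpha}}\sqrt\rho)^\alpha\bigr)$; for commuting states these coincide and are written $D_\alpha$. $\exp$ and $\log$ are in the same base. *)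

(* Defs.v *)
From HB Require Import structures.
From mathcomp Require Import all_boot all_order all_algebra.
From mathcomp Require Import complex mxtens.
From mathcomp Require Import all_classical all_reals all_analysis.
Set Implicit Arguments.
Unset Strict Implicit.
Unset Printing Implicit Defensive.
Import Order.TTheory GRing.Theory Num.Theory.
Local Open Scope ring_scope.
Local Open Scope complex_scope.

Section QDefs.
Variable R : realType.
Local Notation C := R[i].

Definition adj m n (A : 'M[C]_(m, n)) : 'M[C]_(n, m) := (map_mx conjc A)^T.

Definition psd n (A : 'M[C]_n) : Prop :=
  A = adj A /\ forall v : 'rV[C]_n, 0 <= (v *m A *m adj v) 0 0.

Definition density n (A : 'M[C]_n) : Prop := psd A /\ \tr A = 1.

(* functional calculus via the (unitary) spectral decomposition
   A = P^-1 diag(d) P; applied to Hermitian matrices (real eigenvalues). *)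
Definition mxfun n (f : R -> R) (A : 'M[C]_n) : 'M[C]_n :=
  invmx (spectralmx A) *m
  diag_mx (\row_i ((f (complex.Re (spectral_diag A 0 i)))%:C)) *m spectralmx A.

(* matrix power, with the convention 0^a = 0 for a <> 0 (generalized inverse
   on the support for negative exponents) *)
Definition mxpow n (A : 'M[C]_n) (a : R) : 'M[C]_n := mxfun (fun x => x `^ a) A.

Definition trnorm m n (A : 'M[C]_(m, n)) : R :=
  \sum_i Num.sqrt (complex.Re (spectral_diag (adj A *m A) 0 i)).
Definition tdist n (A B : 'M[C]_n) : R := 2^-1 * trnorm (A - B).

(* id_k (x) E, acting on 'M_(k * d1) (first tensor factor = ancilla) *)
Definition ampl k d1 d2 (E : 'M[C]_d1 -> 'M[C]_d2) (X : 'M[C]_(k * d1))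
  : 'M[C]_(k * d2) :=
  \matrix_(p, q)
    E (\matrix_(a, a') X (mxtens_index ((mxtens_unindex p).1, a))
                          (mxtens_index ((mxtens_unindex q).1, a')))
      (mxtens_unindex p).2 (mxtens_unindex q).2.

Definition channel d1 d2 (E : 'M[C]_d1 -> 'M[C]_d2) : Prop :=
  [/\ forall (a : C) (X Y : 'M[C]_d1), E (a *: X + Y) = a *: E X + E Y,
      forall X, \tr (E X) = \tr X &
      forall k (X : 'M[C]_(k * d1)), psd X -> psd (ampl E X)].

Definition convertible d1 d2 (rho sigma : 'M[C]_d1) (rho' sigma' : 'M[C]_d2)
  (er es : R) : Prop :=
  exists E : 'M[C]_d1 -> 'M[C]_d2, channel E /\
    tdist (E rho) rho' <= er /\ tdist (E sigma) sigma' <= es.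

Definition Rstar d1 d2 (rho1 sigma1 : 'M[C]_d1) (rho2 sigma2 : 'M[C]_d2)
  (n : nat) (eps : R) : \bar R :=
  ereal_sup [set ((m%:R / n%:R : R)%:E) | m in
    [set m : nat | convertible (ntensmx rho1 n) (ntensmx sigma1 n)
                               (ntensmx rho2 m) (ntensmx sigma2 m) eps 0]].

(* Petz Renyi divergence (used for 0 < a < 1); +oo when Tr = 0 *)
Definition petz n (a : R) (rho sigma : 'M[C]_n) : \bar R :=
  let Q := complex.Re (\tr (mxpow rho a *m mxpow sigma (1 - a))) in
  if Q == 0 then +oo%E else ((ln Q) / (a - 1))%:E.

(* sandwiched (minimal) Renyi divergence (a >= 1/2); +oo for a > 1 when
   supp rho is not contained in supp sigma *)
Definition sandwiched n (a : R) (rho sigma : 'M[C]_n) : \bar R :=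
  if (1 < a) && ~~ (rho <= sigma)%MS then +oo%E else
  let sr := mxpow rho (2^-1) in
  let Q := complex.Re (\tr (mxpow (sr *m mxpow sigma ((1 - a) / a) *m sr) a)) in
  if Q == 0 then +oo%E else ((ln Q) / (a - 1))%:E.

Definition eratio (x y : \bar R) : \bar R :=
  if y == 0%E then +oo%E
  else if y == +oo%E then (if x == +oo%E then +oo%E else 0%E)
  else (x * ((fine y)^-1)%:E)%E.

End QDefs.

(* Main.v *)
(* Converse: data processing, applied to tests pulled back along the channel.
   For 0 <= T <= 1 and a > 1, (tr rho T)^a <= Q~_a(rho|sigma) (tr sigma T)^(a-1),
   while Audenaert's inequality (quantum Chernoff bound) provides a test for the
   target pair whose error is governed by the Petz quantity tr rho^s sigma^(1-s);
   both quantities are multiplicative under tensor powers.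

   Achievability: on blocks of k copies, pinching rho_1 in an eigenbasis of sigma_1
   costs a factor polynomial in k, so the source becomes a classical pair (p, q)
   whose Renyi quantities are nearly the sandwiched ones.  Measuring the typical set
   of an exponential tilt of (p, q) gives tests with tr rho T >= exp(- lambda n) and
   tr sigma T <= exp(- b n), where b is the infimum over t_1.  On outcome T prepare the
   conditioned typical set of a tilt of the commuting target pair, otherwise prepare
   what is missing to reach sigma_2 exactly.  The two tilts are found with the
   intermediate value theorem, which replaces the minimax argument.  If the support
   of rho_1 is not contained in that of sigma_1, any number of copies can be produced. *)
Require Import Defs.
From HB Require Import structures.
From mathcomp Require Import all_boot all_order all_algebra.
From mathcomp Require Import complex mxtens.
From mathcomp Require Import all_classical all_reals all_analysis.
From mathcomp Require Import ring lra.
Set Implicit Arguments.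
Unset Strict Implicit.
Unset Printing Implicit Defensive.
Import Order.TTheory GRing.Theory Num.Theory.
Local Open Scope ring_scope.
Local Open Scope complex_scope.

(** * Spectral calculus for Hermitian matrices *)

(** The error allowed on the first state is almost one and on the second state zero. On the first
    state the output need only share with the target a component of weight e = exp(- lambda n); this
    is why a test followed by two preparations can be optimal. The state [mu] prepared on acceptance
    has to satisfy only e mu <= rho' and q mu <= sigma', where q is the probability that the test
    accepts the second source. The double infimum decouples. Let b be the infimum over t_1 of the
    source terms. A rate r below all quotients satisfies r D_s <= b + s / (1 - s) lambda for every s
    in (0, 1), and this is dual to the existence of one distribution w with r D(w | p) <= lambda and
    r D(w | q) <= b, up to an arbitrarily small loss in r. The blocks have a fixed length k because
    the law of large numbers needs independent copies of one classical pair, and pinching yields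
    such a pair only block by block. The converse uses data processing for tests alone. On the
    source side Hölder and Jensen inequalities under the trace suffice; the target side rests on
    operator monotonicity of x^s for s < 1. *)

Definition dg (R : realType) n (f : 'I_n -> R) : 'M[R[i]]_n := diag_mx (\row_i (f i)%:C).

(* [hc], [psm] and [mpow] are opaque copies of [adj], [psd] and [mxpow]: unification would otherwise unfold them down to matrix entries. *)
HB.lock Definition hc (R : realType) m n (A : 'M[R[i]]_(m, n)) : 'M[R[i]]_(n, m) := adj A.

HB.lock Definition psm (R : realType) n (A : 'M[R[i]]_n) : Prop := psd A.

(** Traces and quadratic forms enter through their real parts, so that inequalities live in the
    ordered field [R]; for Hermitian matrices nothing is lost. *)
HB.lock Definition rtr (R : realType) n (A : 'M[R[i]]_n) : R := @complex.Re R (\tr A).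

HB.lock Definition qf (R : realType) n (A : 'M[R[i]]_n) (v : 'rV[R[i]]_n) : R :=
  @complex.Re R ((v *m A *m hc v) 0 0).

HB.lock Definition spec (R : realType) n (U : 'M[R[i]]_n) (f : 'I_n -> R) : 'M[R[i]]_n :=
  hc U *m dg f *m U.

HB.lock Definition mpow (R : realType) n (A : 'M[R[i]]_n) (a : R) : 'M[R[i]]_n := mxpow A a.

Section Basics.
Variable R : realType.
Local Notation C := R[i].
Local Notation Re := (@complex.Re R).
Local Notation Im := (@complex.Im R).

Lemma hcE m n (A : 'M[C]_(m, n)) i j : hc A i j = (A j i)^*%C.
Proof. by rewrite hc.unlock !mxE. Qed.

Lemma hc_tC m n (A : 'M[C]_(m, n)) : hc A = (map_mx Num.conj A^T).
Proof. by rewrite hc.unlock; apply/matrixP => i j; rewrite !mxE. Qed.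

Lemma hcK m n : cancel (@hc R m n) (@hc R n m).
Proof. by move=> A; rewrite hc.unlock; apply/matrixP => i j; rewrite !mxE conjcK. Qed.

Lemma hcM m n p (A : 'M[C]_(m, n)) (B : 'M[C]_(n, p)) :
  hc (A *m B) = hc B *m hc A.
Proof. by rewrite hc.unlock /adj map_mxM trmx_mul. Qed.

Lemma hcD m n (A B : 'M[C]_(m, n)) : hc (A + B) = hc A + hc B.
Proof. by rewrite hc.unlock /adj map_mxD linearD. Qed.

Lemma hcN m n (A : 'M[C]_(m, n)) : hc (- A) = - hc A.
Proof. by rewrite hc.unlock /adj map_mxN linearN. Qed.

Lemma hcB m n (A B : 'M[C]_(m, n)) : hc (A - B) = hc A - hc B.
Proof. by rewrite hcD hcN. Qed.

Lemma hcZ m n (a : C) (A : 'M[C]_(m, n)) : hc (a *: A) = a^*%C *: hc A.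
Proof. by apply/matrixP => i j; rewrite !(hcE, mxE) rmorphM. Qed.

Lemma hc1 n : hc (1%:M : 'M[C]_n) = 1%:M.
Proof. by rewrite hc.unlock /adj map_mx1 trmx1. Qed.

Lemma ReD (x y : C) : Re (x + y) = Re x + Re y.
Proof. by case: x; case: y. Qed.
Lemma ReN (x : C) : Re (- x) = - Re x.
Proof. by case: x. Qed.
Lemma Re_sum I (r : seq I) (P : pred I) (F : I -> C) :
  Re (\sum_(i <- r | P i) F i) = \sum_(i <- r | P i) Re (F i).
Proof. by apply: (big_morph Re) => //; exact: ReD. Qed.
Lemma ReMr (x : C) (r : R) : Re (x * r%:C) = Re x * r.
Proof. by case: x => a b /=; rewrite mulr0 subr0. Qed.
Lemma ReMl (x : C) (r : R) : Re (r%:C * x) = r * Re x.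
Proof. by rewrite mulrC ReMr mulrC. Qed.
Lemma Re_conj (x : C) : Re x^*%C = Re x.
Proof. by case: x. Qed.

Definition cn2 (z : C) : R := Re z ^+ 2 + Im z ^+ 2.
Lemma cn2E (z : C) : z * z^*%C = (cn2 z)%:C.
Proof. by case: z => a b; apply/eqP; rewrite eq_complex /cn2 /=; apply/andP; split; apply/eqP; ring. Qed.
Lemma cn2_ge0 z : 0 <= cn2 z. Proof. by rewrite addr_ge0 ?sqr_ge0. Qed.
Lemma cn2_conj z : cn2 z^*%C = cn2 z.
Proof. by case: z => a b; rewrite /cn2 /= sqrrN. Qed.
Lemma cn2_eq0 z : cn2 z = 0 -> z = 0.
Proof.
case: z => a b; rewrite /cn2 /= => h.
have /eqP := h; rewrite paddr_eq0 ?sqr_ge0 // !sqrf_eq0 => /andP[/eqP -> /eqP ->].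
by [].
Qed.

Lemma rtrD n (A B : 'M[C]_n) : rtr (A + B) = rtr A + rtr B.
Proof. by rewrite rtr.unlock linearD ReD. Qed.
Lemma rtrN n (A : 'M[C]_n) : rtr (- A) = - rtr A.
Proof. by rewrite rtr.unlock linearN ReN. Qed.
Lemma rtrB n (A B : 'M[C]_n) : rtr (A - B) = rtr A - rtr B.
Proof. by rewrite rtrD rtrN. Qed.
Lemma rtrZ n (r : R) (A : 'M[C]_n) : rtr (r%:C *: A) = r * rtr A.
Proof. by rewrite rtr.unlock linearZ ReMl. Qed.
Lemma rtrC m n (A : 'M[C]_(m, n)) (B : 'M[C]_(n, m)) :
  rtr (A *m B) = rtr (B *m A).
Proof. by rewrite rtr.unlock mxtrace_mulC. Qed.
Lemma rtr0 n : rtr (0 : 'M[C]_n) = 0.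
Proof. by rewrite rtr.unlock mxtrace0. Qed.

Lemma qfD n (A B : 'M[C]_n) v : qf (A + B) v = qf A v + qf B v.
Proof. by rewrite qf.unlock mulmxDr mulmxDl mxE ReD. Qed.
Lemma qfN n (A : 'M[C]_n) v : qf (- A) v = - qf A v.
Proof. by rewrite qf.unlock mulmxN mulNmx mxE ReN. Qed.
Lemma qfB n (A B : 'M[C]_n) v : qf (A - B) v = qf A v - qf B v.
Proof. by rewrite qfD qfN. Qed.
Lemma qfZ n (r : R) (A : 'M[C]_n) v : qf (r%:C *: A) v = r * qf A v.
Proof. by rewrite qf.unlock -scalemxAr -scalemxAl mxE ReMl. Qed.
Lemma qf_sum n I (s : seq I) (P : pred I) (F : I -> 'M[C]_n) v :
  qf (\sum_(i <- s | P i) F i) v = \sum_(i <- s | P i) qf (F i) v.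
Proof.
by apply: (big_morph (fun A => qf A v)) => [A B|]; rewrite ?qfD // qf.unlock mulmx0 mul0mx mxE.
Qed.
Lemma qfM m n (A : 'M[C]_n) (K : 'M[C]_(m, n)) v :
  qf (K *m A *m hc K) v = qf A (v *m K).
Proof. by rewrite qf.unlock hcM !mulmxA. Qed.

Lemma qf_adj n (A : 'M[C]_n) v : qf (hc A) v = qf A v.
Proof.
rewrite qf.unlock; have -> : v *m hc A *m hc v = hc (v *m A *m hc v).
  by rewrite !hcM hcK mulmxA.
by rewrite hcE Re_conj.
Qed.
Lemma rtr_hc n (A : 'M[C]_n) : rtr (hc A) = rtr A.
Proof.
by rewrite rtr.unlock /mxtrace !Re_sum; apply: eq_bigr => i _; rewrite hcE Re_conj.
Qed.
Lemma qf_eigen n (A : 'M[C]_n) v r : v *m A = r%:C *: v -> qf A v = r * qf 1%:M v.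
Proof. by move=> h; rewrite qf.unlock h mulmx1 -scalemxAl mxE ReMl. Qed.

Definition herm n (A : 'M[C]_n) := A = hc A.

Lemma psmE n (A : 'M[C]_n) : psm A = psd A.
Proof. by rewrite psm.unlock. Qed.
Lemma psd_herm n (A : 'M[C]_n) : psm A -> herm A. Proof. by rewrite psm.unlock /herm hc.unlock; case. Qed.
Lemma psd_qf n (A : 'M[C]_n) v : psm A -> 0 <= qf A v.
Proof. by rewrite psm.unlock qf.unlock hc.unlock => -[_ /(_ v)]; rewrite lecE => /andP[]. Qed.
Lemma psdP n (A : 'M[C]_n) : herm A -> (forall v, 0 <= qf A v) -> psm A.
Proof.
rewrite psm.unlock => hA h; split=> [|v]; first by rewrite {1}hA hc.unlock.
have : (v *m A *m hc v) 0 0 = ((v *m A *m hc v) 0 0)^*%C.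
  by rewrite -hcE !hcM hcK -hA mulmxA.
have := h v; rewrite qf.unlock hc.unlock lecE => -> /=; rewrite andbT.
case: (_ 0 0) => a b [] /eqP; rewrite -addr_eq0 -mulr2n mulrn_eq0 /= => /eqP ->.
by [].
Qed.

Lemma hermD n (A B : 'M[C]_n) : herm A -> herm B -> herm (A + B).
Proof. by rewrite /herm hcD => <- <-. Qed.
Lemma hermN n (A : 'M[C]_n) : herm A -> herm (- A).
Proof. by rewrite /herm hcN => <-. Qed.
Lemma hermB n (A B : 'M[C]_n) : herm A -> herm B -> herm (A - B).
Proof. by move=> hA hB; apply: hermD => //; exact: hermN. Qed.
Lemma hermZ n (r : R) (A : 'M[C]_n) : herm A -> herm (r%:C *: A).
Proof. by rewrite /herm hcZ conjc_real => <-. Qed.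
Lemma herm1 n : herm (1%:M : 'M[C]_n). Proof. by rewrite /herm hc1. Qed.
Lemma hermM m n (A : 'M[C]_n) (K : 'M[C]_(m, n)) : herm A -> herm (K *m A *m hc K).
Proof. by rewrite /herm !hcM hcK mulmxA => <-. Qed.

Lemma psdD n (A B : 'M[C]_n) : psm A -> psm B -> psm (A + B).
Proof.
move=> hA hB; apply: psdP; first by apply: hermD; apply: psd_herm.
by move=> v; rewrite qfD addr_ge0 // psd_qf.
Qed.
Lemma psdZ n (r : R) (A : 'M[C]_n) : 0 <= r -> psm A -> psm (r%:C *: A).
Proof.
move=> r0 hA; apply: psdP; first by apply: hermZ; apply: psd_herm.
by move=> v; rewrite qfZ mulr_ge0 // psd_qf.
Qed.
Lemma psdM m n (A : 'M[C]_n) (K : 'M[C]_(m, n)) : psm A -> psm (K *m A *m hc K).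
Proof.
move=> hA; apply: psdP; first by apply: hermM; apply: psd_herm.
by move=> v; rewrite qfM psd_qf.
Qed.

Lemma qf1E n (v : 'rV[C]_n) : qf 1%:M v = \sum_j cn2 (v 0 j).
Proof.
rewrite qf.unlock mulmx1 mxE Re_sum; apply: eq_bigr => j _.
by rewrite hcE cn2E.
Qed.
Lemma psd1 n : psm (1%:M : 'M[C]_n).
Proof.
apply: psdP; first exact: herm1.
by move=> v; rewrite qf1E sumr_ge0 // => j _; exact: cn2_ge0.
Qed.
Lemma psdK m n (K : 'M[C]_(m, n)) : psm (K *m hc K).
Proof. by rewrite -[X in psm X]/(K *m hc K) -{1}(mulmx1 K); apply: psdM; apply: psd1. Qed.
Lemma psd0 n : psm (0 : 'M[C]_n).
Proof. by rewrite -(mul0mx _ (hc (0 : 'M[C]_n))); apply: psdK. Qed.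

Definition unit_mx n (U : 'M[C]_n) := U *m hc U = 1%:M.
Lemma unitV n (U : 'M[C]_n) : unit_mx U -> hc U *m U = 1%:M.
Proof. exact: mulmx1C. Qed.
Lemma unit1 n : unit_mx (1%:M : 'M[C]_n).
Proof. by rewrite /unit_mx hc1 mulmx1. Qed.

Lemma dgE n (f : 'I_n -> R) i j : dg f i j = if i == j then (f i)%:C else 0.
Proof. by rewrite !mxE; case: eqP => [->|]; rewrite ?mulr1n ?mulr0n. Qed.
Lemma hc_dg n (f : 'I_n -> R) : hc (dg f) = dg f.
Proof.
apply/matrixP => i j; rewrite hcE !dgE eq_sym; case: eqP => [->|_]; rewrite ?conjc0 ?conjc_real //.
Qed.
Lemma dgM n (f g : 'I_n -> R) : dg f *m dg g = dg (fun i => f i * g i).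
Proof.
rewrite /dg mulmx_diag; congr diag_mx; apply/rowP => i; rewrite !mxE.
by rewrite rmorphM.
Qed.
Lemma dgD n (f g : 'I_n -> R) : dg f + dg g = dg (fun i => f i + g i).
Proof.
by apply/matrixP => i j; rewrite mxE !dgE; case: eqP; rewrite ?addr0 // rmorphD.
Qed.
Lemma dgZ n (r : R) (f : 'I_n -> R) : r%:C *: dg f = dg (fun i => r * f i).
Proof.
by apply/matrixP => i j; rewrite mxE !dgE; case: eqP; rewrite ?mulr0 // rmorphM.
Qed.
Lemma dg1 n : dg (fun=> 1) = 1%:M :> 'M[C]_n.
Proof. by apply/matrixP => i j; rewrite dgE !mxE; case: eqP. Qed.

Section Spec.
Variables (n : nat) (U : 'M[C]_n).
Hypothesis hU : unit_mx U.
Implicit Types f g : 'I_n -> R.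

Lemma specM f g : spec U f *m spec U g = spec U (fun i => f i * g i).
Proof. by rewrite spec.unlock -dgM !mulmxA -(mulmxA _ U) hU mulmx1. Qed.
Lemma specD f g : spec U f + spec U g = spec U (fun i => f i + g i).
Proof. by rewrite spec.unlock -dgD mulmxDr mulmxDl. Qed.
Lemma specZ r f : r%:C *: spec U f = spec U (fun i => r * f i).
Proof. by rewrite spec.unlock -dgZ -scalemxAr -scalemxAl. Qed.
Lemma specN f : - spec U f = spec U (fun i => - f i).
Proof.
have -> : - spec U f = (-1)%:C *: spec U f by rewrite rmorphN1 scaleN1r.
by rewrite specZ; congr spec; apply/funext => i; rewrite mulN1r.
Qed.
Lemma specB f g : spec U f - spec U g = spec U (fun i => f i - g i).
Proof. by rewrite specN specD. Qed.
Lemma spec1 : spec U (fun=> 1) = 1%:M.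
Proof. by rewrite spec.unlock dg1 mulmx1 unitV. Qed.
Lemma specc r : spec U (fun=> r) = r%:C%:M.
Proof.
rewrite -scalemx1 -spec1 specZ; congr spec; apply/funext => i; by rewrite mulr1.
Qed.
Lemma spec_herm f : herm (spec U f).
Proof. by rewrite /herm spec.unlock !hcM hc_dg hcK mulmxA. Qed.

Lemma qf_spec f v : qf (spec U f) v = \sum_i f i * cn2 ((v *m hc U) 0 i).
Proof.
rewrite spec.unlock qf.unlock !mulmxA -mulmxA -[U in U *m hc v]hcK -hcM.
rewrite mxE Re_sum; apply: eq_bigr => i _.
rewrite hcE /dg mul_mx_diag !mxE.
by rewrite mulrAC cn2E -rmorphM /= mulrC.
Qed.
Lemma rtr_mul_spec (A : 'M[C]_n) f : rtr (A *m spec U f) = \sum_i f i * qf A (row i U).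
Proof.
rewrite spec.unlock mulmxA rtrC !mulmxA rtr.unlock /mxtrace Re_sum; apply: eq_bigr => i _.
rewrite /dg mul_mx_diag !mxE ReMr mulrC qf.unlock; congr (_ * complex.Re _).
rewrite -row_mul mxE; apply: eq_bigr => j _.
by rewrite !hcE !mxE.
Qed.
Lemma rowU i j : (row i U *m hc U) 0 j = (i == j)%:R.
Proof. by rewrite -row_mul hU !mxE. Qed.
Lemma qf_spec_row f i : qf (spec U f) (row i U) = f i.
Proof.
rewrite qf_spec (bigD1 i) //= rowU eqxx big1 ?addr0 => [|j ji].
  by rewrite /cn2 /= expr1n expr0n /= addr0 mulr1.
by rewrite rowU eq_sym (negbTE ji) /cn2 /= !expr0n /= addr0 mulr0.
Qed.
Lemma rtr_spec f : rtr (spec U f) = \sum_i f i.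
Proof.
rewrite -[spec U f]mul1mx rtr_mul_spec; apply: eq_bigr => i _.
by rewrite -spec1 qf_spec_row mulr1.
Qed.
Lemma spec_psdP f : psm (spec U f) <-> forall i, 0 <= f i.
Proof.
split=> [h i|h]; first by rewrite -(qf_spec_row f i) psd_qf.
apply: psdP; first exact: spec_herm.
by move=> v; rewrite qf_spec sumr_ge0 // => i _; rewrite mulr_ge0 ?cn2_ge0.
Qed.
Lemma qf1_unit v : \sum_i cn2 ((v *m hc U) 0 i) = qf 1%:M v.
Proof. by rewrite -spec1 qf_spec; apply: eq_bigr => i _; rewrite mul1r. Qed.
Lemma qf1_row i : qf 1%:M (row i U) = 1.
Proof. by rewrite -spec1 qf_spec_row. Qed.
Lemma rtr_qf (A : 'M[C]_n) : rtr A = \sum_i qf A (row i U).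
Proof.
rewrite -[A in LHS]mulmx1 -spec1 rtr_mul_spec.
by apply: eq_bigr => i _; rewrite mul1r.
Qed.
Lemma row_spec f i : row i U *m spec U f = (f i)%:C *: row i U.
Proof.
rewrite spec.unlock !mulmxA -row_mul hU -row_mul mul1mx.
by apply/rowP => j; rewrite /dg -row_mul mul_diag_mx !mxE.
Qed.
End Spec.

Lemma psd_rtr n (A : 'M[C]_n) : psm A -> 0 <= rtr A.
Proof. by move=> hA; rewrite (rtr_qf (unit1 n)) sumr_ge0 // => i _; exact: psd_qf. Qed.

(** Squared overlaps of two orthonormal bases. They form a doubly stochastic matrix, which turns the
    trace of a product of two spectral matrices into a double sum over eigenvalues, where scalar
    inequalities apply term by term. *)
Definition ovl n (U V : 'M[C]_n) i j := cn2 ((U *m hc V) i j).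
Lemma ovl_ge0 n (U V : 'M[C]_n) i j : 0 <= ovl U V i j. Proof. exact: cn2_ge0. Qed.
Lemma ovlE n (U V : 'M[C]_n) i j : ovl U V i j = cn2 ((row i U *m hc V) 0 j).
Proof. by rewrite /ovl -row_mul [in RHS]mxE. Qed.
Lemma ovlC n (U V : 'M[C]_n) i j : ovl U V i j = ovl V U j i.
Proof. by rewrite /ovl -[U]hcK -hcM hcE cn2_conj hcK. Qed.
Lemma ovl_suml n (U V : 'M[C]_n) i : unit_mx U -> unit_mx V -> \sum_j ovl U V i j = 1.
Proof.
move=> hU hV; under eq_bigr do rewrite ovlE.
by rewrite qf1_unit // qf1_row.
Qed.
Lemma ovl_sumr n (U V : 'M[C]_n) j : unit_mx U -> unit_mx V -> \sum_i ovl U V i j = 1.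
Proof. by move=> hU hV; under eq_bigr do rewrite ovlC; rewrite ovl_suml. Qed.
Lemma qf_spec_ovl n (U V : 'M[C]_n) g i : unit_mx V ->
  qf (spec V g) (row i U) = \sum_j g j * ovl U V i j.
Proof. by move=> hV; rewrite qf_spec //; apply: eq_bigr => j _; rewrite ovlE. Qed.
Lemma rtr_spec_spec n (U V : 'M[C]_n) f g : unit_mx U -> unit_mx V ->
  rtr (spec U f *m spec V g) = \sum_i \sum_j f i * g j * ovl U V i j.
Proof.
move=> hU hV; rewrite rtrC rtr_mul_spec //; apply: eq_bigr => i _.
by rewrite qf_spec_ovl // mulr_sumr; apply: eq_bigr => j _; rewrite mulrA.
Qed.

Lemma spectral_unit_mx n (A : 'M[C]_n) : unit_mx (spectralmx A).
Proof. by have /unitarymxP := spectral_unitarymx A; rewrite /unit_mx hc_tC. Qed.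
Lemma invmx_unit n (U : 'M[C]_n) : unit_mx U -> invmx U = hc U.
Proof.
move=> hU; have uU : U \in unitmx by have [] := mulmx1_unit hU.
by rewrite -[LHS]mulmx1 -hU mulKmx.
Qed.
Lemma normal_spectral n (A : 'M[C]_n) : A *m hc A = hc A *m A ->
  A = hc (spectralmx A) *m diag_mx (spectral_diag A) *m spectralmx A.
Proof.
move=> hA; have /orthomx_spectralP : A \is normalmx.
  by apply/normalmxP; move: hA; rewrite hc_tC.
by rewrite invmx_unit //; exact: spectral_unit_mx.
Qed.
Lemma real_Re (z : C) : z = z^*%C -> z = (Re z)%:C.
Proof.
case: z => a b [] /eqP; rewrite -addr_eq0 -mulr2n mulrn_eq0 /= => /eqP ->.
by [].
Qed.
Lemma herm_spectral n (A : 'M[C]_n) : herm A ->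
  A = spec (spectralmx A) (fun i => Re (spectral_diag A 0 i)).
Proof.
move=> hA; have hn : A *m hc A = hc A *m A by rewrite -hA.
have hU := spectral_unit_mx A.
have e := normal_spectral hn; set U := spectralmx A in hU e *.
set d := spectral_diag A in e *.
rewrite spec.unlock; suff -> : dg (fun i => Re (d 0 i)) = diag_mx d by [].
apply/matrixP => i j; rewrite dgE mxE; case: eqP => [_|_]; last by rewrite mulr0n.
rewrite mulr1n; apply/esym/real_Re.
have : hc (U *m A *m hc U) = U *m A *m hc U by rewrite !hcM hcK -hA mulmxA.
have -> : U *m A *m hc U = diag_mx d.
  by rewrite e !mulmxA hU mul1mx -mulmxA hU mulmx1.
by move/matrixP/(_ i i); rewrite hcE !mxE eqxx !mulr1n => ->.
Qed.

Lemma herm_spec n (A : 'M[C]_n) : herm A -> exists U f, unit_mx U /\ A = spec U f.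
Proof. by move=> hA; exists (spectralmx A); eexists; split; [exact: spectral_unit_mx|exact: herm_spectral]. Qed.
Lemma psd_spec n (A : 'M[C]_n) : psm A ->
  exists U f, [/\ unit_mx U, A = spec U f & forall i, 0 <= f i].
Proof.
move=> hA; have [U [f [hU e]]] := herm_spec (psd_herm hA).
by exists U, f; split=> //; apply/(spec_psdP hU); rewrite -e.
Qed.

(** For commuting Hermitian A and B the matrix A + iB is normal. One unitary diagonalises it, and
    the real and imaginary parts of its eigenvalues are those of A and B. *)
Lemma comm_spec n (A B : 'M[C]_n) : herm A -> herm B -> A *m B = B *m A ->
  exists U f g, [/\ unit_mx U, A = spec U f & B = spec U g].
Proof.
move=> hA hB hAB; pose N := A + 'i%C *: B.
have aN : hc N = A - 'i%C *: B.
  rewrite /N hcD hcZ -hA -hB; congr (_ + _); rewrite -scaleNr; congr (_ *: _).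
  by apply/eqP; rewrite eq_complex /= oppr0 !eqxx.
have hN : N *m hc N = hc N *m N.
  rewrite aN /N !mulmxDl !mulmxDr !mulmxN !mulNmx -!scalemxAl -!scalemxAr hAB.
  by rewrite !addrA; congr (_ - _); rewrite -!addrA; congr (_ + _); rewrite addrC.
have e2 : (2^-1 : C) = (2^-1)%:C by rewrite fmorphV rmorph_nat.
have e := normal_spectral hN; have hU := spectral_unit_mx N.
set U := spectralmx N in e hU; set d := spectral_diag N in e.
have eU : U *m N *m hc U = diag_mx d.
  by rewrite e !mulmxA hU mul1mx -mulmxA hU mulmx1.
have eU' : U *m hc N *m hc U = hc (diag_mx d).
  by rewrite -eU !hcM !hcK mulmxA.
have key (M : 'M[C]_n) f : U *m M *m hc U = dg f -> M = spec U f.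
  by move=> h; rewrite spec.unlock -h !mulmxA (unitV hU) mul1mx -mulmxA (unitV hU) mulmx1.
exists U, (fun i => Re (d 0 i)), (fun i => Im (d 0 i)); split; [exact: hU|apply: key|apply: key].
  have -> : A = 2^-1 *: (N + hc N).
    by rewrite aN /N addrACA subrr addr0 scalerDr -scalerDl -[2^-1]mul1r -splitr scale1r.
  rewrite -scalemxAr -scalemxAl mulmxDr mulmxDl eU eU'.
  apply/matrixP => i j; rewrite !(hcE, mxE) [j == i]eq_sym; case: eqP => [<-|_]; last first.
    by rewrite !mulr0n conjc0 addr0 mulr0.
  rewrite !mulr1n e2; case: (d 0 i) => a b; apply/eqP; rewrite eq_complex /=.
  by apply/andP; split; apply/eqP; field.
have -> : B = (- 'i%C / 2) *: (N - hc N).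
  rewrite aN /N opprB addrC subrKA scalerDr -scalerDl.
  rewrite -mulrDr -[2^-1]mul1r -splitr mulr1 scalerA mulNr.
  have -> : - ('i%C * 'i%C) = 1 :> C; last by rewrite scale1r.
  by apply/eqP; rewrite eq_complex /= !mul0r !mulr0 !mulr1 sub0r opprK addr0 oppr0 !eqxx.
rewrite -scalemxAr -scalemxAl mulmxBr mulmxBl eU eU'.
apply/matrixP => i j; rewrite !(hcE, mxE) [j == i]eq_sym; case: eqP => [<-|_]; last first.
  by rewrite !mulr0n conjc0 subrr mulr0.
rewrite !mulr1n e2; case: (d 0 i) => a b; apply/eqP; rewrite eq_complex /=.
by rewrite /=; apply/andP; split; apply/eqP; field.
Qed.

Lemma mxfunE n (f : R -> R) (A : 'M[C]_n) :
  mxfun f A = spec (spectralmx A) (fun i => f (Re (spectral_diag A 0 i))).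
Proof. by rewrite /mxfun spec.unlock invmx_unit //; exact: spectral_unit_mx. Qed.

(** In the two eigenbases the relation says (f i - g j) W_ij = 0, so a nonzero entry forces f i = g
    j and hence h (f i) = h (g j). This works for an arbitrary function [h]. *)
Lemma spec_intertwine m n (U : 'M[C]_m) (V : 'M[C]_n) f g (W : 'M[C]_(m, n)) (h : R -> R) :
  unit_mx U -> unit_mx V -> spec U f *m W = W *m spec V g ->
  spec U (h \o f) *m W = W *m spec V (h \o g).
Proof.
move=> hU hV e.
have e1 : dg f *m (U *m W *m hc V) = (U *m W *m hc V) *m dg g.
  have -> : dg f *m (U *m W *m hc V) = U *m (spec U f *m W) *m hc V.
    by rewrite spec.unlock !mulmxA hU mul1mx.
  by rewrite e spec.unlock !mulmxA -(mulmxA _ V) hV mulmx1.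
have e2 : dg (h \o f) *m (U *m W *m hc V) = (U *m W *m hc V) *m dg (h \o g).
  apply/matrixP => i j; move/matrixP/(_ i j): e1.
  rewrite /dg !mul_diag_mx !mul_mx_diag !mxE /=.
  set x := \sum_ _ _; rewrite ![x * _]mulrC.
  have [-> _|x0 /(mulIf x0) []] := eqVneq x 0; first by rewrite !mulr0.
  by move=> ->.
rewrite spec.unlock; move: e2.
set W' := U *m W *m hc V => e2.
have -> : W = hc U *m W' *m V.
  by rewrite /W' !mulmxA unitV // mul1mx -mulmxA unitV // mulmx1.
move: W' e2 => {e1}W' e2.
rewrite !mulmxA -(mulmxA _ U) hU mulmx1 -(mulmxA _ V) hV mulmx1.
by rewrite -(mulmxA (hc U)) e2 !mulmxA.
Qed.

(** Intertwining with the identity shows that the functional calculus does not depend on the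
    diagonalisation chosen by [spectralmx]. *)
Lemma mxfun_spec n (U : 'M[C]_n) f h : unit_mx U -> mxfun h (spec U f) = spec U (h \o f).
Proof.
move=> hU; rewrite mxfunE -[LHS]mulmx1.
rewrite [LHS](@spec_intertwine n n _ U _ f 1%:M h) ?mul1mx //; first exact: spectral_unit_mx.
by rewrite mulmx1 -herm_spectral //; exact: spec_herm.
Qed.

Lemma mxfun_intertwine m n (A : 'M[C]_m) (B : 'M[C]_n) (W : 'M[C]_(m, n)) h :
  herm A -> herm B -> A *m W = W *m B -> mxfun h A *m W = W *m mxfun h B.
Proof.
move=> /herm_spec [U [f [hU ->]]] /herm_spec [V [g [hV ->]]] e.
by rewrite (mxfun_spec _ _ hU) (mxfun_spec _ _ hV); apply: spec_intertwine hU hV e.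
Qed.

End Basics.

(** * Trace norm and trace inequalities *)

Section TraceIneq.
Variable R : realType.
Local Notation C := R[i].
Local Notation Re := (@complex.Re R).

Lemma mpow_spec n (U : 'M[C]_n) f (a : R) : unit_mx U ->
  mpow (spec U f) a = spec U (fun i => f i `^ a).
Proof. by move=> hU; rewrite mpow.unlock; exact: mxfun_spec. Qed.

Lemma mpow_psd n (A : 'M[C]_n) (a : R) : psm A -> psm (mpow A a).
Proof.
move=> /psd_spec [U [f [hU -> f0]]]; rewrite (mpow_spec _ _ hU).
by apply/(spec_psdP hU) => i; exact: powR_ge0.
Qed.

Lemma mpow1 n (A : 'M[C]_n) : psm A -> mpow A 1 = A.
Proof.
move=> /psd_spec [U [f [hU -> f0]]]; rewrite (mpow_spec _ _ hU).
by congr spec; apply/funext => i; rewrite powRr1.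
Qed.

(** The side condition excludes b = - a with a nonzero: there the product is the projection on the
    support, whereas the zeroth power is the identity. *)
Lemma mpowD n (A : 'M[C]_n) (a b : R) : psm A -> (a + b != 0) || (a == 0) ->
  mpow A a *m mpow A b = mpow A (a + b).
Proof.
move=> /psd_spec [U [f [hU -> f0]]] h; rewrite !(mpow_spec _ _ hU) (specM hU).
congr spec; apply/funext => i.
case/orP: h => [h|/eqP ->]; first by rewrite powRD // (negbTE h).
by rewrite add0r powRr0 mul1r.
Qed.

Lemma mpowM n (A : 'M[C]_n) (a b : R) : psm A ->
  mpow (mpow A a) b = mpow A (a * b).
Proof.
move=> /psd_spec [U [f [hU -> f0]]]; rewrite !(mpow_spec _ _ hU).
by congr spec; apply/funext => i; rewrite powRrM.
Qed.

Lemma mpowZ n (r : R) (A : 'M[C]_n) (a : R) : 0 <= r -> psm A ->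
  mpow (r%:C *: A) a = (r `^ a)%:C *: mpow A a.
Proof.
move=> r0 /psd_spec [U [f [hU -> f0]]]; rewrite specZ !(mpow_spec _ _ hU) specZ.
by congr spec; apply/funext => i; rewrite powRM.
Qed.

Lemma psd_sqrtE n (T : 'M[C]_n) : psm T -> mpow T 2^-1 *m hc (mpow T 2^-1) = T.
Proof.
move=> hT; rewrite -(psd_herm (mpow_psd _ hT)) mpowD //; last by rewrite -[2^-1]mul1r -splitr oner_eq0.
by rewrite -[2^-1]mul1r -splitr mpow1.
Qed.

Lemma rtr_psdM n (A B : 'M[C]_n) : psm A -> psm B -> 0 <= rtr (A *m B).
Proof.
move=> hA /psd_spec [U [f [hU -> f0]]]; rewrite rtr_mul_spec // sumr_ge0 // => i _.
by rewrite mulr_ge0 ?psd_qf.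
Qed.

Lemma rtr_le n (A B T : 'M[C]_n) : psm (B - A) -> psm T -> rtr (A *m T) <= rtr (B *m T).
Proof. by move=> h hT; rewrite -subr_ge0 -rtrB -mulmxBl rtr_psdM. Qed.

Lemma qf_le n (A B : 'M[C]_n) v : psm (B - A) -> qf A v <= qf B v.
Proof. by move=> h; rewrite -subr_ge0 -qfB psd_qf. Qed.

Lemma rtr_eq0 n (A : 'M[C]_n) : psm A -> rtr A = 0 -> A = 0.
Proof.
move=> /psd_spec [U [f [hU -> f0]]]; rewrite rtr_spec // => /eqP.
rewrite psumr_eq0 // => /allP h; have -> : f = fun=> 0.
  by apply/funext => i; apply/eqP; apply: h; rewrite mem_index_enum.
by rewrite specc // -scalemx1 rmorph0 scale0r.
Qed.

Lemma trnorm_spec n (U : 'M[C]_n) f : unit_mx U -> trnorm (spec U f) = \sum_i `|f i|.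
Proof.
move=> hU; have -> : trnorm (spec U f) = rtr (mxfun Num.sqrt (hc (spec U f) *m spec U f)).
  by rewrite mxfunE hc.unlock (rtr_spec (spectral_unit_mx _)).
rewrite -(spec_herm U f) specM // mxfun_spec // rtr_spec //.
by apply: eq_bigr => i _ /=; rewrite -expr2 sqrtr_sqr.
Qed.

Lemma tdist_effect n (A B T : 'M[C]_n) e : herm A -> herm B -> rtr A = rtr B ->
  tdist A B <= e -> psm T -> psm (1%:M - T) -> rtr (A *m T) <= rtr (B *m T) + e.
Proof.
move=> hA hB tAB he hT hT1; rewrite -lerBlDl -rtrB -mulmxBl; apply: le_trans he.
have := hermB hA hB; have : rtr (A - B) = 0 by rewrite rtrB tAB subrr.
rewrite /tdist; move: (A - B) => H h0 /herm_spec [U [f [hU eH]]].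
move: h0; rewrite eH trnorm_spec // rtr_spec // => h0.
rewrite rtrC rtr_mul_spec //.
(* The difference H has trace zero, so half its trace norm is the sum of (|f i| + f i) / 2, that is,
   the trace of its positive part. *)
rewrite -[X in _ <= _ * X]addr0 -[X in _ + X]h0 -big_split /= mulr_sumr.
apply: ler_sum => i _.
have t0 : 0 <= qf T (row i U) by exact: psd_qf.
have t1 : qf T (row i U) <= 1 by rewrite -(qf1_row hU i); apply: qf_le.
have [fi|fi] := lerP 0 (f i).
  by rewrite ger0_norm // mulrDr -mulrDl -[2^-1]mul1r -splitr mul1r; exact: ler_piMr.
by rewrite ltr0_norm // addNr mulr0 mulr_le0_ge0 // ltW.
Qed.

(** Any splitting of A - B into a difference of positive matrices bounds the distance, so the
    eigenvalues of A - B never have to be computed. *)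
Lemma tdist_le n (A B A' B' : 'M[C]_n) e : psm A' -> psm B' -> A - B = A' - B' ->
  rtr A' + rtr B' <= 2 * e -> tdist A B <= e.
Proof.
move=> hA hB eAB he; rewrite /tdist eAB.
have [U [f [hU eH]]] := herm_spec (hermB (psd_herm hA) (psd_herm hB)).
rewrite eH trnorm_spec // -(ler_pM2l (_ : 0 < 2)) // mulrA divff ?mul1r ?pnatr_eq0 //.
apply: le_trans he; rewrite !(rtr_qf hU) -big_split /=; apply: ler_sum => i _.
rewrite -(qf_spec_row hU f) -eH qfB.
by rewrite (le_trans (ler_normB _ _)) // !ger0_norm ?psd_qf.
Qed.

(** * Jensen, Young and Hölder inequalities under the trace *)

Lemma bernoulli_powR (x b : R) : 0 <= x -> 1 < b -> b * x <= x `^ b + (b - 1).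
Proof.
move=> x0 b1; have b0 : 0 < b by apply: lt_trans b1.
have b10 : 0 < b - 1 by rewrite subr_gt0.
have := @conjugate_powR R x 1 b (b / (b - 1)) x0 ler01 b0.
rewrite mulr1 powR1 div1r invf_div => /(_ (divr_gt0 b0 b10)) h.
have {h} : x <= x `^ b / b + (b - 1) / b by apply: h; field; rewrite gt_eqF.
by rewrite -mulrDl ler_pdivlMr // mulrC.
Qed.

(** Bernoulli's inequality at each a_j / y, where y is the weighted mean. Weights of total below one
    are allowed, since this only shrinks the subtracted term (b - 1) y^b; contractions, which
    shorten eigenvectors, require it. *)
Lemma jensen_powR n (c a : 'I_n -> R) b : 1 < b -> (forall j, 0 <= c j) ->
  (forall j, 0 <= a j) -> \sum_j c j <= 1 ->
  (\sum_j c j * a j) `^ b <= \sum_j c j * a j `^ b.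
Proof.
move=> b1 c0 a0 c1; have b0 : 0 < b by apply: lt_trans b1.
set y := \sum_j _ * a j.
have y0 : 0 <= y by apply: sumr_ge0 => j _; rewrite mulr_ge0.
have [->|yn] := eqVneq y 0.
  rewrite powR0 ?gt_eqF //; apply: sumr_ge0 => j _; by rewrite mulr_ge0 ?powR_ge0.
have yp : 0 < y by rewrite lt_neqAle eq_sym yn.
have key j : c j * (b * (y `^ b / y) * a j - (b - 1) * y `^ b) <= c j * a j `^ b.
  apply: ler_wpM2l => //.
  have := @bernoulli_powR (a j / y) b (divr_ge0 (a0 j) y0) b1.
  rewrite powRM ?invr_ge0 //.
  have -> : y^-1 `^ b = (y `^ b)^-1 by rewrite -powR_inv1 // -powRrM mulN1r powRN.
  have := powR_gt0 b yp; set Y := y `^ b; move=> Y0 h.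
  have := ler_wpM2r (ltW Y0) h; rewrite mulrDl divfK ?gt_eqF //.
  have -> : b * (Y / y) * a j = b * (a j / y) * Y by ring.
  lra.
apply: le_trans (ler_sum _ (fun j _ => key j)).
have -> : \sum_(i < n) c i * (b * (y `^ b / y) * a i - (b - 1) * y `^ b) =
   b * (y `^ b / y) * y - (b - 1) * y `^ b * \sum_i c i.
  rewrite {4}/y !mulr_sumr -sumrB; apply: eq_bigr => i _; ring.
rewrite -mulrA divfK ?gt_eqF //.
have : (b - 1) * y `^ b * \sum_i c i <= (b - 1) * y `^ b * 1.
  by apply: ler_wpM2l => //; rewrite mulr_ge0 ?powR_ge0 // subr_ge0 ltW.
lra.
Qed.

(** An eigenvalue of K A K^* is the quadratic form of A at an eigenvector multiplied by K, a vector
    of norm at most one. Jensen's inequality for its weights in an eigenbasis of A gives the bound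
    eigenvalue by eigenvalue. *)
Lemma rtr_pow_contr n (A K : 'M[C]_n) b : 1 < b -> psm A -> psm (1%:M - K *m hc K) ->
  rtr (mpow (K *m A *m hc K) b) <= rtr (K *m mpow A b *m hc K).
Proof.
move=> b1 hA hK; have [U [h [hU eh h0]]] := psd_spec (psdM K hA).
have [V [a [hV eA a0]]] := psd_spec hA.
rewrite eh mpow_spec // rtr_spec // (rtr_qf hU) ; apply: ler_sum => i _.
rewrite qfM -(qf_spec_row hU h i) -eh qfM eA mpow_spec // !qf_spec //.
under eq_bigr do rewrite mulrC.
under [leRHS]eq_bigr do rewrite mulrC.
apply: jensen_powR => // [j|]; first exact: cn2_ge0.
rewrite qf1_unit // -(qf1_row hU i) -qfM mulmx1.
exact: qf_le.
Qed.

(** For b > 1 the power is in general not operator monotone, but its trace is monotone: each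
    eigenvalue of X is at most the quadratic form of Y at the same eigenvector, and Jensen's
    inequality moves the power inside. *)
Lemma rtr_pow_le n (X Y : 'M[C]_n) b : 1 < b -> psm X -> psm Y -> psm (Y - X) ->
  rtr (mpow X b) <= rtr (mpow Y b).
Proof.
move=> b1 hX hY hXY; have [U [h [hU eh h0]]] := psd_spec hX.
have [V [a [hV eA a0]]] := psd_spec hY.
rewrite eh mpow_spec // rtr_spec // (rtr_qf hU) ; apply: ler_sum => i _.
rewrite eA mpow_spec // qf_spec //.
apply: (@le_trans _ _ ((qf Y (row i U)) `^ b)).
  apply: ge0_ler_powR; rewrite ?nnegrE ?psd_qf //; first by rewrite (le_trans _ (ltW b1)).
  by rewrite -(qf_spec_row hU h i) -eh qf_le.
rewrite eA qf_spec //.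
under eq_bigr do rewrite mulrC.
under [leRHS]eq_bigr do rewrite mulrC.
apply: jensen_powR => // [j|]; first exact: cn2_ge0.
by rewrite qf1_unit // qf1_row.
Qed.

Lemma mpow_S n (A : 'M[C]_n) (a : R) : 0 < a -> psm A -> mpow A a = A *m mpow A (a - 1).
Proof.
move=> a0 /psd_spec [U [f [hU -> f0]]]; rewrite !(mpow_spec _ _ hU) (specM hU).
by congr spec; apply/funext => i; rewrite mulr_powRB1.
Qed.

(** One factor is split off the power; the remaining power of exponent a - 1 is carried across K,
    since K intertwines [hc K *m K] with [K *m hc K]. *)
Lemma rtr_pow_swap n (K : 'M[C]_n) (a : R) : 0 < a ->
  rtr (mpow (K *m hc K) a) = rtr (mpow (hc K *m K) a).
Proof.
move=> a0; have h1 := psdK K; have := psdK (hc K); rewrite hcK => h2.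
rewrite (mpow_S a0 h1) (mpow_S a0 h2) -mulmxA rtrC -mulmxA; congr rtr.
rewrite -mulmxA; congr (_ *m _).
by rewrite mpow.unlock; apply: mxfun_intertwine; [exact: psd_herm|exact: psd_herm|rewrite mulmxA].
Qed.

Lemma young_rtr n (X Y : 'M[C]_n) p q : 0 < p -> 0 < q -> p^-1 + q^-1 = 1 ->
  psm X -> psm Y ->
  rtr (X *m Y) <= rtr (mpow X p) / p + rtr (mpow Y q) / q.
Proof.
move=> p0 q0 pq /psd_spec [U [f [hU -> f0]]] /psd_spec [V [g [hV -> g0]]].
rewrite !mpow_spec // !rtr_spec // rtr_spec_spec //.
rewrite !mulr_suml.
have -> : \sum_i f i `^ p / p = \sum_i \sum_j f i `^ p / p * ovl U V i j.
  by apply: eq_bigr => i _; rewrite -mulr_sumr ovl_suml // mulr1.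
have -> : \sum_j g j `^ q / q = \sum_i \sum_j g j `^ q / q * ovl U V i j.
  by rewrite exchange_big; apply: eq_bigr => j _; rewrite -mulr_sumr ovl_sumr // mulr1.
rewrite -big_split /=; apply: ler_sum => i _; rewrite -big_split /=; apply: ler_sum => j _.
by rewrite -mulrDl ler_wpM2r ?ovl_ge0 // conjugate_powR.
Qed.

Lemma rtr_pow_eq0 n (X : 'M[C]_n) p : p != 0 -> psm X -> rtr (mpow X p) = 0 -> X = 0.
Proof.
move=> p0 /psd_spec [U [f [hU -> f0]]]; rewrite mpow_spec // rtr_spec // => /eqP.
rewrite psumr_eq0 => [/allP h|i _]; last exact: powR_ge0.
have -> : f = fun=> 0.
  apply/funext => i; apply/(@powR_eq0_eq0 _ _ p)/eqP.
  by apply: h; rewrite mem_index_enum.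
by rewrite specc // -scalemx1 rmorph0 scale0r.
Qed.

(** Young's inequality becomes Hölder's by scaling: c = P^(-1/a) and d = Q^(-1/b), with b = a / (a -
    1), make the right side 1/a + 1/b = 1. *)
Lemma young_opt (x P Q a : R) : 1 < a -> 0 <= x -> 0 < P -> 0 < Q ->
  (forall c d, 0 < c -> 0 < d ->
     c * d * x <= c `^ a * P / a + d `^ (a / (a - 1)) * Q / (a / (a - 1))) ->
  x `^ a <= P * Q `^ (a - 1).
Proof.
move=> a1 x0 Pp Qp; have a0 : 0 < a by apply: lt_trans a1.
have a10 : 0 < a - 1 by rewrite subr_gt0.
set b := a / (a - 1); have b0 : 0 < b by rewrite divr_gt0.
have ab : a^-1 + b^-1 = 1 by rewrite /b invf_div; field; rewrite gt_eqF.
move=> /(_ (P `^ (- a^-1)) (Q `^ (- b^-1)) (powR_gt0 _ Pp) (powR_gt0 _ Qp)).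
rewrite -!powRrM !mulNr !mulVf ?gt_eqF // !powR_inv1 ?(ltW Pp) ?(ltW Qp) //.
rewrite !mulVf ?gt_eqF // !mul1r ab !powRN -invfM ler_pdivrMl ?mulr_gt0 ?powR_gt0 // mulr1 => h.
apply: (le_trans (ge0_ler_powR (ltW a0) _ _ h)); rewrite ?nnegrE ?mulr_ge0 ?powR_ge0 //.
rewrite powRM ?powR_ge0 // -!powRrM mulVf ?gt_eqF // powRr1 ?(ltW Pp) //.
by rewrite /b invf_div mulfVK ?gt_eqF.
Qed.

Lemma holder_rtr n (X Y : 'M[C]_n) (a : R) : 1 < a -> psm X -> psm Y ->
  (rtr (X *m Y)) `^ a <= rtr (mpow X a) * rtr (mpow Y (a / (a - 1))) `^ (a - 1).
Proof.
move=> a1 hX hY; have a0 : 0 < a by apply: lt_trans a1.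
have a10 : 0 < a - 1 by rewrite subr_gt0.
have b0 : 0 < a / (a - 1) by rewrite divr_gt0.
have [P00|Pn] := eqVneq (rtr (mpow X a)) 0.
  by rewrite P00 mul0r (rtr_pow_eq0 _ hX P00) ?gt_eqF // mul0mx rtr0 powR0 ?gt_eqF.
have [Q00|Qn] := eqVneq (rtr (mpow Y (a / (a - 1)))) 0.
  rewrite (rtr_pow_eq0 _ hY Q00) ?gt_eqF // mulmx0 rtr0 powR0 ?gt_eqF //.
  by apply: mulr_ge0; [apply: psd_rtr; apply: mpow_psd|apply: powR_ge0].
apply: young_opt => //.
- exact: rtr_psdM.
- by rewrite lt0r Pn; apply: psd_rtr; apply: mpow_psd.
- by rewrite lt0r Qn; apply: psd_rtr; apply: mpow_psd.
move=> c d c0 d0.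
have hc := psdZ (ltW c0) hX; have hd := psdZ (ltW d0) hY.
have ab : a^-1 + (a / (a - 1))^-1 = 1 by rewrite invf_div; field; rewrite gt_eqF.
have := young_rtr a0 b0 ab hc hd.
rewrite (mpowZ _ (ltW c0) hX) (mpowZ _ (ltW d0) hY) (rtrZ (c `^ a)) (rtrZ (d `^ _)).
by rewrite -scalemxAl -scalemxAr (rtrZ c) (rtrZ d) mulrA.
Qed.

Lemma sub_supp n (rho sigma : 'M[C]_n) (V : 'M[C]_n) s : unit_mx V -> sigma = spec V s ->
  (rho <= sigma)%MS -> rho *m spec V (fun i => (s i != 0)%:R) = rho.
Proof.
move=> hV -> /submxP [D ->]; rewrite -mulmxA (specM hV); congr (_ *m spec _ _).
by apply/funext => i; case: eqP => [->|_]; rewrite ?mul0r ?mulr1.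
Qed.

(** * The sandwiched quantity and its bound on tests *)

Definition sandQ n (a : R) (rho sigma : 'M[C]_n) : R :=
  rtr (mpow (mpow rho 2^-1 *m mpow sigma ((1 - a) / a) *m mpow rho 2^-1) a).

(** Exchanging the factors of K K^* with K = rho^(1/2) sigma^((1-a)/(2a)) gives a form in which
    [rho] appears linearly inside the power, as both the Hölder argument and pinching require. *)
Lemma sandQ_GrG n (a : R) (rho sigma : 'M[C]_n) : 1 < a -> psm rho -> psm sigma ->
  sandQ a rho sigma =
  rtr (mpow (mpow sigma ((1 - a) / a / 2) *m rho *m mpow sigma ((1 - a) / a / 2)) a).
Proof.
move=> a1 hr hs; have a0 : 0 < a by apply: lt_trans a1.
set G := mpow sigma _; set r := mpow rho 2^-1.
have hG : psm G by exact: mpow_psd.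
have hrr : psm r by exact: mpow_psd.
have eG : mpow sigma ((1 - a) / a) = G *m G.
  rewrite (mpowD hs) -splitr //.
  by rewrite mulf_neq0 ?invr_neq0 ?(gt_eqF a0) // subr_eq0 lt_eqF.
have er : r *m r = rho by rewrite -[RHS](psd_sqrtE hr) -(psd_herm hrr).
rewrite /sandQ -/r eG; have eK : hc (r *m G) = G *m r.
  by rewrite hcM -(psd_herm hrr) -(psd_herm hG).
have -> : r *m (G *m G) *m r = (r *m G) *m hc (r *m G) by rewrite eK !mulmxA.
by rewrite rtr_pow_swap // eK -!mulmxA (mulmxA r) er !mulmxA.
Qed.

(** The trace of rho T is that of (G rho G)(G' T G'), with G' the inverse of G on the support of
    sigma. Hölder's inequality produces [sandQ] from the first factor. In the second, exchanging
    factors gives t sigma^(1/b) t with the contraction t = T^(1/2), and the trace Jensen inequality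
    bounds its b-th power by t sigma t. *)
Lemma test_ineq n (a : R) (rho sigma T : 'M[C]_n) : 1 < a -> psm rho -> psm sigma ->
  (rho <= sigma)%MS -> psm T -> psm (1%:M - T) ->
  rtr (rho *m T) `^ a <= sandQ a rho sigma * rtr (sigma *m T) `^ (a - 1).
Proof.
move=> a1 hr hs hsub hT hT1; have a0 : 0 < a by apply: lt_trans a1.
have a10 : 0 < a - 1 by rewrite subr_gt0.
set b := a / (a - 1); have b1 : 1 < b by rewrite /b ltr_pdivlMr // mul1r ltrBlDr ltrDl.
have b0 : 0 < b by apply: lt_trans b1.
rewrite sandQ_GrG //; set G := mpow sigma _.
pose G' := mpow sigma ((a - 1) / a / 2).
have hG : psm G by exact: mpow_psd.
have hG' : psm G' by exact: mpow_psd.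
(* The product G G' is only the projection on the support of sigma; it fixes [rho] because of the
   support inclusion. *)
have e1 : rho *m (G *m G') = rho.
  have [V [s [hV es s0]]] := psd_spec hs.
  rewrite /G /G' es !mpow_spec // specM // -[RHS](sub_supp hV es hsub).
  congr (_ *m spec _ _); apply/funext => i.
  rewrite -opprB !mulNr powRN; case: eqP => [->|/eqP si].
    by rewrite powR0 ?mulr0 // !mulf_neq0 ?invr_neq0 ?gt_eqF.
  by rewrite mulVf // powR_eq0 negb_and si.
have e2 : G' *m G *m rho = rho.
  by rewrite (psd_herm hr) (psd_herm hG) (psd_herm hG') -!hcM e1.
have -> : rtr (rho *m T) = rtr ((G *m rho *m G) *m (G' *m T *m G')).
  have -> : G *m rho *m G *m (G' *m T *m G') = G *m (rho *m (G *m G') *m T *m G').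
    by rewrite !mulmxA.
  rewrite e1 (rtrC G).
  have -> : rho *m T *m G' *m G = rho *m (T *m (G' *m G)) by rewrite !mulmxA.
  by rewrite (rtrC rho (T *m _)) -(mulmxA T) e2 (rtrC T).
apply: (le_trans (holder_rtr a1 _ _)).
- by rewrite (psd_herm hG) {2}/G -(psd_herm hG); have := psdM G hr; rewrite -(psd_herm hG).
- by have := psdM G' hT; rewrite -(psd_herm hG').
apply: ler_wpM2l.
  by apply: psd_rtr; apply: mpow_psd; have := psdM G hr; rewrite -(psd_herm hG).
apply: ge0_ler_powR; rewrite ?nnegrE ?(ltW a10) //.
- by apply: psd_rtr; apply: mpow_psd; have := psdM G' hT; rewrite -(psd_herm hG').
- exact: rtr_psdM.
set t := mpow T 2^-1; have ht : psm t by exact: mpow_psd.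
have et : t *m t = T by rewrite -[RHS](psd_sqrtE hT) -(psd_herm ht).
have eL : hc (G' *m t) = t *m G' by rewrite hcM -(psd_herm ht) -(psd_herm hG').
have -> : G' *m T *m G' = (G' *m t) *m hc (G' *m t) by rewrite eL -et !mulmxA.
rewrite -/b rtr_pow_swap // eL.
have -> : t *m G' *m (G' *m t) = t *m mpow sigma b^-1 *m hc t.
  rewrite -(psd_herm ht) -!mulmxA; congr (_ *m _); rewrite mulmxA; congr (_ *m _).
  rewrite mpowD //; first by rewrite -splitr /b invf_div.
  by rewrite -splitr mulf_neq0 ?invr_neq0 ?lt0r_neq0.
apply: le_trans (rtr_pow_contr b1 (mpow_psd _ hs) _) _.
  by rewrite -(psd_herm ht) et.
rewrite mpowM // mulVf ?gt_eqF // mpow1 // -(psd_herm ht).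
by rewrite -mulmxA rtrC -mulmxA et.
Qed.

End TraceIneq.

(** * Operator monotonicity and the quantum Chernoff inequality *)

Import numFieldNormedType.Exports.
Local Open Scope classical_set_scope.
Local Open Scope ring_scope.
Local Open Scope complex_scope.

Section Loewner.
Variable R : realType.
Local Notation C := R[i].

Lemma qf_amgm n (K1 K2 : 'M[C]_n) v :
  2 * qf (K1 *m hc K2) v <= qf (K1 *m hc K1) v + qf (K2 *m hc K2) v.
Proof.
have := psd_qf v (psdK (K1 - K2)).
rewrite hcB mulmxBl !mulmxBr !qfB.
have -> : qf (K2 *m hc K1) v = qf (K1 *m hc K2) v by rewrite -qf_adj hcM hcK.
lra.
Qed.

Lemma qf1_eq0 n (v : 'rV[C]_n) : qf 1%:M v = 0 -> v = 0.
Proof.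
rewrite qf1E => /eqP; rewrite psumr_eq0 => [/allP h|j _]; last exact: cn2_ge0.
apply/rowP => j; rewrite mxE; apply: cn2_eq0; apply/eqP.
by apply: h; rewrite mem_index_enum.
Qed.

Lemma mpow0 n (A : 'M[C]_n) : psm A -> mpow A 0 = 1%:M.
Proof.
move=> /psd_spec [U [f [hU -> f0]]]; rewrite mpow_spec // -(spec1 hU).
by congr spec; apply/funext => i; rewrite powRr0.
Qed.

Section Pos.
Variables (n : nat) (A V : 'M[C]_n) (b : 'I_n -> R).
Hypotheses (hA : psm A) (hV : unit_mx V) (b0 : forall i, 0 < b i).
Let B := spec V b.
Let P s := psm (mpow B s - mpow A s).

Lemma pos_psd : psm B.
Proof. by apply/(spec_psdP hV) => i; exact: ltW. Qed.
Let hB := pos_psd.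

Lemma mpowD_pos x y : mpow B x *m mpow B y = mpow B (x + y).
Proof.
rewrite !mpow_spec // specM //; congr spec; apply/funext => i.
by rewrite powRD // (gt_eqF (b0 i)) implybT.
Qed.

Lemma hc_mpow (X : 'M[C]_n) x : psm X -> hc (mpow X x) = mpow X x.
Proof. by move=> hX; rewrite -(psd_herm (mpow_psd _ hX)). Qed.

(** As B is positive definite, conjugation by B^(-s/2) turns A^s <= B^s into the statement that
    B^(-s/2) A^(s/2) is a contraction. *)
Lemma contr_pos s : 0 <= s -> P s ->
  psm (1%:M - (mpow B (- s / 2) *m mpow A (s / 2)) *m hc (mpow B (- s / 2) *m mpow A (s / 2))).
Proof.
move=> s0 /(psdM (mpow B (- s / 2))); rewrite (hc_mpow _ hB) mulmxBr mulmxBl.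
rewrite !mpowD_pos; have -> : - s / 2 + s + - s / 2 = 0 by field.
have eA : mpow A s = mpow A (s / 2) *m mpow A (s / 2).
  by rewrite (mpowD hA) -splitr //; case: eqVneq => //= ->; rewrite mul0r eqxx.
by rewrite (mpow0 hB) hcM (hc_mpow _ hA) (hc_mpow _ hB) eA !mulmxA.
Qed.

(** The exponents for which the operator inequality holds are closed under midpoints. For the
    midpoint r, the product K1 K2^* of the contractions for s and t is similar to M = B^(-r/2) A^r
    B^(-r/2), so each eigenvalue of M is at most one by the arithmetic-geometric inequality at an
    eigenvector of K1 K2^*. *)
Lemma LH_mid s t : 0 <= s -> 0 <= t -> P s -> P t -> P ((s + t) / 2).
Proof.
move=> s0 t0 hs ht; set r := (s + t) / 2; have r0 : 0 <= r by rewrite divr_ge0 ?addr_ge0.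
pose M := mpow B (- r / 2) *m mpow A r *m mpow B (- r / 2).
have hM : psm M by have := psdM (mpow B (- r / 2)) (mpow_psd r hA); rewrite hc_mpow.
have [U [m [hU eM m0]]] := psd_spec hM.
suff m1 i : m i <= 1.
  have : psm (1%:M - M).
    by rewrite eM -(spec1 hU) (specB U); apply/(spec_psdP hU) => i; rewrite subr_ge0.
  move/(psdM (mpow B (r / 2))); rewrite (hc_mpow _ hB) mulmxBr mulmxBl mulmx1.
  rewrite mpowD_pos -splitr /M !mulmxA mpowD_pos -(mulmxA _ _ (mpow B (r / 2))) mpowD_pos.
  have -> : r / 2 + - r / 2 = 0 by field.
  have -> : - r / 2 + r / 2 = 0 by field.
  by rewrite (mpow0 hB) mul1mx mulmx1.
(* This c solves c - r/2 = - s/2 and - r/2 - c = - t/2, so that K1 K2^* = B^c M B^(-c); then x = u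
   B^(-c) is a left eigenvector of it. *)
pose c := (t - s) / 4; pose u := row i U; pose x := u *m mpow B (- c).
pose K1 := mpow B (- s / 2) *m mpow A (s / 2).
pose K2 := mpow B (- t / 2) *m mpow A (t / 2).
have eN : K1 *m hc K2 = mpow B c *m M *m mpow B (- c).
  rewrite /K1 /K2 hcM !hc_mpow // !mulmxA -(mulmxA _ (mpow A (s / 2))) mpowD //; last first.
    rewrite -mulrDl mulf_eq0 invr_eq0 pnatr_eq0 orbF paddr_eq0 // mulf_eq0.
    by case: (s == 0); rewrite /= ?orbT.
  rewrite mpowD_pos -(mulmxA _ _ (mpow B (- c))) mpowD_pos.
  have -> : s / 2 + t / 2 = r by rewrite /r; field.
  have -> : c + - r / 2 = - s / 2 by rewrite /c /r; field.
  have -> : - r / 2 - c = - t / 2 by rewrite /c /r; field.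
  by [].
have xN : x *m (K1 *m hc K2) = (m i)%:C *: x.
  rewrite eN eM /x !mulmxA -(mulmxA u) mpowD_pos addNr (mpow0 hB) mulmx1.
  by rewrite (row_spec hU) scalemxAl.
have qx := qf_eigen xN.
have := qf_amgm K1 K2 x; rewrite qx.
have /(qf_le x) := contr_pos s0 hs; rewrite -/K1 => h1.
have /(qf_le x) := contr_pos t0 ht; rewrite -/K2 => h2.
have h1' : qf (K1 *m hc K1) x <= qf 1%:M x.
  by have := psd_qf x (contr_pos s0 hs); rewrite qfB subr_ge0.
have h2' : qf (K2 *m hc K2) x <= qf 1%:M x.
  by have := psd_qf x (contr_pos t0 ht); rewrite qfB subr_ge0.
have x0 : 0 < qf 1%:M x.
  rewrite lt0r (psd_qf _ (psd1 _ _)) andbT; apply/eqP => /qf1_eq0 x0.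
  have : u = 0.
    have -> : u = x *m mpow B c by rewrite /x -mulmxA mpowD_pos addNr (mpow0 hB) mulmx1.
    by rewrite x0 mul0mx.
  move=> u0; have := qf1_row hU i; rewrite -/u u0 qf.unlock !mul0mx mxE /= => /eqP.
  by rewrite eq_sym oner_eq0.
move=> h; rewrite -(ler_pM2r x0) mul1r; lra.
Qed.

(** The exponents 0 and 1 are given; k / 2^(m+1) is the midpoint of the dyadics of level m obtained
    by rounding k / 2 down and up. *)
Lemma LH_dyadic k : psm (B - A) -> forall n, (k <= 2 ^ n)%N -> P (k%:R / (2 ^ n)%:R).
Proof.
move=> hBA n'; elim: n' k => [|m IH] k hk.
  rewrite expn0 divr1; case: k hk => [|[|]] // _; rewrite /P.
    by rewrite !mpow0 // subrr; exact: psd0.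
  by rewrite !mpow1.
have -> : k%:R / (2 ^ m.+1)%:R = ((k./2)%:R / (2 ^ m)%:R + (uphalf k)%:R / (2 ^ m)%:R) / 2 :> R.
  rewrite -mulrDl -natrD uphalf_half addnCA addnn odd_double_half.
  by rewrite expnS natrM invfM mulrA mulrAC.
apply: LH_mid; rewrite ?divr_ge0 ?ler0n //; apply: IH.
  by rewrite leq_half_double (leq_trans hk) // expnS mul2n; case: (2 ^ m)%N.
by rewrite leq_uphalf_double -mul2n -expnS.
Qed.

(** The successor keeps the approximating exponent positive. A zero exponent would break convergence
    on the kernel, where the zeroth power of 0 is 1 while every positive power is 0. *)
Lemma truncn_dyadic (s : R) m : 0 < s < 1 ->
  let k := (Num.truncn (s * (2 ^ m)%:R)).+1 in
  (k <= 2 ^ m)%N /\ `|k%:R / (2 ^ m)%:R - s| <= ((2 ^ m)%:R)^-1.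
Proof.
move=> /andP[s0 s1] k; have p0 : 0 < (2 ^ m)%:R :> R by rewrite ltr0n expn_gt0.
have /truncn_itv/andP[h1 h2] : 0 <= s * (2 ^ m)%:R by rewrite mulr_ge0 // ltW.
split.
  rewrite -(ltr_nat R) (le_lt_trans h1) // -[ltRHS]mul1r ltr_pM2r //.
rewrite -(ler_pM2r p0) mulVf ?gt_eqF // -[X in _ * X]gtr0_norm // -normrM mulrBl.
rewrite divfK ?gt_eqF // ger0_norm ?subr_ge0 ?(ltW h2) // lerBlDr /k -natr1 addrC.
by rewrite lerD2l.
Qed.

Lemma cvg_powR (a s : R) (u : nat -> R) : 0 <= a -> 0 < s -> (forall n, 0 < u n) ->
  u @ \oo --> s -> (fun n => a `^ (u n)) @ \oo --> a `^ s.
Proof.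
rewrite le_eqVlt => /predU1P[<-|a0] s0 u0 us.
  rewrite powR0 ?gt_eqF //; under eq_fun do rewrite powR0 ?gt_eqF //.
  exact: cvg_cst.
have e x : a `^ x = expR (x * ln a) by rewrite /powR gt_eqF.
rewrite e; under eq_fun do rewrite e.
by apply: continuous_cvg; [exact: continuous_expR|apply: cvgM => //; exact: cvg_cst].
Qed.

Lemma cvg_sumR (I : finType) (F : I -> nat -> R) (l : I -> R) :
  (forall i, F i @ \oo --> l i) -> (fun n => \sum_i F i n) @ \oo --> \sum_i l i.
Proof.
move=> h; have -> : (fun n => \sum_i F i n) = \sum_i F i by apply/funext => m; rewrite fct_sumE.
by elim/big_ind2: _ => [|? ? ? ?|i _]; [exact: cvg_cst|exact: cvgD|exact: h].
Qed.

Lemma cvg_qf_mpow (X : 'M[C]_n) (v : 'rV[C]_n) (s : R) (u : nat -> R) : psm X -> 0 < s ->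
  (forall n, 0 < u n) -> u @ \oo --> s ->
  (fun m => qf (mpow X (u m)) v) @ \oo --> qf (mpow X s) v.
Proof.
move=> /psd_spec [U [f [hU -> f0]]] s0 u0 us.
rewrite mpow_spec // qf_spec //.
under eq_fun do rewrite mpow_spec // qf_spec //.
apply: cvg_sumR => i; apply: cvgM; last exact: cvg_cst.
exact: cvg_powR.
Qed.

Lemma LH_pos (s : R) : psm (B - A) -> 0 < s < 1 -> P s.
Proof.
move=> hBA s01; have /andP[s0 s1] := s01.
pose u m := (Num.truncn (s * (2 ^ m)%:R)).+1%:R / (2 ^ m)%:R : R.
have u0 m : 0 < u m by rewrite divr_gt0 ?ltr0n ?expn_gt0.
have us : u @ \oo --> s.
  apply/cvgrPdist_le => e e0; near=> m.
  rewrite distrC; have [_ /le_trans -> //] := truncn_dyadic m s01.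
  rewrite invf_ple ?posrE ?ltr0n ?expn_gt0 //; apply: (@le_trans _ _ m%:R).
    by near: m; exact: nbhs_infty_ger.
  by rewrite ler_nat ltnW // ltn_expl.
apply: psdP => [|v].
  by apply: hermB; apply: psd_herm; apply: mpow_psd.
rewrite qfB; have c1 := cvgB (@cvg_qf_mpow B v s u hB s0 u0 us) (@cvg_qf_mpow A v s u hA s0 u0 us).
rewrite leNgt; apply/negP => neg.
have := cvgr_lt _ (c1 _) _ neg.
case=> N _ /(_ N (leqnn N)) /=; apply/negP; rewrite -leNgt.
have [hk _] := truncn_dyadic N s01.
by have /(psd_qf v) := LH_dyadic hBA hk; rewrite qfB.
Unshelve. all: by end_near.
Qed.

End Pos.

Lemma powR_subadd (x y s : R) : 0 <= x -> 0 <= y -> 0 < s < 1 ->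
  (x + y) `^ s <= x `^ s + y `^ s.
Proof.
move=> x0 y0 /andP[s0 s1].
have [->|xn] := eqVneq x 0; first by rewrite add0r lerDr powR_ge0.
have [->|yn] := eqVneq y 0; first by rewrite addr0 lerDl powR_ge0.
have xp : 0 < x by rewrite lt0r xn.
have yp : 0 < y by rewrite lt0r yn.
have p : 0 < x + y by rewrite addr_gt0.
have key z : 0 < z -> z <= x + y -> z / (x + y) * (x + y) `^ s <= z `^ s.
  move=> z0 zle; have -> : z `^ s = (z / (x + y)) `^ s * (x + y) `^ s.
    by rewrite -powRM ?divr_ge0 ?(ltW z0) ?(ltW p) // divfK ?gt_eqF.
  apply: ler_wpM2r; first exact: powR_ge0.
  apply: ger1_powR; last exact: ltW.
  by rewrite divr_gt0 //= ler_pdivrMr // mul1r.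
have := lerD (key x xp _) (key y yp _); rewrite lerDl lerDr -mulrDl -mulrDl divff ?gt_eqF //.
by rewrite mul1r; apply; exact: ltW.
Qed.

(** B is made positive definite by adding f = d^(1/s); as x^s is subadditive, this raises B^s by at
    most d, which is arbitrarily small. *)
Lemma loewner_heinz n (A B : 'M[C]_n) (s : R) : psm A -> psm B -> psm (B - A) ->
  0 < s < 1 -> psm (mpow B s - mpow A s).
Proof.
move=> hA hB hBA s01; have /andP[s0 s1] := s01.
apply: psdP => [|v].
  by apply: hermB; apply: psd_herm; apply: mpow_psd.
rewrite qfB subr_ge0; apply/ler_addgt0Pr => e e0.
have [V [b [hV eB b0]]] := psd_spec hB.
pose d := e / (qf 1%:M v + 1).
have q1 : 0 < qf 1%:M v + 1 by apply: ltr_wpDl => //; exact: psd_qf (psd1 _ _).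
have d0 : 0 < d by rewrite divr_gt0.
pose f := d `^ s^-1; have f0 : 0 < f by exact: powR_gt0.
have bf0 i : 0 < b i + f by rewrite ltr_wpDl.
have hBf : psm (spec V (fun i => b i + f) - A).
  rewrite -(specD V b (fun=> f)) -eB addrAC; apply: psdD => //.
  by apply/(spec_psdP hV) => _; exact: ltW.
have := psd_qf v (LH_pos hA hV bf0 hBf s01); rewrite qfB subr_ge0 => /le_trans; apply.
rewrite eB !mpow_spec // !qf_spec //.
apply: (@le_trans _ _ (\sum_i (b i `^ s + d) * cn2 ((v *m hc V) 0 i))).
  apply: ler_sum => i _; apply: ler_wpM2r; first exact: cn2_ge0.
  have -> : d = f `^ s by rewrite /f -powRrM mulVf ?powRr1 ?gt_eqF // ltW.
  by apply: powR_subadd => //; exact: ltW.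
under eq_bigr do rewrite mulrDl.
rewrite big_split /= lerD2l -mulr_sumr qf1_unit // /d mulrAC ler_pdivrMr // ler_pM2l //.
by rewrite lerDl.
Qed.

(* Ozawa's proof: with E = B + (A - B)_+, both A <= E and B <= E. *)
Lemma audenaert n (A B : 'M[C]_n) (s : R) : psm A -> psm B -> 0 < s < 1 ->
  exists T, [/\ psm T, psm (1%:M - T) &
    rtr (A *m (1%:M - T)) + rtr (B *m T) <= rtr (mpow A s *m mpow B (1 - s))].
Proof.
move=> hA hB /andP[s0 s1].
have [U [f [hU eH]]] := herm_spec (hermB (psd_herm hA) (psd_herm hB)).
pose T := spec U (fun i => (0 <= f i)%R%:R); pose D := spec U (fun i => Num.max (f i) 0).
have hT : psm T by apply/(spec_psdP hU) => i; rewrite ler0n.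
have hT1 : psm (1%:M - T).
  rewrite -(spec1 hU) (specB U); apply/(spec_psdP hU) => i.
  by case: (0 <= f i); rewrite ?subrr ?subr0.
have hD : psm D by apply/(spec_psdP hU) => i; rewrite le_max lexx orbT.
have eD : (A - B) *m T = D.
  rewrite eH (specM hU); congr spec; apply/funext => i.
  by case: (lerP 0 (f i)) => h; rewrite ?mulr1 ?mulr0.
have hE : psm (B + D) by exact: psdD.
have hEA : psm (B + D - A).
  have -> : B + D - A = D - (A - B) by rewrite opprB addrA [in RHS]addrAC addrC addrA.
  rewrite eH (specB U); apply/(spec_psdP hU) => i.
  by rewrite subr_ge0 le_max lexx.
have hEB : psm (B + D - B) by rewrite addrAC subrr add0r.
exists T; split=> //.
have -> : rtr (A *m (1%:M - T)) + rtr (B *m T) = rtr A - rtr D.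
  by rewrite mulmxBr mulmx1 rtrB -eD mulmxBl rtrB; ring.
set s' := 1 - s; have s'01 : 0 < s' < 1 by rewrite subr_gt0 s1 gtrBl.
have s01 : 0 < s < 1 by rewrite s0.
have es X : psm X -> mpow X s' *m mpow X s = X.
  by move=> hX; rewrite (mpowD hX) /s' subrK ?oner_eq0 // mpow1.
have h1 : psm (mpow (B + D) s' - mpow A s') by exact: loewner_heinz.
have h2 : psm (mpow (B + D) s' - mpow B s') by exact: loewner_heinz.
have h3 : psm (mpow (B + D) s - mpow A s) by exact: loewner_heinz.
have h4 : psm (mpow (B + D) s - mpow B s) by exact: loewner_heinz.
(* With E = B + D and s' = 1 - s, three traces are compared: tr A <= tr E^s' A^s, 0 <= tr (E^s' -
   B^s')(E^s - A^s), and tr B <= tr B^s' E^s. Their sum is tr A - tr D <= tr B^s' A^s. *)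
have i1 := rtr_le h1 (mpow_psd s hA).
have i2 := rtr_psdM h2 h3.
have i3 := rtr_psdM (mpow_psd s' hB) h4.
rewrite (es _ _ hA) in i1.
rewrite mulmxBr rtrB (es _ _ hB) in i3.
rewrite mulmxBr rtrB mulmxBl rtrB mulmxBl rtrB (es _ _ hE) rtrD in i2.
rewrite (rtrC (mpow A s)); move: i1 i2 i3; clear; move: (rtr A) (rtr B) (rtr D).
move: (rtr (mpow (B + D) s' *m _)) (rtr (mpow B s' *m mpow A s)) (rtr (mpow B s' *m _)).
by move=> x1 x2 x3 x4 x5 x6; lra.
Qed.

End Loewner.

(** * Tensor powers *)

Section Digits.
Variable d : nat.

(* Base-[d] digits of an index of a [d ^ n]-dimensional tensor power. *)
Fixpoint dig_rec k : 'I_(d ^ k.+1) -> seq 'I_d :=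
  if k is k'.+1 return 'I_(d ^ k.+1) -> seq 'I_d
  then fun x => (@mxtens_unindex d (d ^ k'.+1) x).1 :: dig_rec (@mxtens_unindex d (d ^ k'.+1) x).2
  else fun x => [:: x].

(** The recursion starts with a single factor, as that of [ntensmx] does, so no cast between d and d
    * 1 is needed. *)
Definition dig n : 'I_(d ^ n) -> seq 'I_d :=
  if n is k.+1 return 'I_(d ^ n) -> seq 'I_d then @dig_rec k else fun=> [::].

Lemma size_dig n (x : 'I_(d ^ n)) : size (dig x) = n.
Proof. by case: n x => // n; elim: n => //= n IH x; rewrite IH. Qed.

Lemma dig_tens k (i : 'I_d) (j : 'I_(d ^ k.+1)) :
  @dig k.+2 (@mxtens_index d (d ^ k.+1) (i, j)) = i :: @dig k.+1 j.
Proof.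
have e := @mxtens_indexK d (d ^ k.+1) (i, j).
transitivity ((@mxtens_unindex d (d ^ k.+1) (mxtens_index (i, j))).1
  :: @dig k.+1 (@mxtens_unindex d (d ^ k.+1) (mxtens_index (i, j))).2); first by [].
by rewrite e.
Qed.

Lemma big_tens (R : Type) (idx : R) (op : Monoid.com_law idx) m n (F : 'I_(m * n) -> R) :
  \big[op/idx]_x F x = \big[op/idx]_(i < m) \big[op/idx]_(j < n) F (mxtens_index (i, j)).
Proof.
rewrite pair_big; apply: reindex => //=.
by exists (@mxtens_unindex m n) => [[i j]|i] _; rewrite (mxtens_indexK, mxtens_unindexK).
Qed.

Lemma sum_dig (V : nmodType) n (F : seq 'I_d -> V) :
  \sum_(x : 'I_(d ^ n.+1)) F (dig x) = \sum_(i : 'I_d) \sum_(y : 'I_(d ^ n)) F (i :: dig y).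
Proof.
case: n => [|n].
  by apply: eq_bigr => i _; rewrite big_ord1.
rewrite (@big_tens V 0 _ d (d ^ n.+1)); apply: eq_bigr => i _; apply: eq_bigr => j _.
by rewrite dig_tens.
Qed.

(** Product weight of a word: the distribution of independent letters when [f] is a distribution,
    the eigenvalues of a tensor power when [f] lists eigenvalues. The ring is left general because
    diagonal entries are complex. *)
Definition fw (R : pzRingType) (f : 'I_d -> R) n (x : 'I_(d ^ n)) : R := \prod_(i <- dig x) f i.

Lemma fw0 (R : pzRingType) (f : 'I_d -> R) (x : 'I_(d ^ 0)) : fw f x = 1.
Proof. by rewrite /fw big_nil. Qed.
Lemma fw1 (R : pzRingType) (f : 'I_d -> R) (x : 'I_d) : @fw R f 1 x = f x.
Proof. by rewrite /fw big_seq1. Qed.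
Lemma fw_tens (R : pzRingType) (f : 'I_d -> R) k (i : 'I_d) (j : 'I_(d ^ k.+1)) :
  @fw R f k.+2 (@mxtens_index d (d ^ k.+1) (i, j)) = f i * @fw R f k.+1 j.
Proof. by rewrite /fw dig_tens big_cons. Qed.

Lemma sum_fw (R : pzRingType) (f : 'I_d -> R) n : \sum_(x : 'I_(d ^ n)) fw f x = (\sum_i f i) ^+ n.
Proof.
elim: n => [|n IH]; first by rewrite big_ord1 fw0 expr0.
rewrite (@sum_dig _ n (fun s => \prod_(i <- s) f i)) exprS mulr_suml.
by apply: eq_bigr => i _; under eq_bigr do rewrite big_cons; rewrite -mulr_sumr -IH.
Qed.

Lemma fw_ge0 (R : numDomainType) (f : 'I_d -> R) n (x : 'I_(d ^ n)) :
  (forall i, 0 <= f i) -> 0 <= fw f x.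
Proof. by move=> f0; rewrite /fw; apply: prodr_ge0 => i _. Qed.

End Digits.

Section Tensor.
Variable R : realType.
Local Notation C := R[i].

Lemma hc_tens m n p q (A : 'M[C]_(m, n)) (B : 'M[C]_(p, q)) :
  hc (tensmx A B) = tensmx (hc A) (hc B).
Proof. by apply/matrixP => i j; rewrite hcE !mxE !hcE rmorphM. Qed.

Lemma tens1 m n : tensmx (1%:M : 'M[C]_m) (1%:M : 'M[C]_n) = 1%:M.
Proof.
apply/matrixP => i j; case: (mxtens_indexP i) => i0 i1; case: (mxtens_indexP j) => j0 j1.
rewrite tensmxE !mxE (can_eq (@mxtens_indexK m n)) xpair_eqE -natrM; congr (_ %:R).
by case: eqP; case: eqP.
Qed.

Lemma ntensS d (A : 'M[C]_d) k : ntensmx A k.+2 = tensmx A (ntensmx A k.+1).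
Proof. by []. Qed.

Lemma ntens_mul d (A B : 'M[C]_d) n : ntensmx (A *m B) n = ntensmx A n *m ntensmx B n.
Proof.
case: n => [|n]; first by rewrite !ntensmx0 mulmx1.
elim: n => [|n IH] //; rewrite !ntensS IH; symmetry.
exact: (@tensmx_mul C d d (d ^ n.+1) (d ^ n.+1) d (d ^ n.+1)).
Qed.

Lemma ntens_hc d (A : 'M[C]_d) n : hc (ntensmx A n) = ntensmx (hc A) n.
Proof.
case: n => [|n]; first by rewrite !ntensmx0 hc1.
elim: n => [|n IH] //; rewrite !ntensS -IH.
exact: (@hc_tens d d (d ^ n.+1) (d ^ n.+1)).
Qed.

Lemma ntens1 d n : ntensmx (1%:M : 'M[C]_d) n = 1%:M.
Proof.
case: n => [|n] //; elim: n => [|n IH] //; rewrite ntensS IH.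
exact: (@tens1 d (d ^ n.+1)).
Qed.

Lemma ntens_unit d (U : 'M[C]_d) n : unit_mx U -> unit_mx (ntensmx U n).
Proof. by move=> hU; rewrite /unit_mx ntens_hc -ntens_mul hU ntens1. Qed.

Lemma tens_dg m n (f : 'I_m -> R) (g : 'I_n -> R) :
  tensmx (dg f) (dg g) = dg (fun x => f (mxtens_unindex x).1 * g (mxtens_unindex x).2).
Proof.
apply/matrixP => i j; case: (mxtens_indexP i) => i0 i1; case: (mxtens_indexP j) => j0 j1.
rewrite tensmxE !dgE (can_eq (@mxtens_indexK m n)) mxtens_indexK xpair_eqE /=.
by case: eqP => /= _; case: eqP => /= _; rewrite ?mul0r ?mulr0 // rmorphM.
Qed.

Lemma ntens_dg d (f : 'I_d -> R) n : ntensmx (dg f) n = dg (@fw d R f n).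
Proof.
case: n => [|n].
  by apply/matrixP => i j; rewrite dgE !mxE fw0; case: eqP.
elim: n => [|n IH].
  by rewrite ntensmx1; congr dg; apply/funext => x; rewrite fw1.
rewrite ntensS IH (@tens_dg d (d ^ n.+1)); congr dg; apply/funext => x.
by case: (@mxtens_indexP d (d ^ n.+1) x) => i j; rewrite fw_tens mxtens_indexK.
Qed.

Lemma ntens_spec d (U : 'M[C]_d) f n : ntensmx (spec U f) n = spec (ntensmx U n) (@fw d R f n).
Proof. by rewrite spec.unlock !ntens_mul ntens_dg ntens_hc. Qed.

Lemma ntens_diag d (A : 'M[C]_d) n x : ntensmx A n x x = @fw d C (fun i => A i i) n x.
Proof.
case: n x => [|n] x; first by rewrite fw0 !mxE eqxx.
elim: n x => [|n IH] x; first by rewrite fw1.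
rewrite ntensS; case: (@mxtens_indexP d (d ^ n.+1) x) => i j.
by rewrite (@tensmxE C d d (d ^ n.+1) (d ^ n.+1)) fw_tens IH.
Qed.

Lemma ntens_tr d (A : 'M[C]_d) n : \tr (ntensmx A n) = (\tr A) ^+ n.
Proof. by rewrite /mxtrace -sum_fw; apply: eq_bigr => x _; rewrite ntens_diag. Qed.

Lemma ntens_psd d (A : 'M[C]_d) n : psm A -> psm (ntensmx A n).
Proof.
move=> /psd_spec [U [f [hU -> f0]]]; rewrite ntens_spec.
by apply/(spec_psdP (ntens_unit n hU)) => x; apply: fw_ge0.
Qed.

Lemma fw_powR d (f : 'I_d -> R) a n (x : 'I_(d ^ n)) : (forall i, 0 <= f i) ->
  (fw f x) `^ a = fw (fun i => f i `^ a) x.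
Proof.
move=> f0; rewrite /fw; elim: (dig x) => [|i s IH]; first by rewrite !big_nil powR1.
by rewrite !big_cons powRM ?IH //; apply: prodr_ge0 => j _.
Qed.

Lemma ntens_mpow d (A : 'M[C]_d) a n : psm A -> mpow (ntensmx A n) a = ntensmx (mpow A a) n.
Proof.
move=> /psd_spec [U [f [hU -> f0]]]; have hUn := ntens_unit n hU.
rewrite ntens_spec (mpow_spec _ _ hUn) (mpow_spec _ _ hU) ntens_spec.
by congr spec; apply/funext => x; rewrite fw_powR.
Qed.

Lemma tr_real n (A : 'M[C]_n) : \tr (hc A) = \tr A -> \tr A = (rtr A)%:C.
Proof.
move=> h; rewrite rtr.unlock; apply: real_Re; rewrite -{1}h /mxtrace rmorph_sum.
by apply: eq_bigr => i _; rewrite hcE.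
Qed.

(** Taking real parts is multiplicative only on real numbers; the hypothesis says that the trace of
    A is real. *)
Lemma ntens_rtr d (A : 'M[C]_d) n : \tr (hc A) = \tr A -> rtr (ntensmx A n) = rtr A ^+ n.
Proof. by move=> /tr_real h; rewrite rtr.unlock ntens_tr h -rmorphXn. Qed.

Lemma psd_tr_real n (A : 'M[C]_n) : psm A -> \tr (hc A) = \tr A.
Proof. by move=> /psd_herm <-. Qed.
Lemma psdM_tr_real n (A B : 'M[C]_n) : psm A -> psm B -> \tr (hc (A *m B)) = \tr (A *m B).
Proof. by move=> hA hB; rewrite hcM -(psd_herm hA) -(psd_herm hB) mxtrace_mulC. Qed.

Lemma sandQ_ntens d a (rho sigma : 'M[C]_d) n : psm rho -> psm sigma ->
  sandQ a (ntensmx rho n) (ntensmx sigma n) = sandQ a rho sigma ^+ n.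
Proof.
move=> hr hs; rewrite /sandQ.
have hK : psm (mpow rho 2^-1 *m mpow sigma ((1 - a) / a) *m mpow rho 2^-1).
  have := psdM (mpow rho 2^-1) (mpow_psd ((1 - a) / a) hs).
  by rewrite -(psd_herm (mpow_psd _ hr)).
rewrite !ntens_mpow // -!ntens_mul ntens_mpow // ntens_rtr //.
by apply: psd_tr_real; exact: mpow_psd.
Qed.

Definition petzQ n (s : R) (rho sigma : 'M[C]_n) : R := rtr (mpow rho s *m mpow sigma (1 - s)).

Lemma petzQ_ntens d s (rho sigma : 'M[C]_d) n : psm rho -> psm sigma ->
  petzQ s (ntensmx rho n) (ntensmx sigma n) = petzQ s rho sigma ^+ n.
Proof.
move=> hr hs; rewrite /petzQ !ntens_mpow // -ntens_mul ntens_rtr //.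
by apply: psdM_tr_real; exact: mpow_psd.
Qed.

Lemma ntens_sub d (rho sigma : 'M[C]_d) n : (rho <= sigma)%MS ->
  (ntensmx rho n <= ntensmx sigma n)%MS.
Proof. by move=> /submxP [D ->]; rewrite ntens_mul submxMl. Qed.

Lemma ntens_dens d (A : 'M[C]_d) n : density A -> density (ntensmx A n).
Proof.
move=> [hA tA]; split; last by rewrite ntens_tr tA expr1n.
by rewrite -psmE; apply: ntens_psd; rewrite psmE.
Qed.

End Tensor.

(** * Channels and the converse bound *)

Section Channels.
Variable R : realType.
Local Notation C := R[i].

Lemma psd_castmx n n' (e : n = n') (A : 'M[C]_n) : psm (castmx (e, e) A) -> psm A.
Proof. by case: n' / e; rewrite castmx_id. Qed.
Lemma castmx_psd n n' (e : n = n') (A : 'M[C]_n) : psm A -> psm (castmx (e, e) A).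
Proof. by case: n' / e; rewrite castmx_id. Qed.

Lemma psd_sum n I (s : seq I) (P : pred I) (F : I -> 'M[C]_n) :
  (forall i, psm (F i)) -> psm (\sum_(i <- s | P i) F i).
Proof. by move=> h; elim/big_ind: _ => // [|A B]; [exact: psd0|exact: psdD]. Qed.

(** This is complete positivity with a one-dimensional ancilla; the casts only identify 1 * d with
    d. *)
Lemma chan_pos d1 d2 (E : 'M[C]_d1 -> 'M[C]_d2) X : channel E -> psm X -> psm (E X).
Proof.
case=> _ _ cp hX.
have e1 := esym (mul1n d1); have e2 := esym (mul1n d2).
have := cp 1%N (castmx (e1, e1) X); rewrite -!psmE => /(_ (castmx_psd e1 hX)).
suff -> : ampl E (castmx (e1, e1) X) = castmx (e2, e2) (E X) by apply: psd_castmx.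
apply/matrixP => p q; rewrite castmxE mxE.
have -> : \matrix_(a, a') castmx (e1, e1) X (mxtens_index ((mxtens_unindex p).1, a))
            (mxtens_index ((mxtens_unindex q).1, a')) = X.
  apply/matrixP => a b; rewrite mxE castmxE; congr (X _ _); apply: val_inj => /=.
    by case: (p %/ d2)%N (mxtens_index_proof1 p) => // _; rewrite mul0n.
  by case: (q %/ d2)%N (mxtens_index_proof1 q) => // _; rewrite mul0n.
by congr (E X _ _); apply: val_inj => /=; rewrite modn_small // -[X in (_ < X)%N]mul1n.
Qed.

Lemma chan_sum d1 d2 (E : 'M[C]_d1 -> 'M[C]_d2) I (s : seq I) (F : I -> 'M[C]_d1) :
  channel E -> E (\sum_(i <- s) F i) = \sum_(i <- s) E (F i).
Proof.
case=> lin _ _; have add X Y : E (X + Y) = E X + E Y by have := lin 1 X Y; rewrite !scale1r.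
have E0 : E 0 = 0 by have := add 0 0; rewrite addr0 => /eqP; rewrite -subr_eq subrr eq_sym => /eqP.
by apply: (big_morph E).
Qed.
Lemma chanZ d1 d2 (E : 'M[C]_d1 -> 'M[C]_d2) a X : channel E -> E (a *: X) = a *: E X.
Proof.
move=> hE; have [lin _ _] := hE; have := lin a X 0.
by rewrite addr0 => ->; have := @chan_sum _ _ E _ [::] (fun i : nat => 0) hE; rewrite !big_nil => ->; rewrite addr0.
Qed.

Lemma qf_rank1 n (A : 'M[C]_n) (v : 'rV[C]_n) : rtr (hc v *m v *m A) = qf A v.
Proof.
rewrite -mulmxA rtrC rtr.unlock qf.unlock; congr complex.Re.
by rewrite /mxtrace big_ord1.
Qed.

Lemma qf_herm_part n (A : 'M[C]_n) v : qf ((2^-1 : R)%:C *: (A + hc A)) v = qf A v.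
Proof. by rewrite qfZ qfD qf_adj mulrDr -mulrDl -[2^-1]mul1r -splitr mul1r. Qed.

(* The Heisenberg-picture image of a test; its Hermitian part is taken because only real parts of traces matter. *)
Lemma chan_adj d1 d2 (E : 'M[C]_d1 -> 'M[C]_d2) T : channel E -> psm T -> psm (1%:M - T) ->
  exists T', [/\ psm T', psm (1%:M - T') &
    forall X, psm X -> rtr (E X *m T) = rtr (X *m T')].
Proof.
move=> hE hT hT1; pose T0 : 'M[C]_d1 := \matrix_(j, i) \tr (E (delta_mx i j) *m T).
have e0 X : rtr (E X *m T) = rtr (X *m T0).
  rewrite !rtr.unlock; congr complex.Re.
  rewrite {1}(matrix_sum_delta X) (chan_sum _ _ hE) mulmx_suml (raddf_sum (@mxtrace _ _)) /mxtrace.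
  apply: eq_bigr => i _; rewrite -/(mxtrace _) (chan_sum _ _ hE) mulmx_suml (raddf_sum (@mxtrace _ _)) mxE.
  by apply: eq_bigr => j _; rewrite /= (chanZ _ _ hE) -scalemxAl mxtraceZ mxE.
have q0 v : qf T0 v = rtr (E (hc v *m v) *m T) by rewrite e0 qf_rank1.
have hv (v : 'rV[C]_d1) : psm (hc v *m v) by have := psdK (hc v); rewrite hcK.
exists ((2^-1 : R)%:C *: (T0 + hc T0)).
have hh : herm ((2^-1 : R)%:C *: (T0 + hc T0)).
  by apply: hermZ; rewrite /herm hcD hcK addrC.
split.
- apply: psdP => // v; rewrite qf_herm_part q0; apply: rtr_psdM => //.
  exact: chan_pos.
- apply: psdP => [|v]; first by apply: hermB => //; exact: herm1.
  rewrite qfB qf_herm_part q0 -qf_rank1 mulmx1.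
  have [_ trE _] := hE.
  have -> : rtr (hc v *m v) = rtr (E (hc v *m v)) by rewrite !rtr.unlock trE.
  by rewrite -rtrB -{1}(mulmx1 (E _)) -mulmxBr; apply: rtr_psdM => //; exact: chan_pos.
move=> X hX; rewrite -scalemxAr rtrZ mulmxDr rtrD e0.
have -> : rtr (X *m hc T0) = rtr (X *m T0).
  by rewrite {1}(psd_herm hX) -hcM rtr_hc rtrC.
by rewrite mulrDr -mulrDl -[2^-1]mul1r -splitr mul1r.
Qed.

(** Amplifying a conjugation by N yields the conjugation by 1 (x) N, which preserves positivity.
    Complete positivity thus reduces to finding Kraus operators. *)
Lemma ampl_kraus k d1 d2 (N : 'M[C]_(d2, d1)) (X : 'M[C]_(k * d1)) :
  ampl (fun Y => N *m Y *m hc N) X = tensmx 1%:M N *m X *m hc (tensmx (1%:M : 'M[C]_k) N).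
Proof.
have key (m : nat) (p : 'I_(k * d2)) (M : 'M[C]_(k * d1, m)) z :
    (tensmx 1%:M N *m M) p z =
    \sum_a N (mxtens_unindex p).2 a * M (mxtens_index ((mxtens_unindex p).1, a)) z.
  case: (mxtens_indexP p) => p1 p2; rewrite mxtens_indexK mxE big_tens (bigD1 p1) //=.
  rewrite [X in _ + X]big1 ?addr0 => [|i ip]; last first.
    apply: big1 => j _; rewrite tensmxE mxE eq_sym (negbTE ip) !mul0r //.
  by apply: eq_bigr => a _; rewrite tensmxE mxE eqxx mul1r.
apply/matrixP => p q; rewrite -[RHS]conjcK -hcE hcM hcK key rmorph_sum mxE mxE.
apply: eq_bigr => a' _.
rewrite rmorphM /= [RHS]mulrC [hc (_ *m X) _ _]hcE conjcK key hcE; congr (_ * _).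
by rewrite mxE; apply: eq_bigr => a _; rewrite mxE.
Qed.

Lemma ampl_sum k d1 d2 (I : finType) (F : I -> 'M[C]_d1 -> 'M[C]_d2) (X : 'M[C]_(k * d1)) :
  ampl (fun Y => \sum_i F i Y) X = \sum_i ampl (F i) X.
Proof.
apply/matrixP => p q; rewrite mxE !summxE; apply: eq_bigr => i _; by rewrite mxE.
Qed.

(** Measuring K K^* and preparing L L^* has rank-one Kraus operators, each a column of L times a row
    of K^*. *)
Lemma trace_prepare_kraus d1 d2 (K : 'M[C]_d1) (L : 'M[C]_d2) (X : 'M[C]_d1) :
  \tr (X *m (K *m hc K)) *: (L *m hc L) =
  \sum_(ij : 'I_d1 * 'I_d2) (col ij.2 L *m row ij.1 (hc K)) *m X *m hc (col ij.2 L *m row ij.1 (hc K)).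
Proof.
have s i : row i (hc K) *m X *m hc (row i (hc K)) = ((hc K *m X *m K) i i)%:M.
  apply/matrixP => a b; rewrite !ord1 [RHS]mxE eqxx mulr1n -row_mul !mxE.
  by apply: eq_bigr => j _; rewrite hcE !mxE hcE conjcK.
have -> : \tr (X *m (K *m hc K)) = \sum_i (hc K *m X *m K) i i.
  by rewrite mulmxA mxtrace_mulC mulmxA.
have -> : L *m hc L = \sum_j col j L *m hc (col j L).
  apply/matrixP => a b; rewrite summxE mxE; apply: eq_bigr => j _.
  by rewrite mxE big_ord1 !hcE !mxE.
rewrite scaler_suml; under eq_bigr do rewrite scaler_sumr.
rewrite pair_big /=; apply: eq_bigr => -[i j] _ /=.
by rewrite hcM !mulmxA -(mulmxA _ _ X) -(mulmxA _ _ (hc (row i _))) s mul_mx_scalar -scalemxAl.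
Qed.

Lemma ampl_prepare k d1 d2 (T : 'M[C]_d1) (mu : 'M[C]_d2) (X : 'M[C]_(k * d1)) :
  psm T -> psm mu -> psm X -> psm (ampl (fun Y => \tr (Y *m T) *: mu) X).
Proof.
move=> hT hmu hX; rewrite -(psd_sqrtE hT) -(psd_sqrtE hmu).
set K := mpow T _; set L := mpow mu _.
have -> : (fun Y => \tr (Y *m (K *m hc K)) *: (L *m hc L)) = (fun Y =>
  \sum_(ij : 'I_d1 * 'I_d2) (col ij.2 L *m row ij.1 (hc K)) *m Y *m hc (col ij.2 L *m row ij.1 (hc K))).
  by apply/funext => Y; exact: trace_prepare_kraus.
rewrite ampl_sum; apply: psd_sum => ij; rewrite ampl_kraus; exact: psdM.
Qed.

Lemma measure_prepare_channel d1 d2 (T : 'M[C]_d1) (mu nu : 'M[C]_d2) :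
  psm T -> psm (1%:M - T) -> psm mu -> psm nu -> \tr mu = 1 -> \tr nu = 1 ->
  channel (fun X => \tr (X *m T) *: mu + \tr (X *m (1%:M - T)) *: nu).
Proof.
move=> hT hT1 hmu hnu tmu tnu; split=> [a X Y|X|k X].
- have t M : \tr ((a *: X + Y) *m M) = a * \tr (X *m M) + \tr (Y *m M).
    by rewrite mulmxDl -scalemxAl mxtraceD mxtraceZ.
  by rewrite !t !scalerDl -!scalerA (scalerDr a) addrACA.
- by rewrite mxtraceD !mxtraceZ tmu tnu !mulr1 -mxtraceD -mulmxDr addrC subrK mulmx1.
rewrite -!psmE => hX.
have -> : ampl (fun X => \tr (X *m T) *: mu + \tr (X *m (1%:M - T)) *: nu) X =
  ampl (fun X => \tr (X *m T) *: mu) X + ampl (fun X => \tr (X *m (1%:M - T)) *: nu) X.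
  by apply/matrixP => p q; rewrite !mxE.
by apply: psdD; exact: ampl_prepare.
Qed.

(** * Measure-and-prepare conversion, and the converse for a given number of copies *)

Lemma density_psd n (A : 'M[C]_n) : density A -> psm A.
Proof. by case; rewrite psmE. Qed.
Lemma density_rtr n (A : 'M[C]_n) : density A -> rtr A = 1.
Proof. by case=> _ h; rewrite rtr.unlock h. Qed.

(** The state [nu] prepared on rejection is the normalised rest (sigma' - q mu) / (1 - q), so sigma
    is mapped to sigma' exactly. The image of rho is a mu + (1 - a) nu with a >= e, and it shares
    the component e mu with rho'. *)
Lemma measure_prepare_convertible d1 d2 (rho sigma T : 'M[C]_d1) (rho' sigma' mu : 'M[C]_d2) (e : R) :
  density rho -> density sigma -> density rho' -> density sigma' -> density mu ->
  psm T -> psm (1%:M - T) -> rtr (sigma *m T) < 1 -> e <= rtr (rho *m T) ->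
  psm (sigma' - (rtr (sigma *m T))%:C *: mu) -> psm (rho' - e%:C *: mu) ->
  convertible rho sigma rho' sigma' (1 - e) 0.
Proof.
move=> hr hs hr' hs' hmu hT hT1; set q := rtr (sigma *m T) => q1 ea hsq hre.
pose nu : 'M[C]_d2 := ((1 - q)^-1)%:C *: (sigma' - q%:C *: mu).
have q10 : 0 < 1 - q by rewrite subr_gt0.
have hnu : psm nu by apply: psdZ => //; rewrite invr_ge0 ltW.
have tmu : \tr mu = 1 by case: hmu.
have tnu : \tr nu = 1.
  have [_ ts'] := hs'.
  rewrite /nu linearZ /= linearB linearZ /= ts' tmu mulr1 -(rmorph1 (real_complex R)) -rmorphB -rmorphM /=.
  by rewrite mulVf ?gt_eqF.
have pmu := density_psd hmu.
have trT (X : 'M[C]_d1) : density X -> \tr (X *m T) = (rtr (X *m T))%:C.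
  by move=> hX; apply: tr_real; apply: psdM_tr_real => //; exact: density_psd.
have trT1 (X : 'M[C]_d1) : density X -> \tr (X *m (1%:M - T)) = (1 - rtr (X *m T))%:C.
  by move=> hX; rewrite mulmxBr mulmx1 linearB /= trT //; case: hX => _ ->; rewrite rmorphB.
exists (fun X => \tr (X *m T) *: mu + \tr (X *m (1%:M - T)) *: nu); split.
  exact: measure_prepare_channel.
split; last first.
  apply: (@tdist_le R _ _ _ 0 0); rewrite ?rtr0 ?mulr0 ?addr0 ?subrr //; try exact: psd0.
  rewrite trT // trT1 // -/q /nu scalerA -rmorphM /= divff ?gt_eqF // scale1r.
  by rewrite [q%:C *: mu + _]addrC subrK subrr.
rewrite trT // trT1 //; set a := rtr (rho *m T).
have a1 : 0 <= 1 - a.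
  have := rtr_psdM (density_psd hr) hT1; rewrite mulmxBr mulmx1 rtrB (density_rtr hr).
  by [].
(* Once e mu is removed from both states, the remainders are positive and each has trace 1 - e. *)
apply: (@tdist_le R _ _ _ ((a - e)%:C *: mu + (1 - a)%:C *: nu) (rho' - e%:C *: mu)).
- by apply: psdD; apply: psdZ => //; rewrite subr_ge0.
- by [].
- have gen (V : zmodType) (A B Y P : V) : A + Y - P = A - B + Y - (P - B).
    by rewrite opprB [A - B + Y]addrAC subrKA.
  have -> : (a - e)%:C = a%:C - e%:C by rewrite rmorphB.
  by rewrite scalerBl; exact: gen.
have rnu : rtr nu = 1 by rewrite rtr.unlock tnu.
have -> : rtr ((a - e)%:C *: mu + (1 - a)%:C *: nu) = (a - e) + (1 - a).
  by rewrite rtrD (rtrZ (a - e)) (rtrZ (1 - a)) rnu (density_rtr hmu) !mulr1.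
have -> : rtr (rho' - e%:C *: mu) = 1 - e.
  by rewrite rtrB (rtrZ e) (density_rtr hmu) (density_rtr hr') mulr1.
by rewrite le_eqVlt; apply/orP; left; apply/eqP; ring.
Qed.

(** A and B are the errors of Audenaert's test between rho2^m and c sigma2^m. Pulled back through
    the channel, the test accepts the first source with probability at least e - A and the second
    with probability at most B. The weight [c] stays free for later optimisation; the alternative e
    <= A covers the case where the power of e - A carries no information. *)
Lemma converse_test d1 d2 (rho1 sigma1 : 'M[C]_d1) (rho2 sigma2 : 'M[C]_d2) (a s e : R) n m :
  1 < a -> 0 < s < 1 -> (rho1 <= sigma1)%MS ->
  density rho1 -> density sigma1 -> density rho2 -> density sigma2 ->
  convertible (ntensmx rho1 n) (ntensmx sigma1 n) (ntensmx rho2 m) (ntensmx sigma2 m) (1 - e) 0 ->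
  forall c, 0 < c -> exists A B, [/\ 0 <= A, 0 <= B,
    A + c * B <= c `^ (1 - s) * petzQ s rho2 sigma2 ^+ m &
    (e <= A) \/ (e - A) `^ a <= sandQ a rho1 sigma1 ^+ n * B `^ (a - 1)].
Proof.
move=> a1 s01 hsub hr1 hs1 hr2 hs2 [E [hE [er es]]] c c0.
have dr1 := ntens_dens n hr1; have ds1 := ntens_dens n hs1.
have dr2 := ntens_dens m hr2; have ds2 := ntens_dens m hs2.
have pr1 := density_psd dr1; have ps1 := density_psd ds1.
have pr2 := density_psd dr2; have ps2 := density_psd ds2.
rewrite -(petzQ_ntens s m (density_psd hr2) (density_psd hs2)).
rewrite -(sandQ_ntens a n (density_psd hr1) (density_psd hs1)).
move: (ntens_sub n hsub) dr1 ds1 dr2 ds2 pr1 ps1 pr2 ps2 er es.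
move: (ntensmx rho1 n) (ntensmx sigma1 n) (ntensmx rho2 m) (ntensmx sigma2 m) E hE.
move=> r1 s1 r2 s2 E hE sub dr1 ds1 dr2 ds2 pr1 ps1 pr2 ps2 er es.
have [T [hT hT1 hTA]] := audenaert pr2 (psdZ (ltW c0) ps2) s01.
have [T' [hT' hT1' eT]] := chan_adj hE hT hT1.
exists (rtr (r2 *m (1%:M - T))), (rtr (s2 *m T)); split.
- exact: rtr_psdM.
- exact: rtr_psdM.
- move: hTA; rewrite (mpowZ _ (ltW c0) ps2) -scalemxAl -scalemxAr (rtrZ c) (rtrZ (_ `^ _)).
  by [].
set A := rtr (r2 *m _); have [|eA] := lerP e A; [by left|right].
have a10 : 0 < a - 1 by rewrite subr_gt0.
have trE X : density X -> rtr (E X) = 1.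
  by move=> hX; have [_ h _] := hE; rewrite rtr.unlock h; case: hX => _ ->.
have hA : rtr (E r1 *m T) >= e - A.
  have := @tdist_effect _ _ r2 (E r1) T (1 - e).
  have -> : tdist r2 (E r1) = tdist (E r1) r2.
    rewrite /tdist; congr (_ * _); have := hermB (psd_herm (chan_pos hE pr1)) (psd_herm pr2).
    rewrite -(opprB (E r1)) => /herm_spec [U [f [hU ->]]].
    rewrite specN !trnorm_spec //; apply: eq_bigr => i _; by rewrite normrN.
  move=> /(_ (psd_herm pr2) (psd_herm (chan_pos hE pr1))).
  rewrite (density_rtr dr2) (trE _ dr1) => /(_ erefl er hT hT1).
  have -> : rtr (r2 *m T) = 1 - A.
    by rewrite /A mulmxBr mulmx1 rtrB (density_rtr dr2); ring.
  lra.
have hB : rtr (E s1 *m T) <= rtr (s2 *m T).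
  rewrite -[leRHS]addr0; apply: tdist_effect => //; try exact: psd_herm.
    by apply: psd_herm; exact: chan_pos.
  by rewrite (trE _ ds1) (density_rtr ds2).
have := test_ineq a1 pr1 ps1 sub hT' hT1'; rewrite -(eT _ pr1) -(eT _ ps1) => h.
apply: (@le_trans _ _ (rtr (E r1 *m T) `^ a)).
  have eA0 : 0 <= e - A by rewrite subr_ge0 ltW.
  have a0 : 0 <= a by apply: ltW; apply: lt_trans a1.
  by apply: (ge0_ler_powR a0 _ _ hA); rewrite nnegrE // (le_trans eA0).
apply: (le_trans h); apply: ler_wpM2l.
  rewrite /sandQ; apply: psd_rtr; apply: mpow_psd.
  have := psdM (mpow r1 2^-1) (mpow_psd ((1 - a) / a) ps1).
  by rewrite -(psd_herm (mpow_psd _ pr1)).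
apply: (ge0_ler_powR (ltW a10) _ _ hB); rewrite nnegrE.
  by apply: rtr_psdM => //; exact: chan_pos.
exact: rtr_psdM.
Qed.

Lemma sandQ_ge1 d (a : R) (rho sigma : 'M[C]_d) : 1 < a -> density rho -> density sigma ->
  (rho <= sigma)%MS -> 1 <= sandQ a rho sigma.
Proof.
move=> a1 hr hs sub.
have := test_ineq a1 (density_psd hr) (density_psd hs) sub (psd1 _ _) _.
by rewrite subrr !mulmx1 (density_rtr hr) (density_rtr hs) !powR1 mulr1; apply; exact: psd0.
Qed.

Lemma petzQ_le1 d (s : R) (rho sigma : 'M[C]_d) : 0 < s < 1 -> density rho -> density sigma ->
  0 <= petzQ s rho sigma <= 1.
Proof.
move=> /andP[s0 s1] hr hs; have pr := density_psd hr; have ps := density_psd hs.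
have s10 : 0 < 1 - s by rewrite subr_gt0.
rewrite /petzQ rtr_psdM; [|exact: mpow_psd|exact: mpow_psd].
have e : s^-1^-1 + (1 - s)^-1^-1 = 1 by rewrite !invrK addrC subrK.
have s0' : 0 < s^-1 by rewrite invr_gt0.
have s10' : 0 < (1 - s)^-1 by rewrite invr_gt0.
have := young_rtr s0' s10' e (mpow_psd s pr) (mpow_psd (1 - s) ps).
rewrite !mpowM // !divff ?gt_eqF // !mpow1 // (density_rtr hr) (density_rtr hs).
by rewrite !mul1r e.
Qed.

(** Here L, p, q, N, M stand for ln (e / 2), ln of [sandQ], ln of [petzQ], n and m; the hypothesis
    is the logarithm of the test inequality. *)
Lemma converse_arith (a s L q p N M : R) : 1 < a -> 0 < s < 1 ->
  a * L <= N * p + (a - 1) * (L - (1 - s)^-1 * (L - M * q)) ->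
  M * (q / (s - 1)) <= N * (p / (a - 1)) - (a / (a - 1) + s / (1 - s)) * L.
Proof.
move=> a1 /andP[s0 s1] h.
have a10 : 0 < a - 1 by rewrite subr_gt0.
have s10 : 0 < 1 - s by rewrite subr_gt0.
rewrite -(ler_pM2l a10).
have -> : (a - 1) * (N * (p / (a - 1)) - (a / (a - 1) + s / (1 - s)) * L) =
  N * p - a * L - (a - 1) * (s / (1 - s) * L).
  by field; rewrite !gt_eqF.
have -> : (a - 1) * (M * (q / (s - 1))) = - ((a - 1) * (M * q / (1 - s))).
  by rewrite -[s - 1]opprB invrN; ring.
move: h; have -> : L - (1 - s)^-1 * (L - M * q) = M * q / (1 - s) - s / (1 - s) * L.
  by field; rewrite gt_eqF.
by rewrite mulrBr; lra.
Qed.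

Lemma converse_bound d1 d2 (rho1 sigma1 : 'M[C]_d1) (rho2 sigma2 : 'M[C]_d2) (a s e : R) n m :
  1 < a -> 0 < s < 1 -> (rho1 <= sigma1)%MS -> 0 < e ->
  density rho1 -> density sigma1 -> density rho2 -> density sigma2 ->
  convertible (ntensmx rho1 n) (ntensmx sigma1 n) (ntensmx rho2 m) (ntensmx sigma2 m) (1 - e) 0 ->
  (petzQ s rho2 sigma2 = 0 -> m = 0%N) /\
  (0 < petzQ s rho2 sigma2 ->
   m%:R * (ln (petzQ s rho2 sigma2) / (s - 1)) <=
   n%:R * (ln (sandQ a rho1 sigma1) / (a - 1)) - (a / (a - 1) + s / (1 - s)) * ln (e / 2)).
Proof.
move=> a1 s01 sub e0 hr1 hs1 hr2 hs2 hconv.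
have key := converse_test a1 s01 sub hr1 hs1 hr2 hs2 hconv.
have /andP[s0 s1] := s01; have a0 : 0 < a by apply: lt_trans a1.
have a10 : 0 < a - 1 by rewrite subr_gt0.
have s10 : 0 < 1 - s by rewrite subr_gt0.
split=> [q0|q0].
  (* A vanishing Petz quantity means an infinite divergence: for m > 0 the test is perfect, A = B =
     0, and the source inequality would give e^a <= 0. *)
  case: m key {hconv} => // m key; have [A [B [A0 B0]]] := key 1 ltr01.
  rewrite q0 expr0n mulr0 mul1r => hAB.
  have eA : A = 0 by lra.
  have eB : B = 0 by lra.
  rewrite eA eB subr0 powR0 ?gt_eqF // mulr0 => -[]; first by rewrite leNgt e0.
  by rewrite leNgt powR_gt0.
set Q := petzQ s rho2 sigma2 in q0 key *; set P := sandQ a rho1 sigma1 in key *.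
have P1 : 1 <= P by exact: sandQ_ge1.
have P0 : 0 < P by apply: lt_le_trans P1.
have d0 : 0 < e / 2 by rewrite divr_gt0.
(* This weight makes the Audenaert bound equal to e / 2, so A <= e / 2 and at least e / 2 of
   acceptance probability is left. The factor 2 does not affect the rate. *)
pose c := (e / 2 / Q ^+ m) `^ (1 - s)^-1.
have c0 : 0 < c by rewrite powR_gt0 // divr_gt0 // exprn_gt0.
have ec : c `^ (1 - s) * Q ^+ m = e / 2.
  rewrite /c -powRrM mulVf ?gt_eqF // powRr1 ?divfK // ?gt_eqF ?exprn_gt0 //.
  by rewrite divr_ge0 ?exprn_ge0 // ltW.
have [A [B [A0 B0]]] := key c c0; rewrite ec => hAB hC.
have hA : A <= e / 2 by have := mulr_ge0 (ltW c0) B0; lra.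
have hB : B <= e / 2 / c.
  by rewrite ler_pdivlMr // mulrC; lra.
case: hC => [eA|hC]; first by lra.
have h1 : (e / 2) `^ a <= P ^+ n * (e / 2 / c) `^ (a - 1).
  apply: (@le_trans _ _ ((e - A) `^ a)).
    by apply: ge0_ler_powR; rewrite ?nnegrE; lra.
  apply: (le_trans hC); apply: ler_wpM2l; first by rewrite exprn_ge0 // ltW.
  by apply: ge0_ler_powR; rewrite ?nnegrE ?(ltW a10) // divr_ge0 ?ltW.
have {h1} : ln ((e / 2) `^ a) <= ln (P ^+ n * (e / 2 / c) `^ (a - 1)).
  by rewrite ler_ln // posrE ?mulr_gt0 ?exprn_gt0 ?powR_gt0 ?divr_gt0.
rewrite lnM ?posrE ?exprn_gt0 ?powR_gt0 ?divr_gt0 // !ln_powR lnXn //.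
have -> : ln (e / 2 / c) = ln (e / 2) - ln c by rewrite ln_div.
have -> : ln c = (1 - s)^-1 * (ln (e / 2) - ln Q *+ m).
  rewrite /c ln_powR; congr (_ * _).
  have qm : 0 < Q ^+ m by rewrite exprn_gt0.
  by rewrite -lnXn // -ln_div.
rewrite -(mulr_natl (ln P)) -(mulr_natl (ln Q)); exact: converse_arith.
Qed.

End Channels.

(** * Pinching *)

Section Pinching.
Variable R : realType.
Local Notation C := R[i].

Lemma sqr_sum_le (I : Type) (s : seq I) (x : I -> R) :
  (\sum_(i <- s) x i) ^+ 2 <= (size s)%:R * \sum_(i <- s) x i ^+ 2.
Proof.
elim: s => [|a s IH]; first by rewrite !big_nil expr0n mul0r.
rewrite !big_cons /=; set S := \sum_(i <- s) x i in IH *; set Q := \sum_(i <- s) _ in IH *.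
case: s => [|b s] in S Q IH *; first by rewrite /S /Q !big_nil !addr0 mul1r.
have k0 : 0 < (size (b :: s))%:R :> R by rewrite ltr0n.
have Q0 : 0 <= Q by apply: sumr_ge0 => i _; exact: sqr_ge0.
rewrite -natr1; move: (size _)%:R k0 IH => k k0 IH.
have h : 0 <= (k * x a - S) ^+ 2 by exact: sqr_ge0.
rewrite -subr_ge0 -(pmulr_rge0 _ k0).
have -> : k * ((k + 1) * (x a ^+ 2 + Q) - (x a + S) ^+ 2) =
  (k * x a - S) ^+ 2 + (k + 1) * (k * Q - S ^+ 2) by ring.
by rewrite addr_ge0 // mulr_ge0 ?subr_ge0 // addr_ge0 // ltW.
Qed.

Lemma cn2_sum_le (I : Type) (s : seq I) (z : I -> C) :
  cn2 (\sum_(i <- s) z i) <= (size s)%:R * \sum_(i <- s) cn2 (z i).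
Proof.
rewrite /cn2 big_split /= mulrDr Re_sum.
have -> : complex.Im (\sum_(i <- s) z i) = \sum_(i <- s) complex.Im (z i).
  by apply: (big_morph (@complex.Im R)) => // -[? ?] [? ?].
by rewrite lerD ?sqr_sum_le.
Qed.

Lemma qf_psdE n (A : 'M[C]_n) v : psm A ->
  qf A v = \sum_j cn2 ((v *m mpow A 2^-1) 0 j).
Proof.
move=> hA; rewrite -qf1E -qfM mulmx1; congr qf; exact/esym/psd_sqrtE.
Qed.

Lemma qf_sum_le n (A : 'M[C]_n) (I : Type) (s : seq I) (y : I -> 'rV[C]_n) : psm A ->
  qf A (\sum_(i <- s) y i) <= (size s)%:R * \sum_(i <- s) qf A (y i).
Proof.
move=> hA; rewrite qf_psdE // mulmx_suml.
under [in leRHS]eq_bigr do rewrite qf_psdE //.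
rewrite exchange_big mulr_sumr; apply: ler_sum => j _.
by rewrite summxE; exact: cn2_sum_le.
Qed.

Lemma spec_sum n (V : 'M[C]_n) (I : Type) (s : seq I) (F : I -> 'I_n -> R) :
  spec V (fun i => \sum_(e <- s) F e i) = \sum_(e <- s) spec V (F e).
Proof.
elim: s => [|e s IH].
  by rewrite big_nil -[RHS](scale0r (spec V (fun=> 0))) -[0 in RHS](rmorph0 (real_complex R)) specZ; congr spec; apply/funext => i; rewrite big_nil mul0r.
by rewrite big_cons -IH specD; congr spec; apply/funext => i; rewrite big_cons.
Qed.

Lemma sum_eq_seq (es : seq R) (x : R) (F : R) : uniq es ->
  \sum_(e <- es) (if x == e then F else 0) = if x \in es then F else 0.
Proof.
move=> ues; case: ifP => [xin|xn].
  rewrite (bigD1_seq x) //= eqxx big1 ?addr0 // => e ex.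
  by rewrite eq_sym (negbTE ex).
by rewrite big_seq big1 // => e ein; case: eqP => // xe; rewrite xe ein in xn.
Qed.

(** The pinched state P commutes with sigma, and rho <= |es| P because pinching splits each vector
    into |es| parts. A common eigenbasis W then makes the problem classical, at the price |es|^t. *)
Lemma pinching n (rho sigma V : 'M[C]_n) s (es : seq R) :
  psm rho -> psm sigma -> unit_mx V -> sigma = spec V s -> uniq es -> (forall i, s i \in es) ->
  exists W q, [/\ unit_mx W, sigma = spec W q &
    forall t, 1 < t -> sandQ t rho sigma <=
      (size es)%:R `^ t * \sum_i (qf rho (row i W)) `^ t * q i `^ (1 - t)].
Proof.
move=> hr hs hV es1 ues sin.
pose Pi e := spec V (fun i => (s i == e)%R%:R).
pose P : 'M[C]_n := \sum_(e <- es) Pi e *m rho *m hc (Pi e).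
have hP : psm P by apply: psd_sum => e; exact: psdM.
have hPi e : hc (Pi e) = Pi e by rewrite -(spec_herm V _).
have sumPi : \sum_(e <- es) Pi e = 1%:M.
  rewrite -spec_sum -(spec1 hV); congr spec; apply/funext => i.
  transitivity (\sum_(e <- es) (if s i == e then 1 else 0 : R)).
    by apply: eq_bigr => e _; case: (s i == e).
  by rewrite sum_eq_seq // sin.
have Pis e : Pi e *m sigma = e%:C *: Pi e.
  rewrite es1 (specM hV) specZ; congr spec; apply/funext => i.
  by case: eqP => [->|_]; rewrite ?mul1r ?mulr1 // mul0r mulr0.
have sPi e : sigma *m Pi e = e%:C *: Pi e.
  by rewrite -(Pis e) es1 !(specM hV); congr spec; apply/funext => i; rewrite mulrC.
have hcomm : P *m sigma = sigma *m P.
  rewrite mulmx_suml mulmx_sumr; apply: eq_bigr => e _.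
  by rewrite hPi -!mulmxA Pis !mulmxA sPi -!scalemxAl -!scalemxAr.
have [W [p [q [hW eP eS]]]] := comm_spec (psd_herm hP) (psd_herm hs) hcomm.
exists W, q; split=> // t t1; have t0 : 0 < t by apply: lt_trans t1.
have p0 : forall i, 0 <= p i by apply/(spec_psdP hW); rewrite -eP.
have q0 : forall i, 0 <= q i by apply/(spec_psdP hW); rewrite -eS.
have PiW e : Pi e = spec W (fun i => (q i == e)%R%:R).
  rewrite /Pi -/((fun x : R => (x == e)%R%:R : R) \o s) -(mxfun_spec _ _ hV) -es1 eS.
  by rewrite (mxfun_spec _ _ hW).
(* The vector [row i W] lies in the eigenspace of sigma for q i, so all other projections annihilate
   it. *)
have pq i : p i <= qf rho (row i W).
  rewrite -(qf_spec_row hW p i) -eP qf_sum.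
  apply: (@le_trans _ _ (\sum_(e <- es) (if q i == e then qf rho (row i W) else 0))); last first.
    by rewrite sum_eq_seq //; case: ifP => // _; exact: psd_qf.
  apply: ler_sum => e _; rewrite qfM PiW (row_spec hW).
  case: eqP => _; first by rewrite rmorph1 scale1r.
  by rewrite rmorph0 scale0r qf.unlock !mul0mx mxE.
(* The pinching inequality: v is the sum of its |es| projections, and Cauchy-Schwarz bounds the
   quadratic form of a sum. *)
have hv : psm ((size es)%:R%:C *: P - rho).
  apply: psdP => [|v].
    by apply: hermB; [apply: hermZ; exact: psd_herm|exact: psd_herm].
  rewrite qfB qfZ subr_ge0 -[X in qf rho X]mulmx1 -sumPi mulmx_sumr.
  apply: (le_trans (qf_sum_le _ _ hr)); rewrite qf_sum; apply: ler_wpM2l => //.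
  by apply: ler_sum => e _; rewrite qfM.
rewrite (sandQ_GrG t1 hr hs); set c := (1 - t) / t / 2; set G := mpow sigma c.
have hG : psm G by exact: mpow_psd.
have gG X : psm X -> psm (G *m X *m G).
  by move=> hX; have := psdM G hX; rewrite -(psd_herm hG).
have sz0 : 0 <= (size es)%:R :> R by [].
have h1 : rtr (mpow (G *m rho *m G) t) <= rtr (mpow ((size es)%:R%:C *: (G *m P *m G)) t).
  apply: rtr_pow_le => //; [exact: gG|by apply: psdZ => //; exact: gG|].
  have := gG _ hv; rewrite mulmxBr mulmxBl -scalemxAr -scalemxAl.
  by [].
apply: (le_trans h1); rewrite (mpowZ _ sz0 (gG _ hP)) rtrZ.
apply: ler_wpM2l; first exact: powR_ge0.
have eG : G = spec W (fun i => q i `^ c) by rewrite /G eS mpow_spec.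
rewrite eG eP !(specM hW) (mpow_spec _ _ hW) (rtr_spec hW); apply: ler_sum => i _.
have -> : (q i `^ c * p i * q i `^ c) `^ t = p i `^ t * q i `^ (1 - t).
  rewrite !powRM ?mulr_ge0 ?powR_ge0 // -!powRrM mulrAC mulrC; congr (_ * _).
  have ct : c * t + c * t = 1 - t by rewrite /c; field; rewrite gt_eqF.
  by rewrite -powRD ct // subr_eq0 lt_eqF.
apply: ler_wpM2r; first exact: powR_ge0.
by apply: ge0_ler_powR (pq i); rewrite ?nnegrE ?psd_qf // ltW.
Qed.

Lemma prod_count (d : nat) (f : 'I_d -> R) (s : seq 'I_d) :
  \prod_(i <- s) f i = \prod_(i : 'I_d) f i ^+ count_mem i s.
Proof.
elim: s => [|a s IH]; first by rewrite big_nil big1.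
rewrite big_cons IH -[f a in LHS]mulr1.
have <- : \prod_(i : 'I_d) f i ^+ (a == i) = f a * 1.
  by rewrite (bigD1 a) //= eqxx expr1 big1 // => i ia; rewrite eq_sym (negbTE ia).
by rewrite -big_split; apply: eq_bigr => i _; rewrite /= exprD.
Qed.

Definition fw_values (d : nat) (f : 'I_d -> R) k : seq R :=
  undup [seq fw f x | x : 'I_(d ^ k)].

(** An eigenvalue of the k-th tensor power depends only on the letter counts of the word, and each
    of the d counts lies between 0 and k. *)
Lemma size_fw_values d (f : 'I_d -> R) k : (size (fw_values f k) <= k.+1 ^ d)%N.
Proof.
pose g (c : {ffun 'I_d -> 'I_k.+1}) : R := \prod_i f i ^+ c i.
have -> : (k.+1 ^ d = size [seq g c | c : {ffun 'I_d -> 'I_k.+1}])%N.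
  by rewrite size_map -cardE card_ffun !card_ord.
apply: uniq_leq_size; first exact: undup_uniq.
move=> y; rewrite mem_undup => /mapP [x _ ->].
have cb i : (count_mem i (dig x) < k.+1)%N.
  by rewrite ltnS (leq_trans (count_size _ _)) // size_dig.
apply/mapP; exists [ffun i => Ordinal (cb i)]; first by rewrite mem_enum.
by rewrite /fw prod_count; apply: eq_bigr => i _; rewrite ffunE.
Qed.

Lemma pinching_ntens d (rho sigma : 'M[C]_d) k : psm rho -> psm sigma ->
  exists W q, [/\ unit_mx W, ntensmx sigma k = spec W q &
    forall t, 1 < t -> sandQ t rho sigma ^+ k <=
      ((k.+1 ^ d)%:R) `^ t * \sum_i (qf (ntensmx rho k) (row i W)) `^ t * q i `^ (1 - t)].
Proof.
move=> hr hs; have [V [s [hV eS s0]]] := psd_spec hs.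
have eSk : ntensmx sigma k = spec (ntensmx V k) (@fw d R s k) by rewrite eS ntens_spec.
have vin x : @fw d R s k x \in fw_values s k.
  by rewrite mem_undup map_f // mem_enum.
have [W [q [hW eW h]]] := pinching (ntens_psd k hr) (ntens_psd k hs) (ntens_unit k hV) eSk
  (undup_uniq _) vin.
exists W, q; split=> // t t1; rewrite -sandQ_ntens //; apply: (le_trans (h t t1)).
apply: ler_wpM2r.
  by apply: sumr_ge0 => i _; rewrite mulr_ge0 ?powR_ge0.
apply: ge0_ler_powR; rewrite ?nnegrE ?ler0n //; first by rewrite ltW // (lt_trans _ t1).
by rewrite ler_nat size_fw_values.
Qed.

End Pinching.

(** * Typical sets *)

Section LargeDeviations.
Variables (R : realType) (d : nat).
Implicit Types (w p q h : 'I_d -> R).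

Lemma sum_fw_dig w (F : seq 'I_d -> R) n :
  \sum_(x : 'I_(d ^ n.+1)) fw w x * F (dig x) =
  \sum_i w i * \sum_(y : 'I_(d ^ n)) fw w y * F (i :: dig y).
Proof.
rewrite /fw (@sum_dig d _ n (fun s => (\prod_(i <- s) w i) * F s)).
apply: eq_bigr => i _; rewrite mulr_sumr; apply: eq_bigr => y _.
by rewrite big_cons mulrA.
Qed.

Definition hsum h (s : seq 'I_d) : R := \sum_(i <- s) h i.

Lemma fw_mean w h n : \sum_i w i = 1 -> \sum_i w i * h i = 0 ->
  \sum_(x : 'I_(d ^ n)) fw w x * hsum h (dig x) = 0.
Proof.
move=> w1 wh; elim: n => [|n IH]; first by rewrite big_ord1 /hsum big_nil mulr0.
rewrite sum_fw_dig.
under eq_bigr => i _.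
  under eq_bigr => y _ do rewrite /hsum big_cons mulrDr.
  rewrite big_split /= -mulr_suml sum_fw w1 expr1n mul1r IH addr0.
  over.
exact: wh.
Qed.

Lemma fw_var w h n : \sum_i w i = 1 -> \sum_i w i * h i = 0 ->
  \sum_(x : 'I_(d ^ n)) fw w x * (hsum h (dig x)) ^+ 2 = n%:R * \sum_i w i * h i ^+ 2.
Proof.
move=> w1 wh; elim: n => [|n IH].
  by rewrite big_ord1 /hsum big_nil expr0n mulr0 mul0r.
rewrite (@sum_fw_dig w (fun s => hsum h s ^+ 2)).
have e i : \sum_(y : 'I_(d ^ n)) fw w y * hsum h (i :: dig y) ^+ 2 =
    h i ^+ 2 + n%:R * \sum_i w i * h i ^+ 2.
  transitivity (\sum_(y : 'I_(d ^ n)) (fw w y * h i ^+ 2 + 2 * h i * (fw w y * hsum h (dig y))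
      + fw w y * hsum h (dig y) ^+ 2)).
    by apply: eq_bigr => y _; rewrite /hsum big_cons; ring.
  rewrite !big_split /= IH -mulr_suml sum_fw w1 expr1n mul1r -mulr_sumr fw_mean //.
  by rewrite mulr0 addr0.
under eq_bigr do rewrite e mulrDr.
by rewrite big_split /= -mulr_suml w1 mul1r -natr1 mulrDl mul1r addrC.
Qed.

Lemma chebyshev_fw w h n (eta : R) : (forall i, 0 <= w i) -> \sum_i w i = 1 ->
  \sum_i w i * h i = 0 -> 0 < eta -> (0 < n)%N ->
  \sum_(x : 'I_(d ^ n) | n%:R * eta < `|hsum h (dig x)|) fw w x <=
  (\sum_i w i * h i ^+ 2) / eta ^+ 2 / n%:R.
Proof.
move=> w0 w1 wh eta0 n0; have n0' : 0 < n%:R :> R by rewrite ltr0n.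
have ne : 0 < (n%:R * eta) ^+ 2 by rewrite exprn_gt0 // mulr_gt0.
have -> : (\sum_i w i * h i ^+ 2) / eta ^+ 2 / n%:R =
    (n%:R * \sum_i w i * h i ^+ 2) / (n%:R * eta) ^+ 2.
  by field; rewrite !gt_eqF.
rewrite ler_pdivlMr // -fw_var // mulr_suml [leRHS](bigID (fun x => n%:R * eta < `|hsum h (dig x)|)) /=.
rewrite -[leLHS]addr0; apply: lerD.
  apply: ler_sum => x hx; apply: ler_wpM2l; first exact: fw_ge0.
  rewrite -[leRHS]real_normK ?num_real //; apply: (lerXn2r _ _ _ (ltW hx)); rewrite nnegrE //.
  by apply: mulr_ge0 => //; exact: ltW.
by apply: sumr_ge0 => x _; rewrite mulr_ge0 ?sqr_ge0 //; exact: fw_ge0.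
Qed.

(** Relative entropy. Where w > 0 and p = 0 the quotient takes its default value 0 instead of being
    infinite, hence the support hypotheses in its uses. *)
Definition relent w p : R := \sum_i w i * ln (w i / p i).

Lemma relent_ge0 w p : (forall i, 0 <= w i) -> \sum_i w i = 1 -> (forall i, 0 <= p i) ->
  \sum_i p i <= 1 -> (forall i, 0 < w i -> 0 < p i) -> 0 <= relent w p.
Proof.
move=> w0 w1 p0 p1 wp.
have : \sum_i (w i - p i) <= relent w p.
  apply: ler_sum => i _; have [->|wn] := eqVneq (w i) 0.
    by rewrite sub0r mul0r oppr_le0.
  have wi : 0 < w i by rewrite lt0r wn w0.
  have pi := wp _ wi.
  have : ln (p i / w i) <= p i / w i - 1.
    by have := @le_ln1Dx R (p i / w i - 1); rewrite addrCA subrr addr0; apply; rewrite ltrBDr addNr divr_gt0.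
  have -> : ln (w i / p i) = - ln (p i / w i) by rewrite -lnV ?invf_div // posrE divr_gt0.
  move=> hl; have := ler_wpM2l (ltW wi) hl.
  have -> : w i * (p i / w i - 1) = p i - w i by field; rewrite gt_eqF.
  by rewrite mulrN; move: (w i * _) => X; lra.
by rewrite sumrB w1; apply: le_trans; rewrite subr_ge0.
Qed.

Lemma fw_expR w p s : (forall i, 0 <= w i) -> (forall i, 0 < w i -> 0 < p i) ->
  0 < \prod_(i <- s) w i ->
  \prod_(i <- s) p i = \prod_(i <- s) w i * expR (- \sum_(i <- s) ln (w i / p i)).
Proof.
move=> w0 wp; elim: s => [|a s IH]; first by rewrite !big_nil oppr0 expR0 mulr1.
rewrite !big_cons => h.
have wa : 0 < w a.
  by rewrite lt0r w0 andbT; apply: contraTneq h => ->; rewrite mul0r ltxx.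
have ws : 0 < \prod_(i <- s) w i by rewrite -(pmulr_rgt0 _ wa).
have pa := wp _ wa.
rewrite IH // opprD expRD -lnV ?posrE ?divr_gt0 // lnK ?posrE ?invr_gt0 ?divr_gt0 // invf_div.
by field; rewrite gt_eqF.
Qed.

(** Weak law of large numbers for both log-likelihood ratios at once. Probability one half is
    enough, since only exponential rates matter later. *)
Lemma typical_set w p q (eta : R) : (forall i, 0 <= w i) -> \sum_i w i = 1 ->
  (forall i, 0 < w i -> 0 < p i) -> (forall i, 0 < w i -> 0 < q i) -> 0 < eta ->
  exists N, forall n, (N <= n)%N -> exists S : pred 'I_(d ^ n),
    2^-1 <= \sum_(x | S x) fw w x /\
    forall x, S x -> [/\
      fw w x * expR (- (n%:R * (relent w p + eta))) <= fw p x,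
      fw p x <= fw w x * expR (- (n%:R * (relent w p - eta))),
      fw w x * expR (- (n%:R * (relent w q + eta))) <= fw q x &
      fw q x <= fw w x * expR (- (n%:R * (relent w q - eta)))].
Proof.
move=> w0 w1 wp wq eta0.
pose h p i := ln (w i / p i) - relent w p.
have wh p' : \sum_i w i * h p' i = 0.
  by under eq_bigr do rewrite mulrBr; rewrite sumrB -mulr_suml w1 mul1r subrr.
pose V p := (\sum_i w i * h p i ^+ 2) / eta ^+ 2.
(* Beyond this N the two Chebyshev bounds V p / n and V q / n add up to at most one half. *)
pose N := (Num.truncn (2 * (V p + V q))).+1.
exists N => n Nn.
have n0 : (0 < n)%N by apply: leq_trans Nn.
have n0' : 0 < n%:R :> R by rewrite ltr0n.
pose good p := [pred x : 'I_(d ^ n) | `|hsum (h p) (dig x)| <= n%:R * eta].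
(* Words of weight zero are discarded because the change of measure by likelihood ratios holds only
   for positive weight. *)
exists (fun x => [&& 0 < fw w x, good p x & good q x]); split; last first.
  have main p' : (forall i, 0 < w i -> 0 < p' i) -> forall x : 'I_(d ^ n), 0 < fw w x -> good p' x ->
      fw w x * expR (- (n%:R * (relent w p' + eta))) <= fw p' x /\
      fw p' x <= fw w x * expR (- (n%:R * (relent w p' - eta))).
    move=> wp' x fx; rewrite /= ler_norml => /andP[g1 g2].
    rewrite /fw (fw_expR w0 wp' fx).
    have e : \sum_(i <- dig x) ln (w i / p' i) = hsum (h p') (dig x) + n%:R * relent w p'.
      rewrite /hsum /h sumrB big_const_seq count_predT size_dig iter_addr addr0 mulr_natl.
      by rewrite subrK.
    by rewrite !(ler_pM2l fx) !ler_expR e !lerN2 mulrDr mulrBr; split; lra.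
  move=> x /and3P[fx gp gq].
  have [h1 h2] := main p wp x fx gp; have [h3 h4] := main q wq x fx gq.
  by split.
have c1 := chebyshev_fw w0 w1 (wh p) eta0 n0.
have c2 := chebyshev_fw w0 w1 (wh q) eta0 n0.
have := sum_fw w n; rewrite w1 expr1n => s1.
have hN : V p / n%:R + V q / n%:R <= 2^-1.
  rewrite -mulrDl ler_pdivrMr //.
  have Vp : 0 <= 2 * (V p + V q).
    rewrite mulr_ge0 // addr_ge0 // divr_ge0 ?sqr_ge0 // sumr_ge0 // => i _;
    by rewrite mulr_ge0 ?sqr_ge0.
  have /andP[_ hV] := truncn_itv Vp.
  have : 2 * (V p + V q) <= n%:R by apply: ltW (lt_le_trans hV _); rewrite ler_nat.
  lra.
have : 1 <= \sum_(x : 'I_(d ^ n) | [&& 0 < fw w x, good p x & good q x]) fw w x +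
   (\sum_(x : 'I_(d ^ n) | n%:R * eta < `|hsum (h p) (dig x)|) fw w x +
    \sum_(x : 'I_(d ^ n) | n%:R * eta < `|hsum (h q) (dig x)|) fw w x).
  rewrite -{1}s1 big_mkcond [X in X + _]big_mkcond [X in _ + (X + _)]big_mkcond [X in _ + (_ + X)]big_mkcond /=.
  rewrite -!big_split /=; apply: ler_sum => x _.
  have fx : 0 <= fw w x by exact: fw_ge0.
  rewrite /=; case: (ltrP 0 (fw w x)) => f0 /=; last first.
    have -> : fw w x = 0 by apply/eqP; rewrite eq_le f0 fx.
    by rewrite !if_same !addr0.
  by do 2!case: lerP => _ /=; rewrite ?addr0 ?add0r // lerDl.
rewrite /V in hN; lra.
Qed.

End LargeDeviations.

(** * Exponential tilting *)

Section Tilting.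
Variable R : realType.

Lemma continuous_sum_fun (I : finType) (F : I -> R -> R) :
  (forall i, continuous (F i)) -> continuous (fun u => \sum_i F i u).
Proof.
move=> h u; rewrite /continuous_at; have -> : (fun u => \sum_i F i u) = \sum_i F i by apply/funext => v; rewrite fct_sumE.
by elim/big_ind2: _ => [|? ? ? ?|i _]; [exact: cvg_cst|exact: cvgD|exact: h].
Qed.

Lemma ge0_closure (k : R -> R) : continuous k -> (forall s, 0 < s < 1 -> 0 <= k s) ->
  forall s, 0 <= s <= 1 -> 0 <= k s.
Proof.
move=> ck h s /andP[s0 s1]; rewrite leNgt; apply/negP => ks.
have : \forall x \near s, k x < 0 by apply: (cvgr_lt _ (ck s)).
move=> /nbhs_ballP [e /= e0 he].
pose t := Num.min e 1; have t0 : 0 < t by rewrite lt_min e0 ltr01.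
have te : t <= e by rewrite ge_min lexx.
have t1 : t <= 1 by rewrite ge_min lexx orbT.
have := he (s + t * (2^-1 - s)); rewrite /ball /= opprD addrA subrr sub0r normrN normrM (gtr0_norm t0).
have hs : `|2^-1 - s| <= 2^-1 by rewrite ler_norml; lra.
have : t * `|2^-1 - s| < e by apply: le_lt_trans (ler_wpM2l (ltW t0) hs) _; lra.
move=> hb /(_ hb); rewrite ltNge => /negP; apply; apply: h.
have e1 : s + t * (2^-1 - s) = (1 - t) * s + t * 2^-1 by ring.
have h1 : 0 <= (1 - t) * s by rewrite mulr_ge0 // subr_ge0.
have h2 : (1 - t) * s <= (1 - t) * 1 by rewrite ler_wpM2l // subr_ge0.
by rewrite e1; lra.
Qed.

Section Tilt.
Variables (d : nat) (g l : 'I_d -> R).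
Hypotheses (g0 : forall i, 0 <= g i) (gpos : exists i, 0 < g i).

(** Partition function of the exponential family with base weights [g] and statistic [l]; [tmean],
    the mean of [l] at parameter u, is the derivative of ln [Zt]. *)
Definition Zt (u : R) : R := \sum_i g i * expR (u * l i).
Definition tilt (u : R) (i : 'I_d) : R := g i * expR (u * l i) / Zt u.
Definition tmean (u : R) : R := \sum_i tilt u i * l i.

Lemma Zt_gt0 u : 0 < Zt u.
Proof.
have [i gi] := gpos; rewrite /Zt (bigD1 i) //=; apply: ltr_pwDl.
  by rewrite mulr_gt0 ?expR_gt0.
by apply: sumr_ge0 => j _; rewrite mulr_ge0 ?expR_ge0.
Qed.

Lemma tilt_ge0 u i : 0 <= tilt u i.
Proof. by rewrite divr_ge0 ?mulr_ge0 ?expR_ge0 // ltW // Zt_gt0. Qed.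
Lemma tilt_sum u : \sum_i tilt u i = 1.
Proof. by rewrite -mulr_suml divff // gt_eqF // Zt_gt0. Qed.
Lemma tilt_supp u i : 0 < tilt u i -> 0 < g i.
Proof. by rewrite !lt0r g0 andbT => /andP[h _]; apply: contra h => /eqP h; rewrite /tilt h !mul0r. Qed.

(** On the support of [g] the reference p is itself an unnormalised member of the family, with
    parameter a. One formula thus covers both relative entropies of a tilt: only a changes. *)
Lemma relent_tilt (p : 'I_d -> R) (a u : R) :
  (forall i, 0 < g i -> p i = g i * expR (a * l i)) ->
  relent (tilt u) p = (u - a) * tmean u - ln (Zt u).
Proof.
move=> hp; have -> : (u - a) * tmean u - ln (Zt u) =
    \sum_i tilt u i * ((u - a) * l i - ln (Zt u)).
  under eq_bigr do rewrite mulrBr; rewrite sumrB -mulr_suml tilt_sum mul1r mulr_sumr.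
  by congr (_ - _); apply: eq_bigr => i _; rewrite mulrCA.
apply: eq_bigr => i _; have [->|gi] := eqVneq (tilt u i) 0; first by rewrite !mul0r.
have gp : 0 < g i by apply: (@tilt_supp u); rewrite lt0r gi tilt_ge0.
congr (_ * _); rewrite hp // /tilt.
have -> : g i * expR (u * l i) / Zt u / (g i * expR (a * l i)) = expR ((u - a) * l i) / Zt u.
  by rewrite mulrBl expRB; field; rewrite !gt_eqF ?expR_gt0 ?Zt_gt0.
by rewrite ln_div ?posrE ?expR_gt0 ?Zt_gt0 // expRK.
Qed.

Lemma Zt_continuous : continuous Zt.
Proof.
apply: continuous_sum_fun => i u; apply: cvgM; first exact: cvg_cst.
apply: (continuous_cvg _ (@continuous_expR R _)).
by apply: cvgM; [exact: cvg_id|exact: cvg_cst].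
Qed.
Lemma lnZt_continuous : continuous (fun u => ln (Zt u)).
Proof.
move=> u; apply: (continuous_cvg _ (continuous_ln (Zt_gt0 u))).
exact: Zt_continuous.
Qed.
Lemma tmean_continuous : continuous tmean.
Proof.
apply: continuous_sum_fun => i u; apply: cvgM; last exact: cvg_cst.
apply: cvgM.
  apply: cvgM; first exact: cvg_cst.
  apply: (continuous_cvg _ (@continuous_expR R _)).
  by apply: cvgM; [exact: cvg_id|exact: cvg_cst].
by apply: cvgV; [rewrite gt_eqF // Zt_gt0|exact: Zt_continuous].
Qed.
Lemma tiltent_continuous (a : R) : continuous (fun u : R => (u - a) * tmean u - ln (Zt u)).
Proof.
move=> u; apply: cvgB; last exact: lnZt_continuous.
apply: cvgM; last exact: tmean_continuous.
by apply: cvgB; [exact: cvg_id|exact: cvg_cst].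
Qed.
End Tilt.

Lemma powR_tilt (p q t : R) : 0 < p -> 0 < q ->
  p `^ t * q `^ (1 - t) = q * expR (t * ln (p / q)).
Proof.
move=> p0 q0; rewrite /powR !gt_eqF // -{2}(lnK (_ : q \in Num.pos)) ?posrE //.
by rewrite -!expRD ln_div ?posrE //; congr expR; ring.
Qed.

(* The optimal measure is the tilt [p^t q^(1-t)] whose relative entropy to [p] is [lam]; if there is none, a far tilt followed by a coin of weight [e^-c] does almost as well. *)
Lemma source_tilt d (p q : 'I_d -> R) (lam b eta : R) :
  (forall i, 0 <= p i) -> (forall i, 0 <= q i) -> \sum_i p i = 1 ->
  (forall i, 0 < p i -> 0 < q i) -> 0 < lam -> 0 < eta ->
  (forall t, 1 < t -> b * (t - 1) <= ln (\sum_i p i `^ t * q i `^ (1 - t)) + t * lam) ->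
  exists w c, [/\ forall i, 0 <= w i, \sum_i w i = 1, forall i, 0 < w i -> 0 < p i,
    0 <= c & relent w p + c <= lam /\ b - eta <= relent w q + c].
Proof.
move=> p0 q0 p1 pq lam0 eta0 hb.
pose l i := ln (p i / q i).
have ppos : exists i, 0 < p i.
  apply: contrapT => /forallNP h; have : \sum_i p i <= 0.
    by apply: sumr_le0 => i _; rewrite leNgt; apply/negP.
  by rewrite p1 ler10.
(* With t = u + 1 the sum of p^t q^(1-t) is the partition function for base p and statistic ln (p /
   q). *)
have Zb u : 0 < u -> b * u <= ln (Zt p l u) + (u + 1) * lam.
  move=> u0; have := hb (u + 1); rewrite addrK ltrDr => /(_ u0).
  suff -> : \sum_i p i `^ (u + 1) * q i `^ (1 - (u + 1)) = Zt p l u by [].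
  apply: eq_bigr => i _; have [->|pi] := eqVneq (p i) 0.
    by rewrite powR0 ?mul0r // gt_eqF // ltr_wpDl // ltW.
  have pp : 0 < p i by rewrite lt0r pi p0.
  rewrite powR_tilt //; last exact: pq.
  rewrite mulrDl mul1r expRD lnK ?posrE ?divr_gt0 ?pq // mulrCA.
  by rewrite [q i * _]mulrC divfK ?gt_eqF ?pq // mulrC.
have hI u : relent (tilt p l u) p = (u - 0) * tmean p l u - ln (Zt p l u).
  by apply: relent_tilt => // i _; rewrite mul0r expR0 mulr1.
have hJ u : relent (tilt p l u) q = (u - -1) * tmean p l u - ln (Zt p l u).
  apply: relent_tilt => // i pi; rewrite mulN1r expRN lnK ?posrE ?divr_gt0 ?pq //.
  by rewrite invf_div mulrCA divff ?mulr1 // gt_eqF.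
have Ige0 u : 0 <= relent (tilt p l u) p.
  apply: relent_ge0 => //; [exact: tilt_ge0|exact: tilt_sum|by rewrite p1|].
  by move=> i; exact: tilt_supp.
have fin u c : 0 <= c -> relent (tilt p l u) p + c <= lam -> b - eta <= relent (tilt p l u) q + c ->
  exists w c, [/\ forall i, 0 <= w i, \sum_i w i = 1, forall i, 0 < w i -> 0 < p i,
    0 <= c & relent w p + c <= lam /\ b - eta <= relent w q + c].
  move=> c0 h1 h2; exists (tilt p l u), c; split=> //; [exact: tilt_ge0|exact: tilt_sum|].
  by move=> i; exact: tilt_supp.
(* A far tilt at u1 loses lam / u1 = eta in the second exponent, exactly the loss allowed. *)
pose u1 := lam / eta; have u10 : 0 < u1 by rewrite divr_gt0.
have [hu|hu] := lerP (relent (tilt p l u1) p) lam.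
  apply: (fin u1 (lam - relent (tilt p l u1) p)); rewrite ?subr_ge0 //.
    by rewrite addrC subrK.
  have := Zb _ u10; have := Ige0 u1; rewrite !hJ !hI subr0 opprK mulrDl mul1r.
  set X := tmean _ _ _; set L := ln _ => h1 h2.
  have h3 : u1 * (b - lam - X) <= lam by lra.
  have : b - lam - X <= eta.
    rewrite -(ler_pM2l u10); have -> : u1 * eta = lam by rewrite /u1 divfK ?gt_eqF.
    exact: h3.
  lra.
have cI := tiltent_continuous (d := d) (g := p) (l := l) p0 ppos (a := 0).
have I0 : (0 - 0) * tmean p l 0 - ln (Zt p l 0) = 0.
  rewrite subrr mul0r sub0r /Zt; under eq_bigr do rewrite mul0r expR0 mulr1.
  by rewrite p1 ln1 oppr0.
have [||u uin hu2] := IVT (f := fun u : R => (u - 0) * tmean p l u - ln (Zt p l u)) (v := lam) (ltW u10).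
- exact: continuous_subspaceT.
- by rewrite I0 -hI ge_min le_max (ltW lam0) (ltW hu) orbT.
have u0 : 0 < u.
  move: uin; rewrite in_itv /= lt_neqAle => /andP[-> _]; rewrite andbT eq_sym.
  by apply: contraTneq lam0 => u0; rewrite -hu2 u0 I0 ltxx.
apply: (fin u 0) => //; first by rewrite hI hu2 addr0.
have := Zb _ u0; move: hu2; rewrite addr0 hJ subr0 opprK.
set X := tmean _ _ _; set L := ln _ => h1 h2.
(* Since u X - L = lam, the hypothesis at u + 1 reads b - lam <= X, while the relative entropy to q
   is lam + X. *)
have h3 : u * (b - lam) <= u * X by lra.
rewrite ler_pM2l // in h3; rewrite mulrDl mul1r; lra.
Qed.

(* Here the optimal tilt has [s] in [0, 1]: either its relative entropy to [p] is [lam], or [s = 0]. *)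
Lemma target_tilt d (p q : 'I_d -> R) (lam b r r' : R) :
  (forall i, 0 <= p i) -> (forall i, 0 <= q i) -> (exists i, 0 < p i /\ 0 < q i) ->
  0 < lam -> 0 < b -> 0 < r' < r ->
  (forall s, 0 < s < 1 -> - r * ln (\sum_i p i `^ s * q i `^ (1 - s)) <= b * (1 - s) + lam * s) ->
  exists w, [/\ forall i, 0 <= w i, \sum_i w i = 1,
    forall i, 0 < w i -> 0 < p i /\ 0 < q i,
    r' * relent w p <= lam & r' * relent w q <= b].
Proof.
move=> p0 q0 [i0 [pi0 qi0]] lam0 b0 /andP[r'0 r'r] hs.
(* Base weights: q restricted to the support of p, so that the tilt at s is proportional to p^s
   q^(1-s), also at the endpoints. *)
pose g i := if 0 < p i then q i else 0; pose l i := ln (p i / q i).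
have g0 i : 0 <= g i by rewrite /g; case: ifP.
have gP i : 0 < g i -> 0 < p i /\ 0 < q i by rewrite /g; case: ifP; rewrite ?ltxx.
have gpos : exists i, 0 < g i by exists i0; rewrite /g pi0.
have r0 : 0 < r by apply: lt_trans r'r.
have cl := lnZt_continuous (d := d) (g := g) (l := l) g0 gpos.
(* The endpoints are reached by continuity: s = 0 may be the optimal tilt, and s = 1 is the other
   end of the intermediate value argument. *)
have Zs : forall s, 0 <= s <= 1 -> 0 <= b * (1 - s) + lam * s + r * ln (Zt g l s).
  apply: ge0_closure.
    move=> s; apply: cvgD; last by apply: cvgM; [exact: cvg_cst|exact: cl].
    apply: cvgD; apply: cvgM; try exact: cvg_cst; last exact: cvg_id.
    by apply: cvgB; [exact: cvg_cst|exact: cvg_id].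
  move=> s s01; have := hs s s01; have /andP[s0 s1] := s01.
  suff -> : \sum_i p i `^ s * q i `^ (1 - s) = Zt g l s by lra.
  apply: eq_bigr => i _; rewrite /g; case: ltP => [pi|pi].
    have [->|qi] := eqVneq (q i) 0; first by rewrite powR0 ?mulr0 ?mul0r // subr_eq0 gt_eqF.
    by rewrite powR_tilt // lt0r qi q0.
  have -> : p i = 0 by apply/eqP; rewrite eq_le pi p0.
  by rewrite powR0 ?mul0r // gt_eqF.
have hJ u : relent (tilt g l u) q = (u - 0) * tmean g l u - ln (Zt g l u).
  by apply: relent_tilt => // i gi; rewrite mul0r expR0 mulr1 /g; have [-> _] := gP _ gi.
have hI u : relent (tilt g l u) p = (u - 1) * tmean g l u - ln (Zt g l u).
  apply: relent_tilt => // i gi; have [pi qi] := gP _ gi.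
  by rewrite mul1r lnK ?posrE ?divr_gt0 // /g pi mulrCA divff ?mulr1 // gt_eqF.
have fin s : 0 <= s < 1 -> r' * relent (tilt g l s) p <= lam -> 
   (s = 0) \/ r' * relent (tilt g l s) p = lam ->
  exists w, [/\ forall i, 0 <= w i, \sum_i w i = 1,
    forall i, 0 < w i -> 0 < p i /\ 0 < q i,
    r' * relent w p <= lam & r' * relent w q <= b].
  move=> /andP[s0 s1] h1 h2; exists (tilt g l s); split=> //.
  - exact: tilt_ge0.
  - exact: tilt_sum.
  - by move=> i /(tilt_supp g0) /gP.
  have s10 : 0 < 1 - s by rewrite subr_gt0.
  have h3 : 0 <= b * (1 - s) + lam * s + r * ln (Zt g l s) by apply: Zs; rewrite s0 ltW.
  have h4 : 0 <= b * (1 - s) + lam * s + r' * ln (Zt g l s).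
    have [L0|L0] := lerP 0 (ln (Zt g l s)).
      by rewrite addr_ge0 ?addr_ge0 ?mulr_ge0 // ltW.
    by apply: le_trans h3 _; rewrite lerD2l ler_wnM2r // ltW.
  rewrite -(ler_pM2r s10).
  (* The tilt is characterised by this identity: (1 - s) D(w | q) + s D(w | p) = - ln Z_s. Knowing
     D(w | p), or s = 0, it yields the bound on D(w | q). *)
  have e : (1 - s) * relent (tilt g l s) q + s * relent (tilt g l s) p = - ln (Zt g l s).
    by rewrite hI hJ; ring.
  have -> : r' * relent (tilt g l s) q * (1 - s) = - (r' * ln (Zt g l s)) - s * (r' * relent (tilt g l s) p).
    have -> : ln (Zt g l s) = - ((1 - s) * relent (tilt g l s) q + s * relent (tilt g l s) p).
      by rewrite e opprK.
    ring.
  case: h2 => [s00|->]; last by lra.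
  by move: h4; rewrite s00; lra.
have [h0|h0] := lerP (r' * relent (tilt g l 0) p) lam.
  by apply: (fin 0); rewrite ?lexx ?ltr01 //; left.
(* Strictness comes from r' < r. It keeps the crossing point away from s = 1, where division by 1 -
   s would fail. *)
have h1 : r' * relent (tilt g l 1) p < lam.
  have := Zs 1; rewrite ler01 lexx subrr mulr0 add0r mulr1 => /(_ isT).
  rewrite hI subrr mul0r sub0r mulrN; move: (ln _) => L hL.
  have [L0|L0] := lerP 0 L; first by have := mulr_ge0 (ltW r'0) L0; lra.
  have : r * L < r' * L by rewrite ltr_nM2r.
  lra.
have cI := tiltent_continuous (d := d) (g := g) (l := l) g0 gpos (a := 1).
have [||u] := IVT (f := fun u : R => r' * ((u - 1) * tmean g l u - ln (Zt g l u))) (v := lam) (@ler01 R).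
- by apply: continuous_subspaceT => u; apply: cvgM; [exact: cvg_cst|exact: cI].
- by rewrite -!hI ge_min le_max (ltW h0) (ltW h1) orbT.
rewrite in_itv /= -hI => /andP[u0 u1] hu.
apply: (fin u); [|by rewrite hu|by right].
rewrite u0 lt_neqAle u1 andbT; apply/eqP => u11.
by move: h1; rewrite -u11 hu ltxx.
Qed.

End Tilting.

(** * Tests on blocks *)

Section Blocks.
Variable R : realType.
Local Notation C := R[i].

Lemma tensmxA_cast m n p (e : (m * (n * p) = m * n * p)%N) (A : 'M[C]_m) (B : 'M[C]_n) (D : 'M[C]_p) :
  tensmx (tensmx A B) D = castmx (e, e) (tensmx A (tensmx B D)).
Proof.
apply/matrixP => x y; rewrite castmxE.
case: (mxtens_indexP x) => xy z; case: (mxtens_indexP xy) => i j.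
case: (mxtens_indexP y) => xy' z'; case: (mxtens_indexP xy') => i' j'.
have co (a : 'I_m) (b : 'I_n) (c : 'I_p) : cast_ord (esym e) (mxtens_index (mxtens_index (a, b), c)) =
    mxtens_index (a, mxtens_index (b, c)).
  by apply: val_inj => /=; rewrite mulnDl mulnA addnA.
by rewrite !co !tensmxE mulrA.
Qed.

Lemma tensmx_castr m n n' (e : n = n') (e' : (m * n = m * n')%N) (A : 'M[C]_m) (B : 'M[C]_n) :
  tensmx A (castmx (e, e) B) = castmx (e', e') (tensmx A B).
Proof. by case: n' / e e' => e'; rewrite !castmx_id. Qed.

(** The two dimensions are equal but not convertible. One cast serves all matrices A, so both states
    of a pair are transported together. *)
Lemma ntensD d a b : exists e : (d ^ a * d ^ b = d ^ (a + b))%N, forall A : 'M[C]_d,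
  ntensmx A (a + b) = castmx (e, e) (tensmx (ntensmx A a) (ntensmx A b)).
Proof.
have e : (d ^ a * d ^ b = d ^ (a + b))%N by rewrite expnD.
exists e => A; case: a e => [|a] e.
  rewrite ntensmx0 (tens_scalar1mx (ntensmx A b)) castmx_comp castmx_id //.
elim: a e => [|a IH] e.
  case: b e => [|b] e.
    rewrite ntensmx1 ntensmx0 (@tens_mx_scalar C d d 1 A) scale1r castmx_comp.
    by apply/matrixP => i j; rewrite castmxE; congr (A _ _); apply: val_inj.
  rewrite ntensmx1; apply/matrixP => i j; rewrite castmxE.
  by congr (tensmx _ _ _ _); apply: val_inj.
have e1 : (d ^ a.+1 * d ^ b = d ^ (a.+1 + b))%N by rewrite expnD.
have e2 : (d * (d ^ a.+1 * d ^ b) = d * d ^ (a.+1 + b))%N by rewrite e1.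
have e3 : (d * (d ^ a.+1 * d ^ b) = d * d ^ a.+1 * d ^ b)%N by rewrite mulnA.
transitivity (tensmx A (ntensmx A (a.+1 + b))); first by [].
rewrite (IH e1) (tensmx_castr _ e2) ntensS (tensmxA_cast e3) castmx_comp.
by congr (castmx (_, _) _); exact: eq_irrelevance.
Qed.

Lemma ntensM d k n : exists e : ((d ^ k) ^ n = d ^ (n * k))%N, forall A : 'M[C]_d,
  ntensmx A (n * k) = castmx (e, e) (ntensmx (ntensmx A k) n).
Proof.
have e : ((d ^ k) ^ n = d ^ (n * k))%N by rewrite -expnM mulnC.
exists e => A; case: n e => [|n] e.
  by rewrite mul0n in e *; rewrite !ntensmx0 castmx_id.
elim: n e => [|n IH] e.
  have := @ntensD d k 0 => -[e0 h0].
  move: e; rewrite mul1n => e; rewrite ntensmx1 castmx_id //.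
have e1 : ((d ^ k) ^ n.+1 = d ^ (n.+1 * k))%N by rewrite -expnM mulnC.
have [e2 h2] := @ntensD d k (n.+1 * k).
have e3 : (d ^ k * (d ^ k) ^ n.+1 = d ^ k * d ^ (n.+1 * k))%N by rewrite e1.
transitivity (ntensmx A (k + n.+1 * k)); first by [].
rewrite h2 (IH e1) (tensmx_castr _ e3) castmx_comp ntensS.
by congr (castmx (_, _) _); exact: eq_irrelevance.
Qed.

Definition has_test d (rho sigma : 'M[C]_d) (x y : R) :=
  exists T, [/\ psm T, psm (1%:M - T), x <= rtr (rho *m T) & rtr (sigma *m T) <= y].

Lemma has_test_cast d d' (e : d = d') (rho sigma : 'M[C]_d) x y :
  has_test rho sigma x y -> has_test (castmx (e, e) rho) (castmx (e, e) sigma) x y.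
Proof. by case: d' / e; rewrite !castmx_id. Qed.

Lemma tens_spec m n (U : 'M[C]_m) (V : 'M[C]_n) f g :
  tensmx (spec U f) (spec V g) =
  spec (tensmx U V) (fun x => f (mxtens_unindex x).1 * g (mxtens_unindex x).2).
Proof. by rewrite spec.unlock -!tensmx_mul tens_dg hc_tens. Qed.

Lemma tens_psd m n (A : 'M[C]_m) (B : 'M[C]_n) : psm A -> psm B -> psm (tensmx A B).
Proof.
move=> /psd_spec [U [f [hU -> f0]]] /psd_spec [V [g [hV -> g0]]]; rewrite tens_spec.
have hUV : unit_mx (tensmx U V) by rewrite /unit_mx hc_tens tensmx_mul hU hV tens1.
by apply/(spec_psdP hUV) => x; rewrite mulr_ge0.
Qed.

Lemma tens_tr m n (A : 'M[C]_m) (B : 'M[C]_n) : \tr (tensmx A B) = \tr A * \tr B.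
Proof.
rewrite /mxtrace big_tens mulr_suml; apply: eq_bigr => i _; rewrite mulr_sumr.
by apply: eq_bigr => j _; rewrite tensmxE.
Qed.

Lemma has_test_tens d d' (rho sigma : 'M[C]_d) (rho' sigma' : 'M[C]_d') x y :
  density rho' -> density sigma' ->
  has_test rho sigma x y -> has_test (tensmx rho rho') (tensmx sigma sigma') x y.
Proof.
move=> [_ tr] [_ ts] [T [hT hT1 hx hy]]; exists (tensmx T 1%:M).
have e (X : 'M[C]_d) (Y : 'M[C]_d') : \tr Y = 1 -> rtr (tensmx X Y *m tensmx T 1%:M) = rtr (X *m T).
  by move=> tY; rewrite tensmx_mul mulmx1 rtr.unlock tens_tr tY mulr1.
split; rewrite ?e //; first by apply: tens_psd => //; exact: psd1.
have -> : 1%:M - tensmx T 1%:M = tensmx (1%:M - T) 1%:M :> 'M[C]_(d * d').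
  by rewrite -tens1; apply/matrixP => i j; rewrite !mxE mulrBl.
by apply: tens_psd => //; exact: psd1.
Qed.

(** A test on n blocks of k copies ignores the remaining r copies, so every number of copies can be
    treated. *)
Lemma has_test_blocks d k n r (rho sigma : 'M[C]_d) x y :
  density rho -> density sigma ->
  has_test (ntensmx (ntensmx rho k) n) (ntensmx (ntensmx sigma k) n) x y ->
  has_test (ntensmx rho (n * k + r)) (ntensmx sigma (n * k + r)) x y.
Proof.
move=> hr hs h; have [e1 h1] := ntensM d k n; have [e2 h2] := ntensD d (n * k) r.
rewrite !h2 !h1; apply: has_test_cast; apply: has_test_tens; try exact: ntens_dens.
exact: has_test_cast.
Qed.

Lemma qf_row n (A U : 'M[C]_n) i : qf A (row i U) = complex.Re ((U *m A *m hc U) i i).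
Proof.
rewrite qf.unlock -!row_mul; congr complex.Re; rewrite !mxE.
by apply: eq_bigr => j _; rewrite !hcE !mxE.
Qed.

Lemma diag_qf n (A U : 'M[C]_n) i : herm A -> (U *m A *m hc U) i i = (qf A (row i U))%:C.
Proof.
move=> hA; rewrite qf_row; apply: real_Re.
by rewrite -hcE !hcM hcK -hA mulmxA.
Qed.

Lemma qf_ntens_row d (A U : 'M[C]_d) n x : herm A ->
  qf (ntensmx A n) (row x (ntensmx U n)) = @fw d R (fun i => qf A (row i U)) n x.
Proof.
move=> hA; rewrite qf_row ntens_hc -!ntens_mul ntens_diag /fw.
transitivity (complex.Re ((\prod_(i <- dig x) qf A (row i U))%:C)); last by [].
congr complex.Re; rewrite rmorph_prod; apply: eq_bigr => i _; exact: diag_qf.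
Qed.

End Blocks.

(** * Achievability *)

Section Achievability.
Variable R : realType.
Local Notation C := R[i].

(** With k + 1 = m^2 a square, the crude bound ln m <= m already gives 2 d m, which is small against
    m^2 / 2 <= k once m >= 4 d / e. *)
Lemma ln_pow_small (d : nat) (e : R) : 0 < e -> exists k, (0 < k)%N /\
  ln ((k.+1 ^ d)%:R) <= k%:R * e.
Proof.
move=> e0; pose m := (Num.truncn (4 * d%:R / e)).+2.
have m2 : (2 <= m)%N by [].
have mge : 4 * d%:R / e <= m%:R.
  have /truncn_itv/andP[_ h] : 0 <= 4 * d%:R / e by rewrite divr_ge0 ?mulr_ge0 // ltW.
  by apply: ltW (lt_le_trans h _); rewrite ler_nat.
have m0 : 0 < m%:R :> R by rewrite ltr0n.
have mm : (m ^ 2).-1.+1 = (m ^ 2)%N by rewrite prednK // expn_gt0.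
exists (m ^ 2).-1; split.
  by rewrite -ltnS mm (@leq_trans 4) // -[4%N]/(2 ^ 2)%N leq_exp2r.
rewrite mm -expnM natrX lnXn // -(mulr_natl (ln _)) natrM.
have hln : ln m%:R <= m%:R :> R by apply: ltW; exact: ln_sublinear.
have hk : m%:R ^+ 2 / 2 <= (m ^ 2).-1%:R :> R.
  have : ((m ^ 2).-1.+1)%:R = m%:R ^+ 2 :> R by rewrite mm natrX.
  rewrite -natr1 => h.
  have h2 : 2 <= m%:R :> R by rewrite (ler_nat R 2).
  have h4 : 2 * 2 <= m%:R ^+ 2 :> R by rewrite expr2 ler_pM.
  lra.
apply: (@le_trans _ _ (2 * d%:R * m%:R)).
  by apply: ler_wpM2l; rewrite ?mulr_ge0.
apply: (@le_trans _ _ (m%:R ^+ 2 / 2 * e)); last by apply: ler_wpM2r => //; exact: ltW.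
have -> : m%:R ^+ 2 / 2 * e = m%:R / 2 * (m%:R * e) by ring.
have -> : 2 * d%:R * m%:R = m%:R / 2 * (4 * d%:R) :> R by field.
apply: ler_wpM2l; first by rewrite divr_ge0.
by rewrite -ler_pdivrMr.
Qed.

Lemma rtr_ntens_test d (A W : 'M[C]_d) n (S : pred 'I_(d ^ n)) : herm A -> unit_mx W ->
  rtr (ntensmx A n *m spec (ntensmx W n) (fun x => (S x)%:R)) =
  \sum_(x | S x) fw (fun i => qf A (row i W)) x.
Proof.
move=> hA hW; rewrite rtr_mul_spec [RHS]big_mkcond; apply: eq_bigr => x _.
by rewrite qf_ntens_row //; case: (S x); rewrite ?mul1r ?mul0r.
Qed.

Lemma sub_row0 d (rho sigma W : 'M[C]_d) q i : psm rho -> unit_mx W -> sigma = spec W q ->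
  (rho <= sigma)%MS -> q i = 0 -> qf rho (row i W) = 0.
Proof.
move=> hr hW es /submxP [D eD] qi.
have -> : rho = sigma *m hc D.
  by rewrite (psd_herm hr) eD hcM es -(spec_herm W q).
by rewrite qf.unlock mulmxA es (row_spec hW) qi rmorph0 scale0r !mul0mx mxE.
Qed.

(* Tests for blocks of [k] copies, with [k] so large that the pinching loss is negligible. *)
Lemma source_tests d (rho sigma : 'M[C]_d) (lam b kappa : R) :
  density rho -> density sigma -> (rho <= sigma)%MS -> 0 < lam -> 0 < b -> 0 < kappa < 1 ->
  (forall t, 1 < t -> b <= ln (sandQ t rho sigma) / (t - 1) + t / (t - 1) * lam) ->
  exists N, forall n, (N <= n)%N ->
    has_test (ntensmx rho n) (ntensmx sigma n)
      (expR (- (lam * n%:R))) (expR (- ((1 - kappa) * b * n%:R))).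
Proof.
move=> hr hs sub lam0 b0 /andP[k0 k1] hb.
have pr := density_psd hr; have ps := density_psd hs.
pose k' := kappa / 4; have k'0 : 0 < k' by rewrite divr_gt0.
have k'1 : k' < 4^-1 by rewrite /k' -[ltRHS]mul1r ltr_pM2r.
have [k [kpos hk]] := @ln_pow_small d (k' / 2 * lam) (mulr_gt0 (divr_gt0 k'0 (ltr0n _ 2)) lam0).
have kR0 : 0 < k%:R :> R by rewrite ltr0n.
have [W [q [hW eW hQ]]] := pinching_ntens k pr ps.
pose p i := qf (ntensmx rho k) (row i W).
have dk := ntens_dens k hr; have dsk := ntens_dens k hs.
have p0 i : 0 <= p i by apply: psd_qf; exact: density_psd.
have q0 : forall i, 0 <= q i.
  by apply/(spec_psdP hW); rewrite -eW; exact: density_psd.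
have p1 : \sum_i p i = 1 by rewrite -(rtr_qf hW) (density_rtr dk).
have q1 : \sum_i q i = 1 by rewrite -(rtr_spec hW) -eW (density_rtr dsk).
have pq i : 0 < p i -> 0 < q i.
  move=> pi; rewrite lt0r q0 andbT; apply: contraTneq pi => qi.
  by rewrite /p (sub_row0 (density_psd dk) hW eW (ntens_sub k sub) qi) ltxx.
pose eta := Num.min (k%:R * k' * lam / 4) (k' * k%:R * b / 2).
have eta0 : 0 < eta by rewrite lt_min !divr_gt0 ?mulr_gt0.
have eta1 : eta <= k%:R * k' * lam / 4 by rewrite ge_min lexx.
have eta2 : eta <= k' * k%:R * b / 2 by rewrite ge_min lexx orbT.
pose lam' := k%:R * (1 - k' / 2) * lam.
have lam'0 : 0 < lam' by rewrite !mulr_gt0 //; lra.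
pose b' := k%:R * (1 - k') * b.
(* The pinching loss t ln v is proportional to t, as is the term with lambda; it fits between the
   factors 1 - k' and 1 - k' / 2 of lambda. Since ln Q >= 0, a factor 1 - k' in front of it may be
   dropped. *)
have hyp t : 1 < t -> b' * (t - 1) <= ln (\sum_i p i `^ t * q i `^ (1 - t)) + t * lam'.
  move=> t1; have t10 : 0 < t - 1 by rewrite subr_gt0.
  have := hQ t t1; set S := \sum_i _; set v := _%:R => hS.
  have v0 : 0 < v by rewrite ltr0n expn_gt0.
  have sQ := sandQ_ge1 t1 hr hs sub; set Q := sandQ t rho sigma in sQ hS.
  have Q0 : 0 < Q by apply: lt_le_trans sQ.
  have S0 : 0 < S.
    have := lt_le_trans (exprn_gt0 k Q0) hS; rewrite pmulr_rgt0 // powR_gt0 //.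
  have {}hS : k%:R * ln Q <= t * ln v + ln S.
    rewrite -(ln_powR v t) -lnM ?posrE ?powR_gt0 // mulr_natl -lnXn //.
    by rewrite ler_ln ?posrE ?exprn_gt0 // mulr_gt0 ?powR_gt0.
  have hv : t * ln v <= t * (k%:R * (k' / 2 * lam)).
    by apply: ler_wpM2l => //; apply: ltW; apply: lt_trans t1.
  have L0 : 0 <= ln Q by exact: ln_ge0.
  have h1 : b * (t - 1) <= ln Q + t * lam.
    have := hb t t1; rewrite -/Q -(ler_pM2r t10) mulrDl divfK ?gt_eqF //.
    by rewrite mulrAC divfK ?gt_eqF.
  have h2 : k%:R * (1 - k') * (b * (t - 1)) <= k%:R * (1 - k') * (ln Q + t * lam).
    by apply: ler_wpM2l => //; rewrite mulr_ge0 //; lra.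
  have h3 : k%:R * (1 - k') * ln Q <= k%:R * ln Q.
    by apply: ler_wpM2r => //; apply: ler_piMr => //; lra.
  rewrite /b' /lam'.
  have e1 : k%:R * (1 - k') * b * (t - 1) = k%:R * (1 - k') * (b * (t - 1)) by ring.
  have e2 : k%:R * (1 - k') * (ln Q + t * lam) = k%:R * (1 - k') * ln Q + t * (k%:R * (1 - k') * lam) by ring.
  have e3 : t * (k%:R * (1 - k' / 2) * lam) = t * (k%:R * (1 - k') * lam) + t * (k%:R * (k' / 2 * lam)) by field.
  rewrite e1 e3; lra.
have [w [c [w0 w1 wp c0 [hI hJ]]]] := source_tilt p0 q0 p1 pq lam'0 eta0 hyp.
have wq i : 0 < w i -> 0 < q i by move=> /wp; exact: pq.
have [N0 typ] := typical_set w0 w1 wp wq eta0.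
(* The first term absorbs the probability one half of the typical set, the second the incomplete
   last block. *)
pose x0 := Num.max (4 * ln 2 / (k%:R * k' * lam)) (2 * k')^-1.
pose N1 := maxn N0 (Num.truncn x0).+1.
exists (N1 * k)%N => n Nn.
pose n0 := (n %/ k)%N.
have n0N : (N1 <= n0)%N by rewrite leq_divRL.
have n0x : x0 <= n0%:R.
  have x00 : 0 <= x0 by rewrite le_max; apply/orP; right; rewrite invr_ge0 mulr_ge0 // ltW.
  have /andP[_ h] := truncn_itv x00; apply: ltW (lt_le_trans h _).
  by rewrite ler_nat (leq_trans _ n0N) // leq_maxr.
have n0a : ln 2 <= n0%:R * (k%:R * k' * lam / 4).
  have : 4 * ln 2 / (k%:R * k' * lam) <= n0%:R by apply: le_trans n0x; rewrite le_max lexx.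
  by rewrite ler_pdivrMr ?mulr_gt0 // => h; lra.
have n0b : 1 <= n0%:R * (2 * k').
  have : (2 * k')^-1 <= n0%:R by apply: le_trans n0x; rewrite le_max lexx orbT.
  by rewrite -[_^-1]mul1r ler_pdivrMr ?mulr_gt0.
have [S [hS1 hS2]] := typ n0 (leq_trans (leq_maxl _ _) n0N).
rewrite (divn_eq n k); apply: has_test_blocks => //; rewrite -/n0 -(divn_eq n k).
pose T := spec (ntensmx W n0) (fun x => (S x)%:R).
have hWn := ntens_unit n0 hW.
have ec : 0 < expR (- (c * n0%:R)) by exact: expR_gt0.
have ec1 : expR (- (c * n0%:R)) <= 1 by rewrite expR_le1 oppr_le0 mulr_ge0.
(* The coin of weight exp(- c) per block multiplies the typical projection and lowers both
   acceptance probabilities equally. *)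
exists ((expR (- (c * n0%:R)))%:C *: T).
have hT : psm T by apply/(spec_psdP hWn) => x; rewrite ler0n.
have nle : n0%:R * k%:R <= n%:R :> R by rewrite -natrM ler_nat leq_divM.
have nge : n%:R <= (n0%:R + 1) * k%:R :> R.
  by rewrite natr1 -natrM ler_nat ltnW // ltn_ceil.
split.
- by apply: psdZ => //; exact: ltW.
- rewrite /T specZ -(spec1 hWn) (specB (ntensmx W n0)); apply/(spec_psdP hWn) => x.
  by rewrite subr_ge0; case: (S x); rewrite ?mulr1 ?mulr0.
- rewrite -scalemxAr rtrZ rtr_ntens_test //; last exact: psd_herm (density_psd dk).
  have h1 : 2^-1 * expR (- (n0%:R * (relent w p + eta))) <= \sum_(x | S x) fw p x.
    apply: (@le_trans _ _ (\sum_(x | S x) fw w x * expR (- (n0%:R * (relent w p + eta))))).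
      by rewrite -mulr_suml; apply: ler_wpM2r => //; exact: expR_ge0.
    by apply: ler_sum => x /hS2 [].
  apply: le_trans (ler_wpM2l (ltW ec) h1).
  have -> : 2^-1 = expR (- ln 2) :> R by rewrite expRN lnK // posrE.
  rewrite -!expRD ler_expR.
  have hh : n0%:R * (relent w p + c) <= n0%:R * lam' by apply: ler_wpM2l.
  have hh2 : n0%:R * eta <= n0%:R * (k%:R * k' * lam / 4) by apply: ler_wpM2l.
  have hh3 : lam * (n0%:R * k%:R) <= lam * n%:R by apply: ler_wpM2l => //; exact: ltW.
  have e1 : n0%:R * lam' = lam * (n0%:R * k%:R) - 2 * (n0%:R * (k%:R * k' * lam / 4)).
    by rewrite /lam'; field.
  have e2 : n0%:R * (relent w p + c) + n0%:R * eta = n0%:R * (relent w p + eta) + c * n0%:R by ring.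
  lra.
rewrite -scalemxAr rtrZ rtr_ntens_test //; last exact: psd_herm (density_psd dsk).
have eq : (fun i => qf (ntensmx sigma k) (row i W)) = q.
  by apply/funext => i; rewrite eW qf_spec_row.
rewrite eq.
have h1 : \sum_(x | S x) fw q x <= expR (- (n0%:R * (relent w q - eta))).
  apply: (@le_trans _ _ (\sum_(x | S x) fw w x * expR (- (n0%:R * (relent w q - eta))))).
    by apply: ler_sum => x /hS2 [].
  rewrite -mulr_suml -[leRHS]mul1r; apply: ler_wpM2r; first exact: expR_ge0.
  have <- : \sum_(x : 'I_((d ^ k) ^ n0)) fw w x = 1 by rewrite sum_fw w1 expr1n.
  rewrite big_mkcond; apply: ler_sum => x _; case: ifP => // _; exact: fw_ge0.
apply: (le_trans (ler_wpM2l (ltW ec) h1)); rewrite -expRD ler_expR.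
have hh : n0%:R * (b' - eta) <= n0%:R * (relent w q + c) by apply: ler_wpM2l.
have hh2 : n0%:R * eta <= n0%:R * (k' * k%:R * b / 2) by apply: ler_wpM2l.
have kb : 0 <= (1 - kappa) * b by rewrite mulr_ge0 ?(ltW b0) // subr_ge0 ltW.
have hh3 : (1 - kappa) * b * n%:R <= (1 - kappa) * b * ((n0%:R + 1) * k%:R) by apply: ler_wpM2l.
have hh4 : k%:R * b * 1 <= k%:R * b * (n0%:R * (2 * k')) by apply: ler_wpM2l => //; rewrite mulr_ge0 // ltW.
have hh5 : 0 <= kappa * b * k%:R by rewrite !mulr_ge0 // ltW.
have e1 : n0%:R * (b' - eta) = n0%:R * k%:R * b - 2 * (n0%:R * (k' * k%:R * b / 2)) - n0%:R * eta.
  by rewrite /b'; field.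
have e2 : (1 - kappa) * b * ((n0%:R + 1) * k%:R) = n0%:R * k%:R * b
    - 4 * (n0%:R * (2 * k') * (k%:R * b) / 2) + k%:R * b - kappa * b * k%:R.
  by rewrite /k'; field.
have e3 : n0%:R * (relent w q + c) = n0%:R * (relent w q - eta) + n0%:R * eta + c * n0%:R by ring.
have e4 : n0%:R * (k' * k%:R * b / 2) = k%:R * b * (n0%:R * (2 * k')) / 4 by field.
lra.
Qed.

(* [m = floor (r'' n)] copies are reached; the prepared state is the target typical set, conditioned. *)
Lemma target_states d (rho sigma U : 'M[C]_d) p q (lam b r r'' : R) :
  density rho -> density sigma -> unit_mx U -> rho = spec U p -> sigma = spec U q ->
  (exists i, 0 < p i /\ 0 < q i) -> 0 < lam -> 0 < b -> 0 < r'' < r ->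
  (forall s, 0 < s < 1 -> - r * ln (\sum_i p i `^ s * q i `^ (1 - s)) <= b * (1 - s) + lam * s) ->
  exists kappa, 0 < kappa < 1 /\ exists N, forall n, (N <= n)%N ->
    let m := Num.truncn (r'' * n%:R) in
    exists mu, [/\ density mu,
      psm (ntensmx rho m - (expR (- (lam * n%:R)))%:C *: mu) &
      forall y, 0 <= y <= expR (- ((1 - kappa) * b * n%:R)) -> psm (ntensmx sigma m - y%:C *: mu)].
Proof.
move=> hr hs hU er es ex lam0 b0 /andP[r0 rr] hyp.
have p0 : forall i, 0 <= p i by apply/(spec_psdP hU); rewrite -er; exact: density_psd.
have q0 : forall i, 0 <= q i by apply/(spec_psdP hU); rewrite -es; exact: density_psd.
have p1 : \sum_i p i = 1 by rewrite -(rtr_spec hU) -er density_rtr.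
have q1 : \sum_i q i = 1 by rewrite -(rtr_spec hU) -es density_rtr.
pose r' := (r'' + r) / 2.
have r'r : 0 < r' < r by rewrite /r'; lra.
have r'0 : 0 < r' by case/andP: r'r.
have r''r' : r'' < r' by rewrite /r'; lra.
have [w [w0 w1 wpq hI hJ]] := target_tilt p0 q0 ex lam0 b0 r'r hyp.
have wp i : 0 < w i -> 0 < p i by case/wpq.
have wq i : 0 < w i -> 0 < q i by case/wpq.
pose x := r'' / r'; have x1 : x < 1 by rewrite ltr_pdivrMr // mul1r.
have x0 : 0 < x by rewrite divr_gt0.
(* Of the slack 1 - x = 4 kappa, one kappa pays for eta, one for ln 2, and one for the weaker
   exponent (1 - kappa) b of the source test. *)
pose kappa := (1 - x) / 4; have kap : 0 < kappa < 1 by rewrite /kappa; lra.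
have kap0 : 0 < kappa by case/andP: kap.
exists kappa; split=> //.
have I0 : 0 <= relent w p by apply: relent_ge0 => //; rewrite p1.
have J0 : 0 <= relent w q by apply: relent_ge0 => //; rewrite q1.
pose c := Num.min lam b; have c0 : 0 < c by rewrite lt_min lam0.
have clam : c <= lam by rewrite ge_min lexx.
have cb : c <= b by rewrite ge_min lexx orbT.
pose eta := kappa * c / r''; have eta0 : 0 < eta by apply: divr_gt0 => //; apply: mulr_gt0.
have [N0 typ] := typical_set w0 w1 wp wq eta0.
pose y0 := Num.max (N0.+1%:R / r'') (ln 2 / (kappa * c)).
exists (Num.truncn y0).+1 => n Nn m.
have ny : y0 <= n%:R.
  have y00 : 0 <= y0 by rewrite le_max divr_ge0 // ltW.
  have /andP[_ h] := truncn_itv y00; apply: ltW (lt_le_trans h _).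
  by rewrite ler_nat.
have n1 : N0.+1%:R <= r'' * n%:R.
  by rewrite mulrC -ler_pdivrMr //; apply: le_trans ny; rewrite le_max lexx.
have n2 : ln 2 <= n%:R * (kappa * c).
  have kc0 : 0 < kappa * c by apply: mulr_gt0.
  by rewrite -(ler_pdivrMr _ _ kc0); apply: le_trans ny; rewrite le_max lexx orbT.
have rn0 : 0 <= r'' * n%:R by rewrite mulr_ge0 // ltW.
have /andP[m1 m2] := truncn_itv rn0; rewrite -/m in m1 m2.
have mN : (N0 <= m)%N.
  by rewrite -ltnS -(ltr_nat R) (le_lt_trans _ m2) // (le_trans _ n1) // ler_nat.
have [S [hS1 hS2]] := typ m mN.
pose tot := \sum_(z | S z) fw w z.
have tot0 : 0 < tot by apply: lt_le_trans hS1.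
pose v z := if S z then fw w z / tot else 0.
have v0 z : 0 <= v z by rewrite /v; case: ifP => // _; rewrite divr_ge0 ?fw_ge0 // ltW.
have hUm := ntens_unit m hU.
have dens_mu : density (spec (ntensmx U m) v).
  split; first by rewrite -psmE; apply/(spec_psdP hUm).
  rewrite (tr_real (psd_tr_real (proj2 (spec_psdP hUm v) v0))) (rtr_spec hUm).
  have -> : \sum_z v z = 1; last by [].
  by rewrite /v -big_mkcond -mulr_suml divff // gt_eqF.
have main (p' : 'I_d -> R) (E y : R) : (forall i, 0 <= p' i) -> 0 <= y -> y <= 2^-1 * expR (- E) ->
    (forall z : 'I_(d ^ m), S z -> fw w z * expR (- E) <= fw p' z) ->
    psm (ntensmx (spec U p') m - y%:C *: spec (ntensmx U m) v).
  move=> p'0 y0' yE hz; rewrite ntens_spec specZ (specB (ntensmx U m)); apply/(spec_psdP hUm) => z.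
  rewrite subr_ge0 /v; case: ifP => Sz; last by rewrite mulr0; exact: fw_ge0.
  apply: le_trans (hz z Sz); rewrite mulrCA; apply: ler_wpM2l; first exact: fw_ge0.
  rewrite ler_pdivrMr //; apply: (le_trans yE); rewrite [leLHS]mulrC.
  apply: ler_wpM2l; last exact: hS1.
  exact: expR_ge0.
have half : 2^-1 = expR (- ln 2) :> R by rewrite expRN lnK // posrE.
have meta : m%:R * eta <= n%:R * (kappa * c).
  apply: (@le_trans _ _ (r'' * n%:R * eta)); first by apply: ler_wpM2r => //; exact: ltW.
  by rewrite le_eqVlt; apply/orP; left; apply/eqP; rewrite /eta; field; rewrite gt_eqF.
have bd (D L : R) : 0 <= D -> r' * D <= L -> c <= L ->
    ln 2 + m%:R * (D + eta) <= (1 - kappa) * L * n%:R.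
  move=> D0 hD cL.
  have h1 : m%:R * D <= r'' * n%:R * D by apply: ler_wpM2r.
  have h2 : r'' * n%:R * D <= x * n%:R * L.
    have -> : r'' * n%:R * D = x * n%:R * (r' * D) by rewrite /x; field; rewrite gt_eqF.
    by apply: ler_wpM2l => //; rewrite mulr_ge0 // ltW.
  have h3 : n%:R * (kappa * c) <= n%:R * (kappa * L) by rewrite !ler_wpM2l // ltW.
  have L0 : 0 <= kappa * n%:R * L 
    by apply: mulr_ge0 (le_trans (ltW c0) cL); apply: mulr_ge0 (ltW kap0) (ler0n _ _).
  have e1 : x = 1 - 4 * kappa by rewrite /kappa; field.
  have e2 : x * n%:R * L = n%:R * L - 4 * (kappa * n%:R * L) by rewrite e1; ring.
  have e3 : n%:R * (kappa * L) = kappa * n%:R * L by ring.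
  have e4 : (1 - kappa) * L * n%:R = n%:R * L - kappa * n%:R * L by ring.
  rewrite mulrDr e4; lra.
exists (spec (ntensmx U m) v); split=> //.
  rewrite er; apply: (main _ (m%:R * (relent w p + eta))) => //.
  - rewrite half -expRD ler_expR.
    have := bd _ _ I0 hI clam; 
    have : 0 <= kappa * lam * n%:R by apply: mulr_ge0 (ler0n _ _); apply: mulr_ge0; exact: ltW.
    have -> : (1 - kappa) * lam * n%:R = lam * n%:R - kappa * lam * n%:R by ring.
    lra.
  - by move=> z /hS2 [].
move=> y /andP[y0' yle]; rewrite es; apply: (main _ (m%:R * (relent w q + eta))) => //.
- apply: (le_trans yle); rewrite half -expRD ler_expR.
  by have := bd _ _ J0 hJ cb; lra.
- by move=> z /hS2 [].
Qed.

Lemma achieve d1 d2 (rho1 sigma1 : 'M[C]_d1) (rho2 sigma2 U : 'M[C]_d2) p q (lam b r r'' : R) :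
  density rho1 -> density sigma1 -> density rho2 -> density sigma2 ->
  (rho1 <= sigma1)%MS -> unit_mx U -> rho2 = spec U p -> sigma2 = spec U q ->
  (exists i, 0 < p i /\ 0 < q i) -> 0 < lam -> 0 < b -> 0 < r'' < r ->
  (forall t, 1 < t -> b <= ln (sandQ t rho1 sigma1) / (t - 1) + t / (t - 1) * lam) ->
  (forall s, 0 < s < 1 -> - r * ln (\sum_i p i `^ s * q i `^ (1 - s)) <= b * (1 - s) + lam * s) ->
  exists N, forall n, (N <= n)%N ->
    let m := Num.truncn (r'' * n%:R) in
    convertible (ntensmx rho1 n) (ntensmx sigma1 n) (ntensmx rho2 m) (ntensmx sigma2 m)
      (1 - expR (- (lam * n%:R))) 0.
Proof.
move=> hr1 hs1 hr2 hs2 sub hU er es ex lam0 b0 rr hb hyp.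
have [kappa [kap [N1 tgt]]] := target_states hr2 hs2 hU er es ex lam0 b0 rr hyp.
have [N2 src] := source_tests hr1 hs1 sub lam0 b0 kap hb.
(* The successor ensures n > 0, so that the test rejects sigma1 with positive probability. *)
exists (maxn N1 N2).+1 => n Nn m.
have [mu [dmu hre hsq]] := tgt n (leq_trans (leq_maxl _ _) (ltnW Nn)).
have [T [hT hT1 hx hy]] := src n (leq_trans (leq_maxr _ _) (ltnW Nn)).
have y1 : rtr (ntensmx sigma1 n *m T) < 1.
  apply: (le_lt_trans hy); rewrite expR_lt1 oppr_lt0 !mulr_gt0 // ?ltr0n; last by case: (n) Nn.
  by rewrite subr_gt0; case/andP: kap.
refine (measure_prepare_convertible (ntens_dens n hr1) (ntens_dens n hs1) (ntens_dens m hr2)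
  (ntens_dens m hs2) dmu hT hT1 y1 hx _ hre).
apply: hsq; rewrite hy andbT; apply: rtr_psdM => //.
by apply: density_psd; exact: ntens_dens.
Qed.

(* Without absolute continuity, [sigma1] is rejected with certainty by a test that [rho1] passes with positive probability, so any number of copies can be prepared. *)
Lemma achieve_unbounded d1 d2 (rho1 sigma1 : 'M[C]_d1) (rho2 sigma2 : 'M[C]_d2) (lam : R) :
  density rho1 -> density sigma1 -> density rho2 -> density sigma2 ->
  ~~ (rho1 <= sigma1)%MS -> 0 < lam ->
  exists N, forall n m, (N <= n)%N ->
    convertible (ntensmx rho1 n) (ntensmx sigma1 n) (ntensmx rho2 m) (ntensmx sigma2 m)
      (1 - expR (- (lam * n%:R))) 0.
Proof.
move=> hr1 hs1 hr2 hs2 nsub lam0.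
have ps := density_psd hs1; have pr := density_psd hr1.
have [V [s [hV es s0]]] := psd_spec ps.
(* The projection on the kernel of sigma1. If rho1 gave it probability zero, rho1 would vanish on
   this kernel and its row space would lie in that of sigma1. *)
pose T := spec V (fun i => (s i == 0)%R%:R).
have hT : psm T by apply/(spec_psdP hV) => i; rewrite ler0n.
have hT1 : psm (1%:M - T).
  rewrite -(spec1 hV) (specB V); apply/(spec_psdP hV) => i.
  by rewrite subr_ge0; case: (s i == 0).
have sT : sigma1 *m T = 0.
  rewrite es (specM hV) -[RHS](scale0r (1%:M : 'M[C]_d1)) -[0 in RHS](rmorph0 (real_complex R)) scalemx1 -(specc hV).
  by congr spec; apply/funext => i; case: eqP => [->|_]; rewrite ?mul0r ?mulr0.
have aT : 0 < rtr (rho1 *m T).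
  rewrite lt0r rtr_psdM // andbT; apply: contraNneq nsub => h0.
  have e0 : T *m rho1 *m T = 0.
    apply: rtr_eq0.
      by have := psdM T pr; rewrite -(psd_herm hT).
    have TT : T *m T = T.
      by rewrite (specM hV); congr spec; apply/funext => i; case: eqP; rewrite ?mulr1 ?mulr0.
    by rewrite rtrC mulmxA TT rtrC.
  have rT : rho1 *m T = 0.
    rewrite -(psd_sqrtE pr); set K := mpow rho1 _.
    have : (hc K *m T) = 0.
      have hK : hc (hc K *m T) *m (hc K *m T) = 0.
        rewrite hcM hcK -(psd_herm hT) !mulmxA -(mulmxA T K) psd_sqrtE //.
      have pK : psm (hc (hc K *m T) *m hc (hc (hc K *m T))) by exact: psdK.
      apply/matrixP => i j; rewrite [RHS]mxE; apply: cn2_eq0.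
      move/matrixP/(_ j j): hK; rewrite [RHS]mxE mxE => hK.
      have : \sum_k cn2 ((hc K *m T) k j) = 0.
        have := congr1 (@complex.Re R) hK; rewrite Re_sum => hK'.
        rewrite -[RHS]hK'; apply: eq_bigr => k _.
        by rewrite hcE mulrC cn2E.
      move/eqP; rewrite psumr_eq0 => [/allP h|k _]; last exact: cn2_ge0.
      by apply/eqP; apply: (h i); rewrite mem_index_enum.
    by rewrite -mulmxA => ->; rewrite mulmx0.
  have -> : rho1 = rho1 *m spec V (fun i => (s i)^-1) *m sigma1.
    rewrite es -mulmxA (specM hV) -[LHS]mulmx1 -(spec1 hV).
    have -> : spec V (fun=> 1) = T + spec V (fun i => (s i)^-1 * s i).
      rewrite /T (specD V); congr spec; apply/funext => i.
      by have [->|si] := eqVneq (s i) 0; rewrite ?mulr0 ?addr0 // mulVf // add0r.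
    by rewrite mulmxDr rT add0r.
  exact: submxMl.
(* Only one copy is tested, so the acceptance probability is constant in n and eventually exceeds
   exp(- lambda n). *)
pose x := - ln (rtr (rho1 *m T)) / lam.
exists (Num.truncn (Num.max x 0)).+1 => n m Nn.
have xn : x <= n%:R.
  have m0 : 0 <= Num.max x 0 by rewrite le_max lexx orbT.
  have /andP[_ h] := truncn_itv m0; apply: ltW (le_lt_trans _ (lt_le_trans h _)).
    by rewrite le_max lexx.
  by rewrite ler_nat.
have ht : has_test (ntensmx rho1 n) (ntensmx sigma1 n) (rtr (rho1 *m T)) 0.
  have h1 : has_test (ntensmx rho1 1) (ntensmx sigma1 1) (rtr (rho1 *m T)) 0.
    by exists T; split=> //; rewrite [ntensmx sigma1 1]/= sT rtr0.
  case: n Nn {xn} => // n _.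
  exact: (@has_test_blocks _ _ 1 1 n _ _ _ _ hr1 hs1 h1).
have [T' [hT' hT1' hx hy]] := ht.
have q0 : rtr (ntensmx sigma1 n *m T') = 0.
  apply/eqP; rewrite eq_le hy; apply: rtr_psdM => //.
  by apply: density_psd; exact: ntens_dens.
have d2m := ntens_dens m hr2; have s2m := ntens_dens m hs2.
apply: (measure_prepare_convertible (ntens_dens n hr1) (ntens_dens n hs1) d2m s2m d2m hT' hT1').
- by rewrite q0.
- apply: le_trans hx; rewrite -[leRHS](lnK (_ : _ \in Num.pos)) ?posrE // ler_expR.
  by move: xn; rewrite /x ler_pdivrMr //; lra.
- by rewrite q0 rmorph0 scale0r subr0; exact: density_psd.
have -> : ntensmx rho2 m - (expR (- (lam * n%:R)))%:C *: ntensmx rho2 m =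
    (1 - expR (- (lam * n%:R)))%:C *: ntensmx rho2 m.
  by rewrite rmorphB rmorph1 scalerBl scale1r.
apply: psdZ; last exact: density_psd.
by rewrite subr_ge0 expR_le1 oppr_le0 mulr_ge0 // ltW.
Qed.

End Achievability.

(** * Convergence of the rates *)

Section Assembly.
Context {R : realType}.
Local Notation C := (R[i]).

Lemma limn_esup_le_eventually (u : (\bar R)^nat) (l : \bar R) : (0 <= l)%E ->
  (forall c : R, (l < c%:E)%E -> exists N, forall n, (N <= n)%N -> (u n <= c%:E)%E) ->
  (limn_esup u <= l)%E.
Proof.
move=> l0 h; case: l l0 h => [l _ h|_ _|//]; last exact: leey.
apply/lee_addgt0Pr => e e0; have [|N hN] := h (l + e); first by rewrite lte_fin ltrDl.
apply: ge_ereal_inf; exists (ereal_sup (u @` [set n | (N <= n)%N])).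
  by exists [set n | (N <= n)%N] => //; exists N.
by apply: ge_ereal_sup => _ [n Nn <-]; exact: hN.
Qed.

Lemma cvge_eventually (u : (\bar R)^nat) (l : \bar R) : (0 <= l)%E ->
  (forall c : R, (l < c%:E)%E -> exists N, forall n, (N <= n)%N -> (u n <= c%:E)%E) ->
  (forall c : R, (c%:E < l)%E -> exists N, forall n, (N <= n)%N -> (c%:E <= u n)%E) ->
  u @ \oo --> l.
Proof.
move=> l0 hu hl; case: l l0 hu hl => [l _ hu hl|_ _ hl|//]; last first.
  apply/cvgeyPge => A; have [N hN] := hl A (ltry A).
  by exists N => // n /= Nn; exact: hN.
have box (e : R) : 0 < e -> exists N, forall n, (N <= n)%N -> ((l - e)%:E <= u n <= (l + e)%:E)%E.
  move=> e0; have [|N1 h1] := hu (l + e); first by rewrite lte_fin ltrDl.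
  have [|N2 h2] := hl (l - e); first by rewrite lte_fin ltrBlDr ltrDl.
  exists (maxn N1 N2) => n; rewrite geq_max => /andP[n1 n2].
  by rewrite h1 // h2.
have fin n (e : R) : ((l - e)%:E <= u n <= (l + e)%:E)%E -> u n \is a fin_num.
  by case: (u n) => [//||]; rewrite ?leye_eq ?leeNy_eq ?andbF.
apply: cvg_EFin.
  have [N hN] := box 1 ltr01.
  by exists N => // n /= Nn; exact: fin (hN n Nn).
apply/cvgrPdist_le => e e0; have [N hN] := box e e0.
exists N => // n /= Nn; have hn := hN n Nn; have fn := fin _ _ hn.
by move: hn; rewrite -(fineK fn) !lee_fin /= ler_distlC.
Qed.

(** The default for a vanishing trace never occurs: under the support inclusion [sandQ] is at least
    one. *)
Lemma sandwichedE n (a : R) (rho sigma : 'M[C]_n) : 1 < a -> density rho -> density sigma ->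
  sandwiched a rho sigma =
  if (rho <= sigma)%MS then (ln (sandQ a rho sigma) / (a - 1))%:E else +oo%E.
Proof.
move=> a1 hr hs; rewrite /sandwiched a1 /=; case: ifPn; first by move=> /negbTE ->.
rewrite negbK => sub; rewrite sub; have := sandQ_ge1 a1 hr hs sub.
rewrite /sandQ rtr.unlock mpow.unlock => q1.
by rewrite gt_eqF // (lt_le_trans ltr01).
Qed.

Lemma petzE n (s : R) (rho sigma : 'M[C]_n) :
  petz s rho sigma =
  if petzQ s rho sigma == 0 then +oo%E else (ln (petzQ s rho sigma) / (s - 1))%:E.
Proof. by rewrite /petz /petzQ rtr.unlock mpow.unlock. Qed.

Lemma petz_real_ge0 n (s : R) (rho sigma : 'M[C]_n) : 0 < s < 1 -> density rho -> density sigma ->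
  0 <= ln (petzQ s rho sigma) / (s - 1).
Proof.
move=> s01 hr hs; have /andP[_ q1] := petzQ_le1 s01 hr hs; have /andP[s0 s1] := s01.
by rewrite mulr_le0 // ?ln_le0 // invr_le0 subr_le0 ltW.
Qed.

Lemma sandQ_real_ge0 n (a : R) (rho sigma : 'M[C]_n) : 1 < a -> density rho -> density sigma ->
  (rho <= sigma)%MS -> 0 <= ln (sandQ a rho sigma) / (a - 1).
Proof.
move=> a1 hr hs sub; apply: divr_ge0; last by rewrite subr_ge0 ltW.
by rewrite ln_ge0 // sandQ_ge1.
Qed.

Lemma coef_gt0 (a s : R) : 1 < a -> 0 < s < 1 -> 0 < a / (a - 1) + s / (1 - s).
Proof.
move=> a1 /andP[s0 s1]; apply: addr_gt0; apply: divr_gt0 => //; rewrite ?subr_gt0 //.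
exact: lt_trans a1.
Qed.

Section Rates.
Variables (d1 d2 : nat) (rho1 sigma1 : 'M[C]_d1) (rho2 sigma2 : 'M[C]_d2) (lam : R).
Hypotheses (hr1 : density rho1) (hs1 : density sigma1).
Hypotheses (hr2 : density rho2) (hs2 : density sigma2) (lam0 : 0 < lam).

Let Rn n := Rstar rho1 sigma1 rho2 sigma2 n (1 - expR (- (lam * n%:R))).
Let rate (t1 t2 : R) := eratio (sandwiched t1 rho1 sigma1 +
                   ((t1 / (t1 - 1) + t2 / (1 - t2)) * lam)%:E)%E (petz t2 rho2 sigma2).

Lemma rate_ge0 (t1 t2 : R) : 1 < t1 -> 0 < t2 < 1 -> (0 <= rate t1 t2)%E.
Proof.
move=> a1 s01; have K0 := coef_gt0 a1 s01; have y0 := petz_real_ge0 s01 hr2 hs2.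
rewrite /rate /eratio; case: ifP => _; first exact: leey.
case: ifP => _; first by case: ifP => _ //; exact: leey.
rewrite petzE; case: ifP => _ /=; first by rewrite invr0 mule0.
apply: mule_ge0; last by rewrite lee_fin invr_ge0.
rewrite sandwichedE //; case: ifPn => [sub|_]; last by rewrite addye // leey.
rewrite -EFinD lee_fin addr_ge0 ?sandQ_real_ge0 //.
by rewrite ltW // mulr_gt0.
Qed.

Lemma Rstar_upper (t1 t2 c : R) : 1 < t1 -> 0 < t2 < 1 -> (rate t1 t2 < c%:E)%E ->
  exists N, forall n, (N <= n)%N -> (Rn n <= c%:E)%E.
Proof.
move=> a1 s01; have K0 := coef_gt0 a1 s01; have y0 := petz_real_ge0 s01 hr2 hs2.
have := rate_ge0 a1 s01; rewrite /rate sandwichedE // petzE /eratio.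
set K := (_ + _) in K0 *; set y := (_ / _) in y0 *.
(* Without the inclusion the numerator is infinite, and by the conventions of [eratio] so is the
   rate, whatever the denominator; it cannot lie below c. *)
case: (boolP (rho1 <= sigma1)%MS) => [sub|_]; last first.
  rewrite addye // eqxx; case: (boolP (petzQ t2 rho2 sigma2 == 0)) => //= _; rewrite eqe.
  by case: ifPn => //= yn0; rewrite gt0_mulye // lte_fin invr_gt0 lt0r yn0.
have conv n m := @converse_bound R d1 d2 rho1 sigma1 rho2 sigma2 t1 t2
  (expR (- (lam * n%:R))) n m a1 s01 sub (expR_gt0 _) hr1 hs1 hr2 hs2.
case: (boolP (petzQ t2 rho2 sigma2 == 0)) => [/eqP q0|qn0].
  rewrite /= => _ c0; exists 0%N => n _; apply: ge_ereal_sup => _ [m hm <-].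
  by have [/(_ q0) -> _] := conv n m hm; rewrite mul0r; exact: ltW.
have q0 : 0 < petzQ t2 rho2 sigma2.
  by rewrite lt0r qn0; case/andP: (petzQ_le1 s01 hr2 hs2).
case: ifPn => // yn0 _ /=; have {yn0} yp : 0 < y.
  by rewrite lt0r y0 andbT; move: yn0; rewrite eqe.
rewrite -EFinD -EFinM lte_fin ltr_pdivrMr // -subr_gt0; set D := _ / _; set gap := (_ - _) => gp.
(* The converse bounds with ln (e / 2); the extra K ln 2 is absorbed by the gap, which grows with
   n. *)
pose x := K * ln 2 / gap.
have ln20 : 0 <= ln 2 :> R by rewrite ln_ge0 // ler1n.
have x0 : 0 <= x by rewrite divr_ge0 ?mulr_ge0 // ltW.
exists (Num.truncn x).+1 => n Nn; have /andP[_ xn] := truncn_itv x0.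
have nx : K * ln 2 <= gap * n%:R.
  rewrite [leRHS]mulrC -ler_pdivrMr //; apply: ltW (lt_le_trans xn _).
  by rewrite ler_nat.
have n0 : 0 < n%:R :> R by rewrite ltr0n; case: (n) Nn.
apply: ge_ereal_sup => _ [m hm <-]; rewrite lee_fin ler_pdivrMr //.
have [_ /(_ q0)] := conv n m hm; rewrite -/K -/y -/D => h.
rewrite -(ler_pM2r yp); apply: (le_trans h).
rewrite ln_div ?posrE ?expR_gt0 // expRK.
move: nx; rewrite /gap mulrBl; lra.
Qed.

(** Zero copies can always be prepared, so the supremum defining [Rstar] is not over the empty set,
    where it would be -oo. *)
Lemma convertible_trivial n : (0 < n)%N ->
  convertible (ntensmx rho1 n) (ntensmx sigma1 n) (ntensmx rho2 0) (ntensmx sigma2 0)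
    (1 - expR (- (lam * n%:R))) 0.
Proof.
move=> n0; set e := expR _.
have e1 : e < 1 by rewrite expR_lt1 oppr_lt0 mulr_gt0 // ltr0n.
have e0 : 0 <= e by exact: expR_ge0.
have h (A : 'M[C]_d1) : density A -> rtr (ntensmx A n *m (e%:C *: 1%:M)) = e.
  by move=> hA; rewrite -scalemxAr mulmx1 rtrZ (density_rtr (ntens_dens n hA)) mulr1.
have c0 : psm (1%:M - e%:C *: 1%:M : 'M[C]_(d2 ^ 0)).
  have -> : 1%:M - e%:C *: 1%:M = (1 - e)%:C *: 1%:M :> 'M[C]_(d2 ^ 0).
    by rewrite rmorphB scalerBl rmorph1 scale1r.
  by apply: psdZ; [rewrite subr_ge0 ltW|exact: psd1].
refine (@measure_prepare_convertible _ _ _ _ _ (e%:C *: 1%:M) _ _ (ntensmx rho2 0) _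
  (ntens_dens n hr1) (ntens_dens n hs1) (ntens_dens 0 hr2) (ntens_dens 0 hs2) (ntens_dens 0 hr2)
  (psdZ e0 (psd1 _ _)) _ _ _ _ _); rewrite ?h //.
have -> : 1%:M - e%:C *: 1%:M = (1 - e)%:C *: 1%:M :> 'M[C]_(d1 ^ n).
  by rewrite rmorphB scalerBl rmorph1 scale1r.
by apply: psdZ; [rewrite subr_ge0 ltW|exact: psd1].
Qed.

Lemma Rstar_ge n m : convertible (ntensmx rho1 n) (ntensmx sigma1 n) (ntensmx rho2 m)
    (ntensmx sigma2 m) (1 - expR (- (lam * n%:R))) 0 -> ((m%:R / n%:R)%:E <= Rn n)%E.
Proof. by move=> h; apply: ereal_sup_ubound; exists m. Qed.

Lemma Rstar_lower (c r : R) : rho2 *m sigma2 = sigma2 *m rho2 -> 0 < r -> c < r ->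
  (forall t1 t2, 1 < t1 -> 0 < t2 < 1 -> (r%:E < rate t1 t2)%E) ->
  exists N, forall n, (N <= n)%N -> (c%:E <= Rn n)%E.
Proof.
move=> hcomm r0 cr hrate.
(* A positive rate strictly between c and r: the gap to c pays for truncating to an integer number
   of copies, the gap to r for the approximations in the tilts and typical sets. *)
pose r'' := (Num.max c 0 + r) / 2.
have cm : Num.max c 0 < r by rewrite gt_max cr.
have m0 : 0 <= Num.max c 0 by rewrite le_max lexx orbT.
have mc : c <= Num.max c 0 by rewrite le_max lexx.
have rr : 0 < r'' < r by rewrite /r''; lra.
have rc : 0 < r'' - c by rewrite /r''; lra.
have rate_reached N : (forall n, (N <= n)%N -> let m := Num.truncn (r'' * n%:R) in
    convertible (ntensmx rho1 n) (ntensmx sigma1 n) (ntensmx rho2 m) (ntensmx sigma2 m)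
      (1 - expR (- (lam * n%:R))) 0) -> exists N, forall n, (N <= n)%N -> (c%:E <= Rn n)%E.
  move=> h; pose x := (r'' - c)^-1; have x0 : 0 <= x by rewrite invr_ge0 ltW.
  exists (maxn N (Num.truncn x).+1) => n; rewrite geq_max => /andP[Nn xn].
  apply: le_trans (Rstar_ge (h n Nn)); rewrite lee_fin.
  have /andP[_ xn'] := truncn_itv x0.
  have n0 : 0 < n%:R :> R by rewrite ltr0n; case: (n) xn.
  have /andP[r''0 _] := rr.
  have hn : 0 <= r'' * n%:R by rewrite mulr_ge0 // ltW.
  have /andP[_ hm] := truncn_itv hn.
  rewrite ler_pdivlMr //.
  have : 1 <= n%:R * (r'' - c).
    rewrite -ler_pdivrMr // mul1r; apply: ltW (lt_le_trans xn' _).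
    by rewrite ler_nat.
  move: hm; rewrite -natr1; lra.
have [sub|nsub] := boolP (rho1 <= sigma1)%MS; last first.
  have [N hN] := achieve_unbounded hr1 hs1 hr2 hs2 nsub lam0.
  by apply: (rate_reached N) => n Nn m; exact: hN.
pose G := [set ln (sandQ t rho1 sigma1) / (t - 1) + t / (t - 1) * lam | t in [set t : R | 1 < t]].
(* As t / (t - 1) >= 1 and the divergence is nonnegative, every source term is at least lambda;
   hence b > 0. *)
have Glam : lbound G lam.
  move=> _ [t /= t1 <-]; rewrite -[leLHS]add0r lerD ?sandQ_real_ge0 //.
  rewrite -[leLHS]mul1r; apply: ler_wpM2r; first exact: ltW.
  by rewrite ler_pdivlMr ?subr_gt0 // mul1r; lra.
have G0 : nonempty G by exists (ln (sandQ 2 rho1 sigma1) / (2 - 1) + 2 / (2 - 1) * lam); exists 2 => //=; rewrite ltr1n.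
pose b := inf G; have b0 : 0 < b by apply: lt_le_trans lam0 _; exact: lb_le_inf.
have hb t : 1 < t -> b <= ln (sandQ t rho1 sigma1) / (t - 1) + t / (t - 1) * lam.
  by move=> t1; apply: ge_inf; [exists lam|exists t].
have [U [p [q [hU er es]]]] := comm_spec (psd_herm (density_psd hr2)) (psd_herm (density_psd hs2)) hcomm.
have p0 : forall i, 0 <= p i by apply/(spec_psdP hU); rewrite -er; exact: density_psd.
have q0 : forall i, 0 <= q i by apply/(spec_psdP hU); rewrite -es; exact: density_psd.
have eQ s : petzQ s rho2 sigma2 = \sum_i p i `^ s * q i `^ (1 - s).
  by rewrite /petzQ er es !(mpow_spec _ _ hU) (specM hU) (rtr_spec hU).
have Qp s : 0 < s < 1 -> 0 < petzQ s rho2 sigma2.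
  move=> s01; have /andP[Q0 _] := petzQ_le1 s01 hr2 hs2; rewrite lt0r Q0 andbT.
  (* With an infinite target divergence and a finite numerator, the rate is 0 by convention, which
     contradicts 0 < r. *)
  apply/eqP => Qe; have := hrate 2 s (_ : 1 < 2) s01; rewrite /rate sandwichedE ?ltr1n // sub.
  rewrite petzE Qe eqxx /eratio /= => /(_ isT); rewrite lte_fin.
  by move/(lt_trans r0); rewrite ltxx.
have ex : exists i, 0 < p i /\ 0 < q i.
  have := Qp 2^-1; rewrite eQ => /(_ _) Q; apply: contrapT => nex.
  have : 0 < \sum_i p i `^ 2^-1 * q i `^ (1 - 2^-1) by apply: Q; lra.
  rewrite big1 ?ltxx // => i _; have [pi|pi] := eqVneq (p i) 0.
    by rewrite pi powR0 ?mul0r // gt_eqF.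
  have [qi|qi] := eqVneq (q i) 0.
    by rewrite qi powR0 ?mulr0 // gt_eqF // subr_gt0; lra.
  by case: nex; exists i; rewrite !lt0r pi qi p0 q0.
have hyp s : 0 < s < 1 -> - r * ln (\sum_i p i `^ s * q i `^ (1 - s)) <= b * (1 - s) + lam * s.
  move=> s01; have /andP[s0 s1] := s01; have s10 : 0 < 1 - s by rewrite subr_gt0.
  rewrite -eQ; set y := ln (petzQ s rho2 sigma2) / (s - 1).
  have y0 : 0 <= y by exact: petz_real_ge0.
  (* The infimum over t_1 is taken with s fixed: clearing the denominator separates the source terms
     from those in s. If y = 0 the rate is infinite, but the left side is then nonpositive. *)
  have yb : r * y - s / (1 - s) * lam <= b.
    apply: lb_le_inf => // _ [t /= t1 <-].
    have S0 := sandQ_real_ge0 t1 hr1 hs1 sub; have K0 := coef_gt0 t1 s01.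
    have Klam := mulr_gt0 K0 lam0; rewrite mulrDl in Klam.
    have [->|yn0] := eqVneq y 0; first by rewrite mulr0; lra.
    have yp : 0 < y by rewrite lt0r yn0.
    have := hrate t s t1 s01; rewrite /rate sandwichedE // sub petzE gt_eqF ?Qp // -/y /eratio.
    rewrite eqe (negbTE yn0) /= -EFinD -EFinM lte_fin ltr_pdivlMr // mulrDl; lra.
  have -> : - r * ln (petzQ s rho2 sigma2) = (r * y - s / (1 - s) * lam) * (1 - s) + lam * s.
    by rewrite /y; field; apply/andP; split; [exact: lt0r_neq0|apply: ltr0_neq0; rewrite subr_lt0].
  by rewrite lerD2r; apply: ler_wpM2r => //; exact: ltW.
have [N hN] := achieve hr1 hs1 hr2 hs2 sub hU er es ex lam0 b0 rr hb hyp.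
exact: rate_reached hN.
Qed.

End Rates.

End Assembly.

Lemma EFin_lt_between (R : realType) (c : R) (l : \bar R) : (c%:E < l)%E ->
  exists2 r : R, c < r & (r%:E < l)%E.
Proof.
case: l => [l||//]; last by exists (c + 1); rewrite ?ltrDl ?ltry.
by rewrite lte_fin => cl; exists ((c + l) / 2); rewrite ?lte_fin; lra.
Qed.

Local Close Scope complex_scope.
Local Open Scope classical_set_scope.

Theorem theorem5 (R : realType) (d1 d2 : nat)
  (rho1 sigma1 : 'M[R[i]]_d1) (rho2 sigma2 : 'M[R[i]]_d2) (lambda : R) :
  density rho1 -> density sigma1 -> density rho2 -> density sigma2 ->
  0 < lambda ->
  let eps := fun n : nat => 1 - expR (- (lambda * n%:R)) in
  let Rn := fun n : nat => Rstar rho1 sigma1 rho2 sigma2 n (eps n) in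
  let bound := fun (D : R -> \bar R) =>
    ereal_inf [set eratio (sandwiched t.1 rho1 sigma1 +
                   ((t.1 / (t.1 - 1) + t.2 / (1 - t.2)) * lambda)%:E)%E
                  (D t.2)
              | t in [set t : R * R | 1 < t.1 /\ 0 < t.2 < 1]] in
  (rho2 *m sigma2 = sigma2 *m rho2 ->
     Rn @ \oo --> bound (fun t2 => petz t2 rho2 sigma2)) /\
  (limn_esup Rn <= bound (fun t2 => petz t2 rho2 sigma2))%E.
Proof.
move=> hr1 hs1 hr2 hs2 lam0 eps Rn bound; set B := bound _.
have B0 : (0 <= B)%E.
  by apply: le_ereal_inf_tmp => _ [t [t1 t2] <-]; exact: rate_ge0.
have upper (c : R) : (B < c%:E)%E -> exists N, forall n, (N <= n)%N -> (Rn n <= c%:E)%E.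
  move=> /ereal_inf_lt [_ [t [t1 t2] <-] tc].
  exact: (Rstar_upper hr1 hs1 hr2 hs2 lam0 t1 t2 tc).
split=> [hcomm|]; last exact: limn_esup_le_eventually.
apply: cvge_eventually => // c cB; have [c0|c0] := ltP c 0.
  (* A negative c is reached with zero copies, whereas the achievability argument needs a positive
     rate. *)
  exists 1%N => n n0; have := Rstar_ge (convertible_trivial hr1 hs1 hr2 hs2 lam0 n0).
  by rewrite mul0r; apply: le_trans; rewrite lee_fin ltW.
have [r cr rB] := EFin_lt_between cB.
apply: (Rstar_lower hr1 hs1 hr2 hs2 lam0 hcomm (le_lt_trans c0 cr) cr) => t1 t2 ht1 ht2.
by apply: (lt_le_trans rB); apply: ereal_inf_lbound; exists (t1, t2).
Qed.
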